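(* Let the potential $W(H)=\sum_{i,j,k\in I^2_N}\omega_{ijk}H_{ij}H_{jk}H_{ki}$ be defined by $\omega_{ijk}$ of the form $$\omega_{ijk}=\begin{cases} e^{\,\epsilon^{ab}(i_a-j_a)(k_b-j_b)\,(x^i+x^j+x^k)}, & \text{for } \epsilon^{ab}(i_a-j_a)(k_b-j_b)>0,\\ 0, & \text{for } \epsilon^{ab}(i_a-j_a)(k_b-j_b)\le 0,\end{cases}$$ where $x^i$ ($i\in I^2_N$) are formal variables. Then the correlator $$\langle\Delta_{i_1,\dots,i_n}\rangle:=\left\langle H_{i_1i_2}H_{i_2i_3}\cdots H_{i_ni_1}\right\rangle=\sum_{k=0}^{\infty}\frac{\beta^k}{k!}\left\langle H_{i_1i_2}H_{i_2i_3}\cdots H_{i_ni_1}\,(W(H))^k\right\rangle_0,$$ where the sequence of points $i_1,\dots,i_n\in I^2_N$ forms the boundary of the polygon $\Delta=\Delta_{i_1,\dots,i_n}$, is for sufficiently large $N$ expressed as a sum over triangulations of $\Delta$ of the following form: $$\langle\Delta_{i_1,\dots,i_n}\rangle=\sum_{\tau\in\text{triangulations of }\Delta}\beta^{|\tau|}\,e^{2\langle\phi_\tau,L(\Delta)\rangle},$$ where $|\tau|$ is the number of triangles in the triangulation $\tau$, and $$\langle\phi_\tau,L(\Delta)\rangle:=\sum_{a\in V(\tau)}\phi_\tau(a)\,x^a$$ is a polynomial whose Newton polyhedron is $\Delta$ and whose coefficients are the values of the characteristic function $\phi_\tau$ of the triangulation $\tau$ at the corresponding triangulation vertices $a\in 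V(\tau)$.
   Context: Index set and matrices. For $N\in\mathbb{N}$ let $I^2_N=\{m=(m_1,m_2)\in\mathbb{Z}^2: |m_1|,|m_2|\le N\}$. One considers Hermitian matrices $H=(H_{ij})_{i,j\in I^2_N}$ of size $(2N+1)^2\times(2N+1)^2$, i.e. $H_{ij}=\overline{H_{ji}}$, with measure $\mathcal{D}H=\prod_i dH_{ii}\prod_{i<j}d\,\mathrm{Re}(H_{ij})\,d\,\mathrm{Im}(H_{ij})$ (for any fixed total order on $I^2_N$). Model and averages. The matrix model is $Z=\int \mathcal{D}H\,\exp\left[-\tfrac12\mathrm{Tr}(H^2)+\beta W(H)\right]$, understood as a formal series in $\beta$: the exponential is expanded in $\beta$ and each coefficient is integrated separately. For a polynomial $P$ in the matrix entries, $$\langle P(H)\rangle_0=\frac{\int \mathcal{D}H\,P(H)\,e^{-\frac12 \mathrm{Tr}(H^2)}}{\int \mathcal{D}H\,e^{-\frac12 \mathrm{Tr}(H^2)}}.$$ The correlator $\langle\cdot\rangle$ without subscript is the formal series in $\beta$ displayed in the claim. Polygon. The sequence $i_1,\dots,i_n\in I^2_N$ consists of the vertices of a fixed polygon $\Delta_{i_1,\dots,i_n}$ (possibly not convex) with vertices in $\mathbb{Z}^2$, listed in clockwise order; there is no summation over $i_1,\dots,i_n$ in the correlator. Antisymmetric symbol. Each index has two components, $i=(i_1,i_2)$; $\epsilon^{ab}$ is the $2\times2$ antisymmetric symbol, with summation over $a,b\in\{1,2\}$, and its sign is chosen ($\epsilon^{21}=1=-\epsilon^{12}$) so that $\epsilon^{ab}(i_a-j_a)(k_b-j_b)>0$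 exactly when $i,j,k$ are the vertices of a non-degenerate triangle in counterclockwise order. Triangulations. A triangulation $\tau$ of $\Delta$ is a decomposition of $\Delta$ into finitely many simplices of dimension 2 (triangles) whose vertices are points of $\mathbb{Z}^2$, such that the intersection of any two of them is their common (possibly empty) face. $V(\tau)$ denotes the set of vertices of $\tau$. Characteristic function. For a vertex $a$ of $\tau$, $\phi_\tau(a)=\sum_{\sigma\ni a}\mathrm{Vol}(\sigma)$, where the sum is over all triangles $\sigma$ of $\tau$ for which $a$ is a vertex and $\mathrm{Vol}$ is the area; $\phi_\tau(a)=0$ for lattice points $a\in\Delta$ that are not vertices of $\tau$. Newton polyhedron. For a polynomial $\sum_a c_a x^a$, where $x^a$ is associated with the lattice point $a=(a_1,a_2)$ (as the Laurent monomial $x_1^{a_1}x_2^{a_2}$), the Newton polyhedron is the convex hull of $\{a: c_a\neq 0\}$.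
   Formalization: The formula holds if W counts each oriented triangle once (summing over all ordered i,j,k turns β into 3β) and τ runs over triangulations having every side of the polygon as an edge; for non-convex Δ the Newton polyhedron is the convex hull of Δ. *)

(* Defs.v *)
From HB Require Import structures.
From mathcomp Require Import all_boot all_order all_algebra.
From mathcomp Require Import finmap.
From mathcomp Require Import all_classical all_reals all_analysis.
From mathcomp Require Import complex.

Set Implicit Arguments.
Unset Strict Implicit.
Unset Printing Implicit Defensive.
Import Order.TTheory GRing.Theory Num.Theory.
Local Open Scope classical_set_scope.
Local Open Scope ring_scope.

Section BelowTheory.
Variable K : finType.
Implicit Types m u v w : {ffun K -> nat}.

Definition below m : seq {ffun K -> nat} :=
  [seq [ffun i => nat_of_ord (u i)] | u : {dffun forall i : K, 'I_(m i).+1}].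

Definition expo_sub m u : {ffun K -> nat} := [ffun i => (m i - u i)%N].

Definition expo_le u m := [forall i, (u i <= m i)%N].

Lemma mem_below m u : (u \in below m) = expo_le u m.
Proof.
apply/mapP/forallP => [[w _ ->] i|le_um]; first by rewrite ffunE -ltnS.
exists [ffun i => Ordinal (le_um i : (u i < (m i).+1)%N)] => [|].
  by rewrite mem_enum.
by apply/ffunP => i; rewrite !ffunE.
Qed.

Lemma below_uniq m : uniq (below m).
Proof.
rewrite map_inj_in_uniq ?enum_uniq // => u v _ _ /ffunP uv.
by apply/ffunP => i; apply/val_inj; have := uv i; rewrite !ffunE.
Qed.

Lemma expo_le_trans u v w : expo_le u v -> expo_le v w -> expo_le u w.
Proof.
by move=> /forallP uv /forallP vw; apply/forallP => i; apply: leq_trans (vw i).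
Qed.

Lemma expo_subr_le u m : expo_le (expo_sub m u) m.
Proof. by apply/forallP => i; rewrite ffunE leq_subr. Qed.

Lemma expo_subK u m : expo_le u m -> expo_sub m (expo_sub m u) = u.
Proof. by move=> /forallP um; apply/ffunP => i; rewrite !ffunE subKn. Qed.

Lemma expo_sub0 m : expo_sub m 0 = m.
Proof. by apply/ffunP => i; rewrite !ffunE subn0. Qed.

End BelowTheory.

(* Formal power series over A in commuting variables indexed by K; the exponents
   are the m : {ffun K -> nat}. *)
Record fps (K : finType) (A : Type) := Fps { fcoef : {ffun K -> nat} -> A }.

Section Fps.
Variables (K : finType) (A : comNzRingType).
Implicit Types (f g h : fps K A) (m u v w : {ffun K -> nat}).

HB.instance Definition _ := gen_eqMixin (fps K A).
HB.instance Definition _ := gen_choiceMixin (fps K A).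

Lemma fpsP f g : (forall m, fcoef f m = fcoef g m) -> f = g.
Proof. by case: f g => [f] [g] /= fg; congr Fps; exact/funext. Qed.

Definition fps_zero : fps K A := Fps (fun=> 0).
Definition fps_opp f : fps K A := Fps (fun m => - fcoef f m).
Definition fps_add f g : fps K A := Fps (fun m => fcoef f m + fcoef g m).
Definition fconst (c : A) : fps K A := Fps (fun m => if m == 0 then c else 0).
Definition fps_mul f g : fps K A :=
  Fps (fun m => \sum_(u <- below m) fcoef f u * fcoef g (expo_sub m u)).

Fact fps_addA : associative fps_add.
Proof. by move=> f g h; apply/fpsP => m /=; rewrite addrA. Qed.
Fact fps_addC : commutative fps_add.
Proof. by move=> f g; apply/fpsP => m /=; rewrite addrC. Qed.
Fact fps_add0 : left_id fps_zero fps_add.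
Proof. by move=> f; apply/fpsP => m /=; rewrite add0r. Qed.
Fact fps_addN : left_inverse fps_zero fps_opp fps_add.
Proof. by move=> f; apply/fpsP => m /=; rewrite addNr. Qed.

HB.instance Definition _ := GRing.isZmodule.Build (fps K A)
  fps_addA fps_addC fps_add0 fps_addN.

Fact fps_mulC : commutative fps_mul.
Proof.
move=> f g; apply/fpsP => m /=.
rewrite (perm_big (map (expo_sub m) (below m))) /=; last first.
  apply: uniq_perm; first exact: below_uniq.
    rewrite map_inj_in_uniq ?below_uniq // => u v.
    rewrite !mem_below => um vm uv.
    by rewrite -(expo_subK um) uv expo_subK.
  move=> u; rewrite mem_below; apply/idP/mapP => [um|[v _ ->]].
    by exists (expo_sub m u); rewrite ?expo_subK // mem_below expo_subr_le.
  exact: expo_subr_le.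
rewrite big_map [LHS]big_seq [RHS]big_seq; apply: eq_bigr => u.
by rewrite mem_below => um; rewrite expo_subK // mulrC.
Qed.

Fact fps_mul1 : left_id (fconst 1) fps_mul.
Proof.
move=> f; apply/fpsP => m /=.
rewrite (bigD1_seq 0) ?below_uniq //=; last first.
  by rewrite mem_below; apply/forallP => i; rewrite ffunE.
rewrite eqxx mul1r expo_sub0 big1 ?addr0 // => u /negPf ->.
by rewrite mul0r.
Qed.

Fact fps_mulDl : left_distributive fps_mul fps_add.
Proof.
move=> f g h; apply/fpsP => m /=; rewrite -big_split /=.
by apply: eq_bigr => u _; rewrite mulrDl.
Qed.

Fact fps_mulA : associative fps_mul.
Proof.
move=> f g h; apply/fpsP => m /=; apply/esym.
transitivity (\sum_(u <- below m) \sum_(v <- below m | expo_le v u)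
    fcoef f v * fcoef g (expo_sub u v) * fcoef h (expo_sub m u)).
  rewrite [LHS]big_seq [RHS]big_seq; apply: eq_bigr => u.
  rewrite mem_below => um; rewrite big_distrl /= -[RHS]big_filter.
  apply/perm_big/uniq_perm; rewrite ?filter_uniq ?below_uniq // => v.
  rewrite mem_filter !mem_below; case: (boolP (expo_le v u)) => //= vu.
  by rewrite (expo_le_trans vu um).
rewrite (exchange_big_dep xpredT) //= [LHS]big_seq [RHS]big_seq.
apply: eq_bigr => v; rewrite mem_below => vm; rewrite big_distrr /=.
rewrite -big_filter.
rewrite (perm_big (map (fun w => [ffun i => v i + w i]%N : {ffun K -> nat})
                       (below (expo_sub m v)))) /=; last first.
  apply: uniq_perm; first by rewrite filter_uniq ?below_uniq.
    rewrite map_inj_in_uniq ?below_uniq // => w w' _ _ /ffunP ww.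
    by apply/ffunP => i; have := ww i; rewrite !ffunE => /addnI.
  move=> u; rewrite mem_filter mem_below; apply/andP/mapP.
    move=> [/forallP vu /forallP um]; exists (expo_sub u v).
      rewrite mem_below; apply/forallP => i.
      by rewrite !ffunE leq_sub2r.
    by apply/ffunP => i; rewrite !ffunE subnKC.
  move=> [w]; rewrite mem_below => /forallP wm ->; split; apply/forallP => i.
    by rewrite ffunE leq_addr.
  rewrite ffunE; have := wm i; rewrite ffunE leq_subRL //.
  exact: (forallP vm).
rewrite big_map; apply: eq_bigr => w _; rewrite -mulrA; congr (_ * _).
congr (fcoef g _ * fcoef h _); apply/ffunP => i; rewrite !ffunE.
  by rewrite addKn.
by rewrite subnDA.
Qed.

Fact fps_1_neq0 : fconst 1 != 0.
Proof.
apply/eqP => /(congr1 (fun f => fcoef f 0)) /= /eqP.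
by rewrite eqxx oner_eq0.
Qed.

HB.instance Definition _ := GRing.Zmodule_isComNzRing.Build (fps K A)
  fps_mulA fps_mulC fps_mul1 fps_mulDl fps_1_neq0.

Definition fvar (i : K) : fps K A :=
  Fps (fun m => if m == [ffun j => (j == i) : nat] then 1 else 0).

End Fps.

(* Intended for f with zero constant term; then f ^+ n has no term of degree
   less than n, so that the sum over n may stop at the degree of m. *)
Definition fexp (K : finType) (F : fieldType) (f : fps K F) : fps K F :=
  Fps (fun m => \sum_(n < (\sum_i m i)%N.+1) fcoef (f ^+ n) m / n`!%:R).

(* orient i j k = eps^{ab} (i_a - j_a) (k_b - j_b) with eps^{21} = 1 = -eps^{12};
   positive iff i, j, k is a counterclockwise nondegenerate triangle, in which
   case it is twice the area. *)
Definition orient (A : pzRingType) (i j k : A * A) : A :=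
  (i.2 - j.2) * (k.1 - j.1) - (i.1 - j.1) * (k.2 - j.2).

Record idx (N : nat) := Idx {
  idx_val :> int * int;
  idx_valP : (`|idx_val.1| <= N%:Z) && (`|idx_val.2| <= N%:Z) }.

HB.instance Definition _ N := [isSub for @idx_val N].
HB.instance Definition _ N := [Countable of idx N by <:].

Definition idx_code N (i : idx N) : 'I_(N + N).+1 * 'I_(N + N).+1 :=
  (inord (absz ((val i).1 + N%:Z)), inord (absz ((val i).2 + N%:Z))).
Definition idx_decode N (c : 'I_(N + N).+1 * 'I_(N + N).+1) : option (idx N) :=
  insub (c.1%:Z - N%:Z, c.2%:Z - N%:Z).

Fact idx_codeK N : pcancel (@idx_code N) (@idx_decode N).
Proof.
have shift (z : int) : `|z| <= N%:Z ->
    (@inord (N + N) (absz (z + N%:Z)) : nat)%:Z - N%:Z = z.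
  move=> zN; have := zN; rewrite ler_norml => /andP[Nz zN'].
  have z0 : 0 <= z + N%:Z by rewrite -lerBlDr sub0r.
  rewrite inordK ?gez0_abs ?addrK // ltnS -lez_nat gez0_abs //.
  by rewrite PoszD lerD2r.
case=> [[a b] /= abN]; have /andP[/= aN bN] := abN.
rewrite /idx_decode /idx_code /= !shift //.
by rewrite insubT //=; congr Some; apply/val_inj.
Qed.

HB.instance Definition _ N := fintype.isFinite.Build (idx N) (pcan_enumP (@idx_codeK N)).

Section Plane.
Variable R : realType.

Definition plane := (R^o * R^o)%type.

Definition pt (a : int * int) : plane := (a.1%:~R, a.2%:~R).

Definition hull (X : set plane) : set plane :=
  smallest (fun Y : set plane => @convex_set R plane Y) X.

Definition conv_pts (s : {fset int * int}) : set plane :=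
  hull (pt @` [set` s]).

(* Consecutive pairs, cyclically: (i_1,i_2), ..., (i_{n-1},i_n), (i_n,i_1). *)
Definition sides (T : Type) (s : seq T) : seq (T * T) := zip s (rot 1 s).

Definition segment (e : (int * int) * (int * int)) : set plane :=
  hull [set pt e.1; pt e.2].

Definition boundary (s : seq (int * int)) : set plane :=
  [set p | exists2 e, e \in sides s & segment e p].

(* Winding number of the closed polyline s about a point p off the polyline:
   signed count of its crossings with the horizontal ray going from p to the
   right, upward crossings being positive. *)
Definition winding (s : seq (int * int)) (p : plane) : int :=
  \sum_(e <- sides s)
    (if [&& (pt e.1).2 <= p.2, p.2 < (pt e.2).2 &
            0 < orient (pt e.1) (pt e.2) p] then 1
     else if [&& (pt e.2).2 <= p.2, p.2 < (pt e.1).2 &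
            orient (pt e.1) (pt e.2) p < 0] then -1
     else 0).

Definition region (s : seq (int * int)) : set plane :=
  boundary s `|` [set p | winding s p != 0].

(* Distinct sides meet at most in a common endpoint. Flat (180 degree) vertices
   are allowed. *)
Definition simple_polygon (s : seq (int * int)) : Prop :=
  [/\ (3 <= size s)%N, uniq s &
      forall e f, e \in sides s -> f \in sides s -> e <> f ->
      forall p, segment e p -> segment f p ->
      exists a, [/\ p = pt a, (a == e.1) || (a == e.2) &
                    (a == f.1) || (a == f.2)]].

(* Off a simple polygon the winding number is 0 outside and, inside, constantly
   -1 or 1 according to the orientation. *)
Definition clockwise_polygon (s : seq (int * int)) : Prop :=
  simple_polygon s /\
  forall p, region s p -> ~ boundary s p -> winding s p = -1.

(* Half the absolute determinant, which does not depend on the enumeration of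
   the vertices; only used for s of cardinal 3. *)
Definition area (s : {fset int * int}) : R :=
  `|orient (nth (0, 0) s 0) (nth (0, 0) s 1) (nth (0, 0) s 2)|%:~R / 2.

(* A triangle is given by its set of vertices. The last clause says that the
   polyline s is the boundary of the triangulation: each side [i_l, i_{l+1}] is
   an edge of it (in the model, H_{i_l i_{l+1}} is contracted with exactly one
   triangle edge). It is automatic if the sides contain no lattice points besides
   their endpoints and s has no flat vertex. *)
Definition triangulations (s : seq (int * int)) : set {fset {fset int * int}} :=
  [set tau : {fset {fset int * int}} |
    [/\ forall t, t \in tau -> #|` t| = 3%N /\ area t != 0,
        \bigcup_(t in [set` tau]) conv_pts t = region s,
        forall t t', t \in tau -> t' \in tau ->
          conv_pts t `&` conv_pts t' = conv_pts (t `&` t')%fset &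
        forall e, e \in sides s ->
          exists2 t, t \in tau & (e.1 \in t) && (e.2 \in t)]].

Definition vertices (tau : {fset {fset int * int}}) : {fset int * int} :=
  (\bigcup_(t <- tau) t)%fset.

Definition phi (tau : {fset {fset int * int}}) (a : int * int) : R :=
  \sum_(t <- tau | a \in t) area t.

(* Polynomials in the symbols x^a, a in Z^2, by their coefficients. *)
Definition phi_poly (tau : {fset {fset int * int}}) : {fsfun int * int -> R with 0} :=
  [fsfun a in vertices tau => phi tau a].

Definition newton (P : {fsfun int * int -> R with 0}) : set plane :=
  hull (pt @` [set a | P a != 0]).

End Plane.

Section Model.
Variables (R : realType) (N : nat).
Local Open Scope complex_scope.
Local Notation C := R[i].
Local Notation I := (idx N).

Definition idx_lt (i j : I) := (enum_rank i < enum_rank j)%N.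

(* The Hermitian matrix with real coordinates y: y (i, i) is the diagonal entry,
   and for i < j the real and imaginary parts of H_ij are y (i, j), y (j, i). *)
Definition herm (y : I * I -> R) (i j : I) : C :=
  if i == j then (y (i, i))%:C
  else if idx_lt i j then y (i, j) +i* y (j, i)
  else y (j, i) -i* y (i, j).

Fixpoint iter_integral (s : seq (I * I)) (F : (I * I -> R) -> R)
    (y : I * I -> R) : R :=
  if s is c :: s' then
    \int[@lebesgue_measure R]_(t in [set: R])
      iter_integral s' F (fun c' => if c' == c then t else y c')
  else F y.

(* The integral against DH of a real function of the Hermitian matrix, as an
   iterated Lebesgue integral over all coordinates. It is only applied to
   polynomials times a Gaussian, for which the order is irrelevant. *)
Definition DH_integral (F : (I -> I -> C) -> R) : R :=
  iter_integral (enum {: I * I}) (fun y => F (herm y)) (fun=> 0).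

Definition trace_sq (H : I -> I -> C) : C := \sum_i \sum_j H i j * H j i.

Definition gauss (H : I -> I -> C) : R := expR (- (2^-1 * complex.Re (trace_sq H))).

Definition gauss_moment (P : (I -> I -> C) -> C) : C :=
  DH_integral (fun H => complex.Re (P H) * gauss H)
  +i* DH_integral (fun H => complex.Im (P H) * gauss H).

(* The zeroth-order average <P(H)>_0. *)
Definition average0 (P : (I -> I -> C) -> C) : C :=
  gauss_moment P / gauss_moment (fun=> 1).

(* <.>_0 extended coefficientwise to integrands valued in C[[x^i : i in I]]. *)
Definition faverage0 (P : (I -> I -> C) -> fps I C) : fps I C :=
  Fps (fun m => average0 (fun H => fcoef (P H) m)).

Definition omega (i j k : I) : fps I C :=
  let c := orient (val i) (val j) (val k) in
  if 0 < c then fexp (c%:~R * (fvar C i + fvar C j + fvar C k)) else 0.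

(* The sum over all ordered triples; each oriented triangle occurs three times,
   through its cyclic rotations. *)
Definition potential (H : I -> I -> C) : fps I C :=
  \sum_i \sum_j \sum_k omega i j k * fconst I (H i j * H j k * H k i).

(* The sum over triples up to cyclic rotation (represented by the rotation that
   starts with its least element): each oriented triangle occurs once. *)
Definition cyclic_potential (H : I -> I -> C) : fps I C :=
  \sum_i \sum_(j | idx_lt i j) \sum_(k | idx_lt i k)
    omega i j k * fconst I (H i j * H j k * H k i).

(* Formal series in beta over C[[x]]: the single variable is indexed by tt. *)
Definition beta : fps unit (fps I C) := fvar (fps I C) tt.

Definition correlator (W : (I -> I -> C) -> fps I C) (v : seq I) :
    fps unit (fps I C) :=
  Fps (fun m => let k := m tt in
    fconst I ((k`!)%:R^-1) *
    faverage0 (fun H =>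
      fconst I (\prod_(e <- sides v) H e.1 e.2) * W H ^+ k)).

(* x^a for a in Z^2; the value 0 off the index set is never used once the index
   set contains the polygon. *)
Definition xvar (a : int * int) : fps I C :=
  if insub a is Some i then fvar C i else 0.

Definition poly_series (P : {fsfun int * int -> R with 0}) : fps I C :=
  \sum_(a <- finsupp P) fconst I ((P a)%:C) * xvar a.

End Model.

(* Main.v *)
Require Import Defs.
From HB Require Import structures.
From mathcomp Require Import all_boot all_order all_algebra.
From mathcomp Require Import finmap.
From mathcomp Require Import all_classical all_reals all_analysis.
From mathcomp Require Import measurable_realfun complex ring lra zify.
Import Order.TTheory GRing.Theory Num.Theory.
Import numFieldNormedType.Exports.
Local Open Scope classical_set_scope.
Local Open Scope ring_scope.

(* By Wick's theorem with <H_ij H_kl>_0 = delta_il delta_jk, the coefficient of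
   beta^k is a sum over k-tuples of counterclockwise triangles, weighted by the
   number of ways to match every directed edge of the triangles and of the
   clockwise polygon with an edge running in the opposite direction. If a matching
   exists, the winding numbers of the triangles add up to minus that of the
   polygon, which is 1 inside and 0 outside. So the triangles do not overlap and
   cover the polygon; then no directed edge occurs twice, the matching is unique,
   and the triangles meet face to face. Conversely, the directed edges of a
   triangulation cancel along inner edges and against the sides of the polygon.
   The k! orderings of a triangulation absorb 1/k!, and the product of the weights
   exp(2 area(T) (x^i + x^j + x^k)) is exp(2 phi_tau). In the unrestricted
   potential a triangle occurs in its three rotations, which turns beta into
   3 beta. *)

Set Implicit Arguments.
Unset Strict Implicit.
Unset Printing Implicit Defensive.

(** * Gaussian moments in one variable *)

Section Gaussian1D.
Variable R : realType.
Implicit Types (a x : R) (n : nat).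
Local Notation mu := (@lebesgue_measure R).

(** The polygon's winding number is controlled only off its boundary, while the facts to prove
    concern midpoints of edges and points shared by triangles, which may lie on it. Geometric claims
    are therefore turned into open conditions and tested at nearby generic points, off finitely many
    lines. Sums of winding numbers are decisive because all triangles have the same orientation: the
    terms are nonnegative, so a sum 0 or 1 leaves at most one nonzero term. With mixed orientations
    terms could cancel and triangles could overlap. Both directions pass through one multiset
    identity: the list of all directed edges is a permutation of its reversal. It depends neither on
    the order of the triangles nor on a chosen matching. That no edge repeats is then a consequence
    of geometry, which is why a moment is 0 or 1 and never a larger number of matchings. Analysis is
    confined to a recursion between one-variable Gaussian moments: matrix entries are complex linear
    forms in independent real coordinates, and Wick's theorem follows algebraically from that
    recursion and the covariances. *)

Definition gmono a n x : R := x ^+ n * expR (- (a * x ^+ 2)).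

Definition gmom a n : R := \int[mu]_x gmono a n x.

Lemma is_derive_gmono a n x :
  is_derive x 1 (gmono a n) (n%:R * gmono a n.-1 x - 2 * a * gmono a n.+1 x).
Proof.
have d1 : is_derive x (1:R) (fun y : R^o => y ^+ n) (n%:R * x ^+ n.-1).
  have -> : (fun y : R^o => y ^+ n) = (@id R^o) ^+ n.
    by apply/funext => y; rewrite exprfctE.
  have := is_deriveX n (is_derive_id x (1:R)).
  by move/is_derive_eq; apply; rewrite /GRing.scale /= mulr1.
have d2 : is_derive x (1:R) (fun y : R^o => - (a * y ^+ 2)) (- (a * (2 * x))).
  have -> : (fun y : R^o => - (a * y ^+ 2)) = - (a *: ((@id R^o) ^+ 2)).
    by apply/funext => y; rewrite /GRing.opp /= /GRing.scale /= exprfctE.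
  apply: is_derive_eq; rewrite /GRing.scale /=; ring.
have d3 := is_derive1_comp (is_derive_expR _) d2.
have := is_deriveM d1 d3; rewrite /gmono => /is_derive_eq; apply.
rewrite /GRing.scale /= !exprS. ring.
Qed.

Lemma continuous_gmono a n : continuous (gmono a n).
Proof.
move=> x; apply: differentiable_continuous; apply/derivable1_diffP.
by have [] := is_derive_gmono a n x.
Qed.

(** [expR (a * x ^+ 2)] is at least 1 and dominates its Taylor term of order [n.+1], while
    [|x| ^+ n] is at most [1 + (x ^+ 2) ^+ n.+1]; the constant adds the two bounds. *)
Lemma gmono_bounded a n : 0 < a -> exists C : R, forall x, `|gmono a n x| <= C.
Proof.
move=> a0; exists (1 + n.+1`!%:R / a ^+ n.+1) => x.
rewrite normrM normrX (ger0_norm (expR_ge0 _)) expRN.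
rewrite ler_pdivrMr ?expR_gt0//.
have axx : 0 <= a * x ^+ 2 by rewrite mulr_ge0 ?sqr_ge0// ltW.
have h := expR_ge1Dxn n axx; apply: (@le_trans _ _ (1 + (x ^+ 2) ^+ n.+1)).
  have [x1|x1] := leP `|x| 1.
    apply: (@le_trans _ _ 1); first by rewrite exprn_ile1.
    by rewrite lerDl exprn_ge0 ?sqr_ge0.
  apply: (@le_trans _ _ ((x ^+ 2) ^+ n.+1)); last by rewrite lerDr.
  rewrite -(real_normK (num_real x)) -exprM ler_weXn2l ?(ltW x1)//.
  by rewrite mulnS mul2n -addnn addnA leq_addl.
rewrite mulrDl mul1r lerD//.
  by rewrite -expR0 ler_expR.
rewrite -ler_pdivrMl ?divr_gt0 ?exprn_gt0 ?ltr0n ?fact_gt0//.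
rewrite invf_div mulrAC -exprMn; apply: le_trans h.
by rewrite lerDr.
Qed.

(** The variance is [(2 * a)^-1]; integrability and a positive total mass are inherited from the
    normal density. *)
Lemma gmono0_normal a : 0 < a -> exists2 s : R, s != 0 &
  gmono a 0 = fun x => (normal_peak s)^-1 * normal_pdf 0 s x.
Proof.
move=> a0; pose s : R := Num.sqrt (2 * a)^-1.
have s2 : s ^+ 2 = (2 * a)^-1 by rewrite sqr_sqrtr// invr_ge0 mulr_ge0 ?ltW.
have s0 : s != 0 by rewrite -sqrf_eq0 s2 invr_eq0 mulf_neq0 ?pnatr_eq0 ?gt_eqF.
exists s => //; apply/funext => x.
rewrite /normal_pdf (negPf s0) mulKf ?gt_eqF ?normal_peak_gt0//.
rewrite /normal_fun /gmono mul1r subr0 s2 mulNr; congr (expR (- _)).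
by field; rewrite gt_eqF.
Qed.

Lemma integrable_gmono0 a : 0 < a -> mu.-integrable setT (EFin \o gmono a 0).
Proof.
move=> /gmono0_normal[s s0 ->].
exact: (integrableZl measurableT _ (integrable_normal_pdf (0 : R) s)).
Qed.

Lemma gmom0_gt0 a : 0 < a -> 0 < gmom a 0.
Proof.
move=> /gmono0_normal[s s0 fE]; rewrite /gmom fE RintegralZl//; last first.
  exact: integrable_normal_pdf.
by rewrite /Rintegral integral_normal_pdf mulr1 invr_gt0 normal_peak_gt0.
Qed.

(** Half of the exponent keeps the power of x bounded, the other half is integrable. *)
Lemma integrable_gmono a n : 0 < a -> mu.-integrable setT (EFin \o gmono a n).
Proof.
move=> a0; have a20 : 0 < a / 2 by rewrite divr_gt0.
have [C hC] := gmono_bounded n a20.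
have := integrableZl measurableT C (integrable_gmono0 a20).
apply: le_integrable => //.
  apply/measurable_EFinP. apply: continuous_measurable_fun. exact: continuous_gmono.
move=> x _ /=; rewrite lee_fin.
have -> : gmono a n x = gmono (a / 2) n x * gmono (a / 2) 0 x.
  rewrite /gmono mul1r -mulrA -expRD; congr (_ * expR _); by field.
rewrite normrM [leRHS]normrM; apply: ler_wpM2r => //.
exact: (le_trans (hC _) (ler_norm _)).
Qed.

(** Multiplied by k, the value at a point of modulus k becomes a bounded value of [gmono a n.+1], so
    it decays at least like 1/k. *)
Lemma gmono_cvg0 a n : 0 < a -> (gmono a n k%:R @[k --> \oo] --> 0) /\
  (gmono a n (- k%:R) @[k --> \oo] --> 0).
Proof.
move=> a0; have [C hC] := gmono_bounded n.+1 a0.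
suff H (u : R^nat) : (forall k, `|u k| = k%:R) -> gmono a n (u k) @[k --> \oo] --> 0.
  by split; apply: H => k; rewrite ?normrN ger0_norm.
move=> uk; apply/cvgrPdist_le => e e0; near=> k.
rewrite sub0r normrN.
have k0 : 0 < (k%:R : R) by near: k; exact: nbhs_infty_gtr.
rewrite -(ler_pM2l k0) -{1}(uk k) -normrM mulrA -exprS (le_trans (hC _))//.
rewrite -ler_pdivrMr//; near: k; exact: nbhs_infty_ger.
Unshelve. all: by end_near. Qed.

(* The integral of the derivative of [gmono a n] vanishes. For [n = 0] the junk
   value [n.-1 = 0] is cancelled by the factor [n]. *)
Lemma gmom_rec a n : 0 < a -> 2 * a * gmom a n.+1 = n%:R * gmom a n.-1.
Proof.
move=> a0; apply/eqP; rewrite eq_sym -subr_eq0; apply/eqP.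
pose f x := n%:R * gmono a n.-1 x - 2 * a * gmono a n.+1 x.
have cf : continuous f.
  by move=> x; apply: cvgB; apply: cvgM; [exact: cvg_cst|exact: continuous_gmono
    |exact: cvg_cst|exact: continuous_gmono].
have i1 := integrableZl measurableT n%:R (integrable_gmono n.-1 a0).
have i2 := integrableZl measurableT (2 * a) (integrable_gmono n.+1 a0).
have intf : mu.-integrable setT (EFin \o f).
  by apply: eq_integrable (integrableB measurableT i1 i2).
have -> : n%:R * gmom a n.-1 - 2 * a * gmom a n.+1 = \int[mu]_x f x.
  rewrite /gmom -!RintegralZl//; try exact: integrable_gmono.
  by rewrite -RintegralB.
(* The fundamental theorem applies on compact intervals, and dominated convergence carries it to the
   line. The shift [k.+1] keeps every interval nondegenerate. *)
pose I k : set R := `[- k.+1%:R, k.+1%:R]%classic.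
have mI k : measurable (I k) by exact: measurable_itv.
have [|||||_ _ hcv] := @dominated_convergence _ _ _ mu setT measurableT
  (fun k => EFin \o (f \_ (I k))) (EFin \o f) (abse \o (EFin \o f)).
- move=> k; apply/measurable_EFinP. apply/(measurable_restrictT _ (mI k)).
  apply: measurable_funTS. by apply: continuous_measurable_fun.
- by apply/measurable_EFinP; apply: continuous_measurable_fun.
- apply: aeW => x _ /=; apply: cvg_near_cst; near=> k.
  congr EFin; apply: patchT; rewrite inE /I /= in_itv/=; have : `|x| <= k.+1%:R.
    rewrite -natr1 (@le_trans _ _ k%:R) ?lerDl//; near: k; exact: nbhs_infty_ger.
  by rewrite ler_norml.
- exact: integrable_abse.
- apply: aeW => x k _ /=; rewrite lee_fin /patch; case: ifP => // _.
  by rewrite normr0.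
have h0 : [sequence \int[mu]_x ((EFin \o (f \_ (I k))) x)]_k%E @ \oo --> (0:R)%:E.
  have -> : [sequence \int[mu]_x ((EFin \o (f \_ (I k))) x)]_k%E =
      (fun k => (gmono a n k.+1%:R - gmono a n (- k.+1%:R))%:E).
    apply/funext => k; rewrite EFinB -(@continuous_FTC2 _ f).
    + rewrite /= [RHS]integral_mkcond; apply: eq_integral => x _ /=.
      by rewrite restrict_EFin.
    + by rewrite gtrN.
    + exact: continuous_subspaceT.
    + have cg : continuous (gmono a n) by exact: continuous_gmono.
      split; [by move=> x _; have [] := is_derive_gmono a n x| |].
        by apply: cvg_at_right_filter; exact: cg.
      by apply: cvg_at_left_filter; exact: cg.
    + by move=> x _; rewrite derive1E; have [_] := is_derive_gmono a n x.
  have [c1 c2] := gmono_cvg0 n a0.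
  apply: cvg_EFin; first exact: nearW.
  rewrite /comp /=; rewrite -[0](subr0 0); apply: cvgB.
    by rewrite -cvg_shiftS in c1.
  by rewrite -cvg_shiftS in c2.
by rewrite /Rintegral (cvg_unique _ hcv h0).
Unshelve. all: by end_near. Qed.

End Gaussian1D.

(** * Wick's theorem *)

(* All ways to take one entry out of [s], with the remaining list. *)
Fixpoint rems (T : Type) (s : seq T) : seq (T * seq T) :=
  if s is x :: s' then (x, s') :: [seq (p.1, x :: p.2) | p <- rems s'] else [::].

Lemma rems_map (T U : Type) (f : T -> U) (s : seq T) :
  rems (map f s) = [seq (f p.1, map f p.2) | p <- rems s].
Proof. by elim: s => //= x s ->; rewrite -!map_comp. Qed.

Lemma perm_rems (T : eqType) (s : seq T) p :
  p \in rems s -> perm_eq s (p.1 :: p.2).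
Proof.
elim: s p => //= x s IHs p; rewrite inE => /predU1P[->//|/mapP[q /IHs sq ->]] /=.
by rewrite -(perm_cons x) in sq; rewrite (perm_trans sq)// (perm_catCA [:: x] [:: q.1]).
Qed.

Lemma size_rems (T : eqType) (s : seq T) p : p \in rems s -> size s = (size p.2).+1.
Proof. by move/perm_rems/perm_size. Qed.

Lemma sum_rems_uniq (T : eqType) (V : pzRingType) (f : seq T -> V) (x : T) (s : seq T) :
  uniq s -> x \in s ->
  \sum_(p <- rems s) (p.1 == x)%:R * f p.2 = f (rem x s).
Proof.
elim: s x f => //= y s IHs x f /andP[ys us]; rewrite inE big_cons big_map /= eq_sym.
have [<-{x} _|xy /= xs] := eqVneq y x.
  rewrite mul1r big_seq big1 ?addr0// => p /perm_rems/perm_mem/(_ p.1).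
  rewrite mem_head; have [->|_] := eqVneq p.1 y; last by rewrite mul0r.
  by rewrite (negPf ys).
by rewrite mul0r add0r (IHs x (fun s' => f (y :: s'))).
Qed.

Section RealWick.
Variables (K : finType) (C : comNzRingType) (sigma : K -> C) (m : K -> nat -> C).
Hypothesis mS : forall k n, m k n.+1 = sigma k * n%:R * m k n.-1.
Implicit Types (w : seq K) (L : seq (K -> C)).

(** The coordinates are independent, so a monomial's moment factors and depends only on
    multiplicities. *)
Definition word_moment w : C := \prod_k m k (count_mem k w).

(* The moment of the product of the linear forms in [L] and of the variables
   listed in the word [w]. *)
Fixpoint form_moment L w : C :=
  if L is l :: L' then \sum_k l k * form_moment L' (k :: w) else word_moment w.

Lemma perm_form_moment L w w' :
  perm_eq w w' -> form_moment L w = form_moment L w'.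
Proof.
elim: L w w' => [|l L IHL] w w' /= ww'.
  by apply: eq_bigr => k _; move/permP: ww' => ->.
by apply: eq_bigr => k _; rewrite (IHL _ (k :: w'))// perm_cons.
Qed.

Lemma word_moment_cons k w :
  word_moment (k :: w) = sigma k * (count_mem k w)%:R * word_moment (rem k w).
Proof.
rewrite /word_moment (bigD1 k)//= [in RHS](bigD1 k)//= eqxx add1n mS -!mulrA.
(* When k is absent from w, removing it changes nothing; this agrees with [0.-1 = 0]. *)
congr (_ * (_ * (_ * _))); first by rewrite count_rem /= eqxx andbT;
  case: (boolP (k \in w)) => [|/count_memPn ->]; rewrite ?subn1.
apply: eq_bigr => i ik; rewrite count_rem /= eq_sym (negPf ik) andbF subn0.
by rewrite add0n.
Qed.

(** Gaussian integration by parts: the letter k is contracted either with an equal letter of the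
    word or with one of the forms still to be expanded. *)
Lemma form_moment_cons L k w : form_moment L (k :: w) =
  sigma k * (count_mem k w)%:R * form_moment L (rem k w) +
  \sum_(p <- rems L) sigma k * p.1 k * form_moment p.2 w.
Proof.
elim: L k w => [|l L IHL] k w; first by rewrite /= big_nil addr0 word_moment_cons.
rewrite [rems _]/= big_cons big_map /= -/(form_moment _ _).
(* The head form emits a letter d. The case d = k raises the multiplicity of k by one, and this
   extra unit is the contraction of k with the head form. *)
transitivity (\sum_d (l d * (sigma k * (d == k)%:R * form_moment L w) +
    (l d * (sigma k * (count_mem k w)%:R * form_moment L (d :: rem k w)) +
     l d * (\sum_(p <- rems L) sigma k * p.1 k * form_moment p.2 (d :: w))))).
  apply: eq_bigr => d _; rewrite -!mulrDr addrA; congr (_ * _).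
  rewrite (@perm_form_moment _ _ [:: k, d & w]) ?(perm_catCA [:: d] [:: k])//.
  rewrite IHL /=; congr (_ + _); have [->|dk] := eqVneq d k.
    rewrite natrD mulrDr mulrDl mulr1; congr (_ + _).
    have [kw|/count_memPn->] := boolP (k \in w); last by rewrite !(mulr0, mul0r).
    congr (_ * _); apply: perm_form_moment; rewrite perm_sym perm_sym.
    exact: perm_to_rem.
  by rewrite mulr0 mul0r !add0r.
rewrite !big_split /= addrA [in RHS]addrCA addrA; congr (_ + _ + _).
- rewrite (bigD1 k)//= eqxx mulr1 big1 ?addr0; first by ring.
  by move=> d /negPf ->; rewrite !(mulr0, mul0r).
- by rewrite big_distrr /=; apply: eq_bigr => d _; ring.
rewrite [LHS](eq_bigr (fun d =>
  \sum_(p <- rems L) l d * (sigma k * p.1 k * form_moment p.2 (d :: w))));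
    last by move=> d _; rewrite big_distrr.
rewrite exchange_big /=; apply: eq_bigr => p _.
by rewrite big_distrr /=; apply: eq_bigr => d _; ring.
Qed.

Lemma wick l L : form_moment (l :: L) [::] =
  \sum_(p <- rems L) (\sum_k sigma k * l k * p.1 k) * form_moment p.2 [::].
Proof.
rewrite /=; under eq_bigr =>
  k _ do rewrite form_moment_cons /= mulr0 mul0r add0r big_distrr.
rewrite exchange_big /=; apply: eq_bigr => p _; rewrite big_distrl.
by apply: eq_bigr => k _ /=; ring.
Qed.

End RealWick.

Section EdgeWick.
Variables (K : finType) (I : eqType) (C : comNzRingType).
Variables (sigma : K -> C) (m : K -> nat -> C) (ell : I * I -> K -> C).
Hypotheses (m0 : forall k, m k 0 = 1)
  (mS : forall k n, m k n.+1 = sigma k * n%:R * m k n.-1)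
  (ellP : forall e e', \sum_k sigma k * ell e k * ell e' k = (e' == (e.2, e.1))%:R).
Implicit Types (s : seq (I * I)).

Definition flip (T : Type) (e : T * T) : T * T := (e.2, e.1).

Definition edge_moment s : C := form_moment m [seq ell e | e <- s] [::].

Lemma edge_moment_nil : edge_moment [::] = 1.
Proof. by rewrite /edge_moment /= /word_moment big1// => k _ /=. Qed.

Lemma edge_moment_cons e s : edge_moment (e :: s) =
  \sum_(p <- rems s) (p.1 == flip e)%:R * edge_moment p.2.
Proof.
rewrite /edge_moment (wick mS) rems_map big_map; apply: eq_bigr => p _.
by rewrite ellP.
Qed.

(** A nonzero term of the expansion pairs the first edge with a reversed copy and leaves a nonzero
    moment of the rest, so a complete matching exists; only the multiset identity it implies is
    kept. *)
Lemma edge_moment_balanced s : edge_moment s != 0 -> perm_eq s (map (@flip I) s).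
Proof.
have [n] := ubnP (size s); elim: n s => // n IHn [//|e s] /=; rewrite ltnS => sn.
apply: contra_neqT => ns; rewrite edge_moment_cons big_seq big1// => p ps.
have [pe|_] := eqVneq p.1 (flip e); last by rewrite mul0r.
rewrite mul1r; apply: contraNeq ns => /IHn.
rewrite -(size_rems ps) => /(_ (ltnW sn)) bal.
have sp := perm_rems ps; rewrite pe in sp.
have es : perm_eq (e :: s) (e :: flip e :: p.2) by rewrite perm_cons.
rewrite (perm_trans es)// perm_sym (perm_trans (perm_map (@flip I) es))//= .
rewrite (_ : flip (flip e) = e); last by case: (e).
rewrite (perm_catCA [:: flip e] [:: e])/= !perm_cons perm_sym.
exact: bal.
Qed.

(** Without repetitions the reverse of an edge occurs once, so each contraction is forced. A loop
    would be its own reverse and would need a second copy of itself. *)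
Lemma edge_moment_uniq s : uniq s -> (forall e, e \in s -> e.1 != e.2) ->
  (forall e, e \in s -> flip e \in s) -> edge_moment s = 1.
Proof.
have [n] := ubnP (size s); elim: n s => // n IHn [|e s] /=; rewrite ?edge_moment_nil//.
rewrite ltnS => sn /andP[es us] off bal.
have fK : involutive (@flip I) by case.
have fe : flip e \in s.
  have := bal e (mem_head _ _); rewrite inE => /predU1P[|//].
  by have := off _ (mem_head _ _); case: (e) => a b /= ab [ba]; rewrite ba eqxx in ab.
rewrite edge_moment_cons (sum_rems_uniq edge_moment us fe) IHn.
- by [].
- by rewrite size_rem//; move: fe sn; case: (s) => //= ? ? _; apply: ltnW.
- exact: rem_uniq.
- by move=> d /mem_rem ds; apply: off; rewrite inE ds orbT.
move=> d; rewrite !mem_rem_uniq// !inE => /andP[dfe ds].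
have := bal d; rewrite !inE ds orbT => /(_ isT) /predU1P[fde|->].
  by move: dfe; rewrite -fde fK eqxx.
rewrite andbT; apply: contraNneq es => /(can_inj fK) ed; by rewrite -ed.
Qed.

End EdgeWick.

(** * Gaussian averages over Hermitian matrices *)

Section IteratedGaussian.
Variables (R : realType) (N : nat).
Local Notation I := (idx N).
Local Notation K := (I * I)%type.
Local Notation C := R[i].
Local Notation mu := (@lebesgue_measure R).
Local Open Scope complex_scope.
Implicit Types (y : K -> R) (k : K).

Lemma Rintegral_sum (T : Type) (r : seq T) (h : T -> R -> R) :
  (forall t, mu.-integrable setT (EFin \o h t)) ->
  \int[mu]_x (\sum_(t <- r) h t x) = \sum_(t <- r) \int[mu]_x h t x.
Proof.
move=> hi; rewrite /Rintegral.
under eq_integral do rewrite -sumEFin.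
rewrite integral_sum//= sum_fine// => t _.
exact: integrable_fin_num (hi t).
Qed.

(** The integrand stays a sum of products of one-variable functions, so each integration acts on a
    single factor; coordinates outside [s] keep their value in [y]. *)
Lemma iter_integral_sum (T : Type) (r : seq T) (c : T -> R) (g : T -> K -> R -> R) s y :
  (forall t k, mu.-integrable setT (EFin \o g t k)) -> uniq s ->
  iter_integral s (fun y => \sum_(t <- r) c t * \prod_k g t k (y k)) y =
  \sum_(t <- r) c t *
    \prod_k (if k \in s then \int[mu]_x g t k x else g t k (y k)).
Proof.
move=> gi; elim: s y => [//|e s IHs] y /= /andP[es us].
transitivity (\int[mu]_x \sum_(t <- r) c t * (\prod_(k | k != e)
    (if k \in s then \int[mu]_x g t k x else g t k (y k))) * g t e x).
  apply: eq_Rintegral => x _; rewrite IHs//; apply: eq_bigr => t _.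
  rewrite -mulrA; congr (_ * _); rewrite (bigD1 e)//= (negPf es) eqxx mulrC.
  by congr (_ * _); apply: eq_bigr => k /negPf ->.
rewrite Rintegral_sum => [|t]; last exact: (integrableZl measurableT _ (gi t e)).
apply: eq_bigr => t _; rewrite RintegralZl// -mulrA; congr (_ * _).
rewrite [RHS](bigD1 e)//= mem_head mulrC; congr (_ * _).
by apply: eq_bigr => k ke; rewrite inE (negPf ke).
Qed.

(** The coefficient of a squared coordinate in Tr(H^2)/2: an off-diagonal entry occurs twice in the
    trace, a diagonal one once. *)
Definition weight k : R := if k.1 == k.2 then 2^-1 else 1.

Lemma weight_gt0 k : 0 < weight k.
Proof. by rewrite /weight; case: ifP => _; rewrite ?invr_gt0. Qed.

Definition gnorm : R := \prod_k gmom (weight k) 0.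

Lemma gnorm_gt0 : 0 < gnorm.
Proof. by apply: prodr_gt0 => k _; apply: gmom0_gt0; exact: weight_gt0. Qed.

Definition nmom k n : C := (gmom (weight k) n / gmom (weight k) 0)%:C.

Definition covar k : C := (2 * weight k)^-1%:C.

Lemma nmom0 k : nmom k 0 = 1.
Proof. by rewrite /nmom divff// gt_eqF// gmom0_gt0// weight_gt0. Qed.

Lemma nmomS k n : nmom k n.+1 = covar k * n%:R * nmom k n.-1.
Proof.
rewrite /nmom /covar -(rmorph_nat (real_complex R)) -!rmorphM; congr (_%:C).
rewrite mulrA; congr (_ / _); rewrite -mulrA -gmom_rec ?weight_gt0// mulKf//.
by rewrite mulf_neq0// gt_eqF// weight_gt0.
Qed.

Lemma trace_sq_herm y : complex.Re (trace_sq (herm y)) = \sum_k 2 * weight k * y k ^+ 2.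
Proof.
have ReD (u v : C) : complex.Re (u + v) = complex.Re u + complex.Re v by case: u v =>
  ? ? [].
have ReS (F : I -> C) : complex.Re (\sum_i F i) = \sum_i complex.Re (F i).
  by rewrite (big_morph (@complex.Re R) ReD (erefl _)).
(* The product of H_ij and H_ji is the sum of the squares of the coordinates (i, j) and (j, i), and
   [q i j] is the share of the first. On the diagonal the two shares coincide, hence the half. *)
pose q i j : R := if i == j then y (i, j) ^+ 2 / 2 else y (i, j) ^+ 2.
transitivity (\sum_i \sum_j (q i j + q j i)).
  rewrite /trace_sq ReS; apply: eq_bigr => i _; rewrite ReS; apply: eq_bigr => j _.
  rewrite /herm /q (eq_sym j i); have [<-|ij] := eqVneq i j.
    by rewrite /= mul0r subr0; field.
  rewrite /idx_lt; case: (ltngtP (enum_rank i) (enum_rank j)) => /= h; try by ring.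
  by move/val_inj/enum_rank_inj : h ij => ->; rewrite eqxx.
under eq_bigr => i _ do rewrite big_split.
rewrite big_split /= [X in _ + X]exchange_big /= -mulr2n pair_bigA /= -sumrMnl.
apply: eq_bigr => -[i j] _ /=; by rewrite /q /weight /=; case: eqP => _; field.
Qed.

Lemma gauss_herm y : gauss (herm y) = \prod_k expR (- (weight k * y k ^+ 2)).
Proof.
rewrite /gauss trace_sq_herm -expR_sum sumrN mulr_sumr; congr (expR (- _)).
by apply: eq_bigr => k _; rewrite !mulrA mulVf ?mul1r// pnatr_eq0.
Qed.

(* [F] is a polynomial in the coordinates and [v] is its Gaussian average,
   computed monomial by monomial. *)
Definition gexpands (F : (K -> R) -> C) (v : C) : Prop :=
  exists r : seq (C * seq K),
    (forall y, F y = \sum_(t <- r) t.1 * \prod_(k <- t.2) (y k)%:C) /\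
    v = \sum_(t <- r) t.1 * word_moment nmom t.2.

Lemma word_prod (S : comNzRingType) (F : K -> S) (w : seq K) :
  \prod_(k <- w) F k = \prod_k F k ^+ count_mem k w.
Proof.
elim: w => [|e w IHw]; first by rewrite big_nil big1// => k _; rewrite expr0.
rewrite big_cons IHw /= [RHS](bigD1 e)//= eqxx exprS (bigD1 e)//= mulrA.
congr (_ * _); apply: eq_bigr => k; rewrite eq_sym => /negPf ->.
by rewrite add0n.
Qed.

(** [L] stands for the real or the imaginary part; real linearity treats both components of
    [gauss_moment] alike. *)
Lemma DH_integral_real (L : C -> R) (P : (I -> I -> C) -> C) (r : seq (C * seq K)) :
  {morph L : u v / u + v} -> L 0 = 0 -> (forall (u : C) (x : R),
    L (u * x%:C) = L u * x) ->
  (forall y, P (herm y) = \sum_(t <- r) t.1 * \prod_(k <- t.2) (y k)%:C) ->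
  DH_integral (fun H => L (P H) * gauss H) =
  L (gnorm%:C * \sum_(t <- r) t.1 * word_moment nmom t.2).
Proof.
move=> LD L0 LZ PE; rewrite /DH_integral.
have -> : (fun y => L (P (herm y)) * gauss (herm y)) = (fun y =>
    \sum_(t <- r) L t.1 * \prod_k gmono (weight k) (count_mem k t.2) (y k)).
  apply/funext => y; rewrite PE (big_morph L LD L0) big_distrl /=.
  apply: eq_bigr => t _; rewrite -rmorph_prod LZ -mulrA; congr (_ * _).
  by rewrite gauss_herm word_prod -big_split.
rewrite (@iter_integral_sum _ r (fun t => L t.1)
  (fun t k => gmono (weight k) (count_mem k t.2))) ?enum_uniq//; last first.
  by move=> t k; apply: integrable_gmono; exact: weight_gt0.
rewrite mulr_sumr (big_morph L LD L0); apply: eq_bigr => t _.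
rewrite mulrCA /word_moment /nmom -rmorph_prod -rmorphM LZ; congr (_ * _).
rewrite /gnorm -big_split; apply: eq_bigr => k _ /=; rewrite mem_enum inE.
by rewrite mulrC divfK// gt_eqF// gmom0_gt0// weight_gt0.
Qed.

Lemma gexpands_moment P v : gexpands (fun y =>
  P (herm y)) v -> gauss_moment P = gnorm%:C * v.
Proof.
move=> [r [PE ->]]; rewrite /gauss_moment (DH_integral_real _ _ _ PE)//.
- rewrite (DH_integral_real _ _ _ PE)//.
  + by case: (_ * _).
  + by case=> ? ? [].
  + by case=> ? ? x /=; rewrite mulr0 add0r.
- by case=> ? ? [].
- by case=> ? ? x /=; rewrite mulr0 subr0.
Qed.

Lemma gexpands1 : gexpands (fun=> 1) 1.
Proof.
exists [:: (1, [::])]; split=> [y|]; rewrite big_seq1 mul1r ?big_nil//.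
by rewrite /word_moment big1// => k _; rewrite nmom0.
Qed.

Lemma gexpands_average P v : gexpands (fun y => P (herm y)) v -> average0 P = v.
Proof.
move=> Pv; rewrite /average0 (gexpands_moment Pv) (gexpands_moment (P :=
  fun=> 1) gexpands1).
by rewrite mulr1 mulrC mulKf// (inj_eq (@complexI R)) gt_eqF// gnorm_gt0.
Qed.

Lemma gexpands_sum (T : Type) (r : seq T) (c : T -> C) (F : T -> (K -> R) -> C)
    (v : T -> C) :
  (forall t, gexpands (F t) (v t)) ->
  gexpands (fun y => \sum_(t <- r) c t * F t y) (\sum_(t <- r) c t * v t).
Proof.
move=> Fv; elim: r => [|t r [u [uE uv]]].
  by exists [::]; split=> [y|]; rewrite !big_nil.
have [q [qE qv]] := Fv t.
exists ([seq (c t * p.1, p.2) | p <- q] ++ u); split=> [y|].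
  rewrite big_cons big_cat big_map uE qE mulr_sumr /=; congr (_ + _).
  by apply: eq_bigr => p _; rewrite mulrA.
rewrite big_cons big_cat big_map uv qv mulr_sumr /=; congr (_ + _).
by apply: eq_bigr => p _; rewrite mulrA.
Qed.

(* The matrix entry [H_ij] as a linear form in the real coordinates. *)
Definition entry_form (e : I * I) k : C :=
  if e.1 == e.2 then (k == e)%:R
  else if idx_lt e.1 e.2 then (k == e)%:R + 'i * (k == flip e)%:R
  else (k == flip e)%:R - 'i * (k == e)%:R.

Lemma sum_delta (a : K) (f : K -> C) : \sum_k (k == a)%:R * f k = f a.
Proof.
rewrite (bigD1 a)//= eqxx mul1r big1 ?addr0// => k /negPf ->.
by rewrite mul0r.
Qed.

Lemma sum_entry_form e (f : K -> C) : \sum_k entry_form e k * f k =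
  if e.1 == e.2 then f e
  else if idx_lt e.1 e.2 then f e + 'i * f (flip e) else f (flip e) - 'i * f e.
Proof.
rewrite /entry_form; case: ifP => _; first exact: sum_delta.
case: ifP => _; under eq_bigr do [rewrite mulrDl ?mulNr -mulrA];
  by rewrite ?big_split /= ?sumrN -mulr_sumr !sum_delta.
Qed.

Lemma herm_entry y i j : herm y i j = \sum_k entry_form (i, j) k * (y k)%:C.
Proof.
rewrite sum_entry_form /herm /flip /=; case: eqP => [->//|_].
by case: ifP => _; apply/eqP;
  rewrite eq_complex /= !(mul0r, mul1r, subr0, add0r, addr0, oppr0, sub0r) !eqxx.
Qed.

(** Off the diagonal, real and imaginary parts are independent of variance 1/2: their contributions
    add up to 1 for H_ij against H_ji and cancel for H_ij against itself, where 'i is squared. On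
    the diagonal the variance is 1. *)
Lemma entry_form_pairing e e' :
  \sum_k covar k * entry_form e k * entry_form e' k = (e' == (e.2, e.1))%:R.
Proof.
under eq_bigr do rewrite mulrAC mulrC.
rewrite sum_entry_form /covar /weight /flip /entry_form.
case: e e' => [i j] [k l] /=; rewrite !xpair_eqE /=.
have half : (2 * 1)^-1%:C = 2^-1 :> C by rewrite mulr1 fmorphV rmorph_nat.
have ii : 'i * 'i = -1 :> C by rewrite -expr2 sqr_i.
have one : (2 / 2)^-1%:C = 1 :> C by rewrite divff// invr1.
have iih (z : C) : 'i * (2^-1 * ('i * z)) = - (2^-1 * z).
  by rewrite mulrCA (mulrA 'i) ii mulN1r mulrN.
have half2 (z : C) : 2^-1 * z + 2^-1 * z = z by field.
have [<-|ij] := eqVneq i j; have [<-|kl] := eqVneq k l.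
- by rewrite one mul1r !andbb eq_sym.
- have ikl : (i == k) && (i == l) = false.
    by apply/negP => /andP[/eqP ik /eqP il]; rewrite -ik -il eqxx in kl.
  rewrite (andbC (i == l)) ikl mulr0 addr0 subr0 if_same mulr0.
  by rewrite (eq_sym k) (eq_sym l) ikl.
- have ijk : (i == k) && (j == k) = false.
    by apply/negP => /andP[/eqP ik /eqP jk]; rewrite ik jk eqxx in ij.
  rewrite (andbC (j == k)) ijk !mulr0 addr0 subr0 if_same.
  by rewrite andbC (eq_sym k) (eq_sym k j) ijk.
have swap : ~~ (idx_lt i j && idx_lt j i) && (idx_lt i j || idx_lt j i).
  rewrite /idx_lt; case: ltngtP => // /val_inj/enum_rank_inj ij'.
  by rewrite ij' eqxx in ij.
rewrite half (andbC (j == k)) (andbC (j == l)) (andbC (k == j)) (eq_sym l i) (eq_sym k j).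
case: (boolP (idx_lt i j)) swap => lij swap; case: (boolP (idx_lt k l)) => lkl.
- have -> : (i == l) && (j == k) = false.
    by apply/negP => /andP[/eqP il /eqP jk]; rewrite -il -jk in lkl; rewrite lkl in swap.
  by rewrite !mulr0 addr0 add0r iih subrr.
- have -> : (i == k) && (j == l) = false.
    by apply/negP => /andP[/eqP ik /eqP jl]; move: lkl; rewrite -ik -jl lij.
  by rewrite !mulr0 subr0 sub0r !mulrN iih opprK half2.
- have -> : (i == k) && (j == l) = false.
    by apply/negP => /andP[/eqP ik /eqP jl]; move: lij; rewrite ik jl lkl.
  by rewrite !mulr0 addr0 add0r iih opprK half2.
have -> : (i == l) && (j == k) = false.
  by apply/negP => /andP[/eqP il /eqP jk]; rewrite -il -jk in lkl;
    rewrite (negPf lkl) in swap.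
by rewrite !mulr0 subr0 sub0r !mulrN iih opprK subrr.
Qed.

Lemma gexpands_forms (L : seq (K -> C)) (w : seq K) :
  gexpands (fun y => \prod_(l <- L) (\sum_k l k * (y k)%:C) * \prod_(k <- w) (y k)%:C)
    (form_moment nmom L w).
Proof.
elim: L w => [|l L IHL] w.
  by exists [:: (1, w)]; split=> [y|]; rewrite big_seq1 mul1r// big_nil mul1r.
have [r [rE rv]] := gexpands_sum (index_enum K) l (fun k => IHL (k :: w)).
exists r; split=> // y; rewrite -rE big_cons -mulrA big_distrl /=.
by apply: eq_bigr => k _; rewrite big_cons; ring.
Qed.

Lemma gexpands_edges (s : seq (I * I)) :
  gexpands (fun y => \prod_(e <- s) herm y e.1 e.2) (edge_moment nmom entry_form s).
Proof.
have [r [rE rv]] := gexpands_forms [seq entry_form e | e <- s] [::].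
exists r; split=> // y; rewrite -rE big_nil mulr1 big_map.
by apply: eq_bigr => -[i j] _; rewrite herm_entry.
Qed.

End IteratedGaussian.

(** * Winding numbers *)

Section Plane.
Variable R : realType.
Local Notation plane := (plane R).
Implicit Types (a b c o p q x y : plane) (e t : R).

Definition det a b p : R := orient a b p.

Lemma detE (a1 a2 b1 b2 p1 p2 : R) :
  det (a1, a2) (b1, b2) (p1, p2) = (a2 - b2) * (p1 - b1) - (a1 - b1) * (p2 - b2).
Proof. by []. Qed.

Lemma det_rot a b p : det b p a = det a b p.
Proof. by case: a b p => [? ?] [? ?] [? ?]; rewrite !detE; ring. Qed.

Lemma det_swap a b p : det b a p = - det a b p.
Proof. by case: a b p => [? ?] [? ?] [? ?]; rewrite !detE; ring. Qed.

Lemma det_left a b : det a b a = 0.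
Proof. by case: a b => [? ?] [? ?]; rewrite !detE; ring. Qed.

Lemma det_right a b : det a b b = 0.
Proof. by case: a b => [? ?] [? ?]; rewrite !detE; ring. Qed.

Lemma det_sum a b c p : det a b p + det b c p + det c a p = det a b c.
Proof. by case: a b c p => [? ?] [? ?] [? ?] [? ?]; rewrite !detE; ring. Qed.

Definition mix t p q : plane := ((1 - t) * p.1 + t * q.1, (1 - t) * p.2 + t * q.2).

Lemma det_mix a b t p q : det a b (mix t p q) = (1 - t) * det a b p + t * det a b q.
Proof. by case: a b p q => [? ?] [? ?] [? ?] [? ?]; rewrite /mix !detE /=; ring. Qed.

(** Cramer's rule: the three determinants on the right are the barycentric coordinates of p, scaled
    by [det a b c]. *)
Lemma det_bary a b c p :
  det a b c * p.1 = det b c p * a.1 + det c a p * b.1 + det a b p * c.1 /\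
  det a b c * p.2 = det b c p * a.2 + det c a p * b.2 + det a b p * c.2.
Proof. by case: a b c p => [? ?] [? ?] [? ?] [? ?]; rewrite !detE /=; split; ring. Qed.

Definition crossing x y p : int :=
  if [&& x.2 <= p.2, p.2 < y.2 & 0 < det x y p] then 1
  else if [&& y.2 <= p.2, p.2 < x.2 & det x y p < 0] then -1 else 0.

Lemma windingE s p : winding s p = \sum_(e <- sides s) crossing (pt R e.1) (pt R e.2) p.
Proof. by []. Qed.

(** The half-open rule only asks which endpoint is at most as high as p, so antisymmetry holds at
    every point, even on the segment; opposite edges then cancel exactly. *)
Lemma crossing_swap x y p : crossing y x p = - crossing x y p.
Proof.
rewrite /crossing det_swap oppr_gt0 oppr_lt0.
case: (lerP x.2 p.2) => xp; case: (lerP y.2 p.2) => yp //=;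
  by case: ifP.
Qed.

Definition winding3 a b c p : int := crossing a b p + crossing b c p + crossing c a p.

Lemma winding3_rot a b c p : winding3 b c a p = winding3 a b c p.
Proof. by rewrite /winding3; ring. Qed.

Lemma winding3_swap a b c p : winding3 b a c p = - winding3 a b c p.
Proof. by rewrite /winding3 (crossing_swap a b) (crossing_swap c a) (crossing_swap b
  c); ring. Qed.

(** The sign analysis behind [winding3_ccw]. Here u, v, w are the height of p minus those of the
    vertices, and x, y, z are unnormalized barycentric coordinates; the equation says that p has the
    weighted mean height. *)
Lemma winding3_sign (F : realFieldType) (u v w x y z : F) :
  0 < x + y + z -> u * y + v * z + w * x = 0 -> (u == v) && (v == w) = false ->
  let w1 := (if [&& 0 <= u, v < 0 & 0 < x] then 1
    else if [&& 0 <= v, u < 0 & x < 0] then -1 else 0) +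
  (if [&& 0 <= v, w < 0 & 0 < y] then 1
    else if [&& 0 <= w, v < 0 & y < 0] then -1 else 0) +
  (if [&& 0 <= w, u < 0 & 0 < z] then 1
    else if [&& 0 <= u, w < 0 & z < 0] then -1 else 0) : int in
  [/\ 0 < x -> 0 < y -> 0 < z -> w1 = 1, x < 0 -> w1 = 0 &
      w1 = 0 \/ w1 = 1 /\ [/\ 0 <= x, 0 <= y & 0 <= z]].
Proof.
move=> d0 eq0 uvw.
(* If p were as high as every vertex, positive weights would force all three heights to agree, which
   nondegeneracy excludes. *)
have npos : 0 <= u -> 0 <= v -> 0 <= w -> 0 < x -> 0 < y -> 0 < z -> False.
  move=> u0 v0 w0 x0 y0 z0; move: eq0 => /eqP.
  rewrite !paddr_eq0 ?addr_ge0 ?mulr_ge0 ?(ltW x0) ?(ltW y0) ?(ltW z0)//.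
  rewrite !mulf_eq0 (gt_eqF x0) (gt_eqF y0) (gt_eqF z0) !orbF =>
    /andP[/andP[/eqP uz /eqP vz] /eqP wz].
  by rewrite uz vz wz eqxx in uvw.
move: eq0 npos.
case: (lerP 0 u) => u0; case: (lerP 0 v) => v0; case: (lerP 0 w) => w0 /=;
  case: (ltrgt0P x) => x0 /=; case: (ltrgt0P y) => y0 /=;
    case: (ltrgt0P z) => z0 /= eq0 npos;
  rewrite ?x0 ?y0 ?z0 ?lexx;
  (split; [by [] || (move=> *; by [] || (exfalso;
    first [exact: npos| nra])) | by [] || (move=> *; by [] || (exfalso; nra)) |
     first [by left | by right; do !split; auto | exfalso; clear npos; nra]]).
Qed.
(* The half-open crossing rule makes [winding3] the indicator function of a
   half-open triangle, so that it takes no other values on the boundary. *)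
Lemma winding3_ccw a b c p : 0 < det a b c ->
  [/\ 0 < det a b p -> 0 < det b c p -> 0 < det c a p -> winding3 a b c p = 1,
      det a b p < 0 -> winding3 a b c p = 0 &
      winding3 a b c p = 0 \/ winding3 a b c p = 1 /\
        [/\ 0 <= det a b p, 0 <= det b c p & 0 <= det c a p]].
Proof.
move=> abc0; have abc := abc0; rewrite -(det_sum a b c p) in abc.
have [_ bary] := det_bary a b c p.
have bary0 : (p.2 - a.2) * det b c p + (p.2 - b.2) * det c a p +
    (p.2 - c.2) * det a b p = 0.
  have := subrr (det a b c * p.2); rewrite [X in _ - X]bary -(det_sum a b c p) => <-.
  by ring.
have nz : (p.2 - a.2 == p.2 - b.2) && (p.2 - b.2 == p.2 - c.2) = false.
  apply/negP => /andP[/eqP/addrI/oppr_inj ab /eqP/addrI/oppr_inj bc].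
  move: abc0; case: (a) (b) (c) ab bc => [? ?] [? ?] [? ?] /= -> ->.
  by rewrite detE !subrr mulr0 mul0r subrr ltxx.
have := winding3_sign abc bary0 nz.
by rewrite /winding3 /crossing !subr_ge0 !subr_lt0.
Qed.
End Plane.

Lemma mem_tl (T : eqType) (x y : T) s : y \in s -> y \in x :: s.
Proof. by rewrite inE => ->; rewrite orbT. Qed.

(** * Open conditions and generic points *)

Section Topology.
Variable R : realType.
Local Notation plane := (plane R).
Implicit Types (a b c o p q x y : plane) (e t : R) (U : set plane).

Lemma det_continuous a b : continuous (det a b : plane -> R).
Proof.
move=> q; rewrite /det /orient; apply: (@cvgB _ R); apply: cvgM; try exact: cvg_cst.
  by apply: (@cvgB _ R); [exact: cvg_fst|exact: cvg_cst].
by apply: (@cvgB _ R); [exact: cvg_snd|exact: cvg_cst].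
Qed.

Lemma near_det_gt0 a b p : 0 < det a b p -> \forall q \near p, 0 < det a b q.
Proof. by move=> h; exact: (cvgr_gt _ (@det_continuous a b p)). Qed.

Lemma near_det_lt0 a b p : det a b p < 0 -> \forall q \near p, det a b q < 0.
Proof. by move=> h; exact: (cvgr_lt _ (@det_continuous a b p)). Qed.

Lemma near_det_neq0 a b p : det a b p != 0 -> \forall q \near p, det a b q != 0.
Proof.
rewrite neq_lt => /orP[/near_det_lt0|/near_det_gt0]; apply: filterS => q.
  by move/lt_eqF->.
by move/gt_eqF->.
Qed.

Lemma mix_continuous p q : continuous ((fun t => mix t p q) : R -> plane).
Proof.
move=> t; refine (@cvg_pair R R R (nbhs t) (nbhs ((1 - t) * p.1 + t * q.1 : R))
  (nbhs ((1 - t) * p.2 + t * q.2 : R)) _ _ _ _ _ _ _) => /=; apply: (@cvgD _ R);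
    apply: cvgM; try exact: cvg_cst.
- by apply: (@cvgB _ R); [exact: cvg_cst|exact: cvg_id].
- exact: cvg_id.
- by apply: (@cvgB _ R); [exact: cvg_cst|exact: cvg_id].
- exact: cvg_id.
Qed.

Lemma mix0 p q : mix 0 p q = p.
Proof. by case: p => ? ?; rewrite /mix subr0 !mul1r !mul0r !addr0. Qed.

Lemma mix1 p q : mix 1 p q = q.
Proof. by case: q => ? ?; rewrite /mix subrr !mul1r !mul0r !add0r. Qed.

Lemma near_toward p q U : nbhs p U -> exists t, [/\ 0 < t, t < 1 & U (mix t p q)].
Proof.
move=> pU; have : \forall t \near (0 : R), U (mix t p q).
  by apply: (@mix_continuous p q 0); rewrite /= mix0.
move=> tU; have tU' : \forall t \near (0:R)^'+, U (mix t p q).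
  by rewrite near_withinE; apply: filterS tU.
near ((0:R)^'+) => t; exists t; split; near: t.
- exact: nbhs_right_gt.
- exact: nbhs_right_lt.
- exact: tU'.
Unshelve. all: by end_near. Qed.

Lemma near_all (T : eqType) (L : seq T) p (P : T -> set plane) :
  (forall l, l \in L -> \forall q \near p, P l q) ->
  \forall q \near p, forall l, l \in L -> P l q.
Proof.
elim: L => [|l L IHL] pP; first by near=> q.
have h1 := pP l (mem_head _ _).
have h2 := IHL (fun l lL => pP l (mem_tl _ lL)).
near=> q => l'; rewrite inE => /predU1P[->|lL]; [near: q; exact: h1|].
by move: l' lL; near: q; exact: h2.
Unshelve. all: by end_near. Qed.

(** Lines are avoided one at a time: a small move off the new line preserves the earlier conditions,
    which are open. The induction keeps U a neighbourhood of the point, so that the next move stays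
    in it. *)
Lemma generic_point p U (L : seq (plane * plane)) : nbhs p U ->
  (forall l, l \in L -> l.1 != l.2) ->
  exists q, U q /\ forall l, l \in L -> det l.1 l.2 q != 0.
Proof.
move=> pU L0; suff [q [qU qL]] : exists q, nbhs q U /\ forall l,
  l \in L -> det l.1 l.2 q != 0.
  by exists q; split=> //; exact: nbhs_singleton.
elim: L L0 => [_|[x y] L IHL L0]; first by exists p.
have [q [qU qL]] := IHL (fun l lL => L0 l (mem_tl _ lL)).
have [qxy|qxy] := eqVneq (det x y q) 0; last first.
  by exists q; split=> // l; rewrite inE => /predU1P[->//|/qL].
(* Adding to q the vector y - x turned by a right angle raises the determinant by the squared length
   of y - x. *)
pose g : plane := (q.1 - (y.2 - x.2), q.2 + (y.1 - x.1)).
have gxy : det x y g != 0.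
  have -> : det x y g = det x y q + ((y.2 - x.2) ^+ 2 + (y.1 - x.1) ^+ 2).
    by rewrite /g; case: x y q {qxy L0 qU qL g} => [x1 x2] [y1 y2] [q1 q2] /=;
      rewrite !detE; ring.
  rewrite qxy add0r paddr_eq0 ?sqr_ge0// !sqrf_eq0 !subr_eq0.
  have := L0 (x, y) (mem_head _ _); apply: contra => /andP[/eqP xy2 /eqP xy1] /=.
  by case: (x) (y) xy1 xy2 => ? ? [? ?] /= -> ->.
have qL' : \forall q' \near q, forall l, l \in L -> det l.1 l.2 q' != 0.
  by apply: near_all => l /qL; exact: near_det_neq0.
have /(near_toward g)[t [t0 t1 [tU tL]]] : \forall q' \near q,
    nbhs q' U /\ forall l, l \in L -> det l.1 l.2 q' != 0.
  by apply: filterI => //; exact: nbhs_interior.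
exists (mix t q g); split=> // l; rewrite inE => /predU1P[->|/tL//] /=.
by rewrite det_mix qxy mulr0 add0r mulf_neq0// gt_eqF.
Qed.

End Topology.

(** * Convex sets and hulls in the plane *)

Section Hull.
Local Open Scope convex_scope.
Variable R : realType.
Local Notation plane := (plane R).
Implicit Types (a b c o p q x y : plane) (e t : R) (X Y : set plane).

Lemma convexP X : @convex_set R plane X <->
  forall p q t, 0 <= t <= 1 -> X p -> X q -> X (mix t p q).
Proof.
split=> [cX p q t /andP[t0 t1] Xp Xq|cX p q l].
  have := cX q p (Itv01 t0 t1) (mem_set Xq) (mem_set Xp); move/set_mem.
  congr (X _); rewrite /mix; congr pair; by rewrite addrC.
rewrite !inE => Xp Xq.
have := cX q p l%:num _ Xq Xp.
have -> : mix l%:num q p = p <| l |> q by rewrite /mix; congr pair; rewrite addrC.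
by apply; apply/andP; split.
Qed.

Lemma hull_sub X : X `<=` hull X.
Proof. exact: sub_smallest. Qed.

Lemma hull_min X Y : @convex_set R plane Y -> X `<=` Y -> hull X `<=` Y.
Proof. exact: smallest_sub. Qed.

Lemma hull_convex X : @convex_set R plane (hull X).
Proof.
apply/convexP => p q t t01 Xp Xq Y [cY XY].
by move/convexP: (cY); apply => //; [exact: Xp|exact: Xq].
Qed.

Lemma hullS X Y : X `<=` Y -> hull X `<=` hull Y.
Proof. by move=> XY; apply: hull_min => [|p /XY];
  [exact: hull_convex|exact: hull_sub]. Qed.

Lemma hull_id X : @convex_set R plane X -> hull X = X.
Proof. by move=> cX; apply/seteqP; split; [exact: hull_min|exact: hull_sub]. Qed.

End Hull.

(** * Sides of polygons and local constancy of winding numbers *)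

Lemma sum_sides (T : Type) (V : nmodType) (F : T -> V) (s : seq T) :
  \sum_(e <- sides s) F e.1 = \sum_(e <- sides s) F e.2.
Proof.
have szr : size (rot 1 s) = size s by rewrite size_rot.
rewrite -(big_map fst xpredT F) -(big_map snd xpredT F) -/(unzip1 _) -/(unzip2 _).
rewrite unzip1_zip ?szr// unzip2_zip ?szr//.
case: s szr => [|x s] _; first by rewrite big_nil.
by rewrite rot1_cons big_rcons /= big_cons addrC.
Qed.

Lemma sides_uniq (T : eqType) (s : seq T) : uniq s -> uniq (sides s).
Proof. exact: zip_uniql. Qed.

Lemma sides_mem (T : eqType) (s : seq T) e : e \in sides s -> e.1 \in s /\ e.2 \in s.
Proof.
case: e => x y /= h; have szr : size (rot 1 s) = size s by rewrite size_rot.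
split; first by rewrite -(@unzip1_zip _ _ s (rot 1 s)) ?szr//; apply/mapP; exists (x, y).
by rewrite -(mem_rot 1) -(@unzip2_zip _ _ s (rot 1 s)) ?szr//; apply/mapP; exists (x, y).
Qed.

Lemma sides_neq (T : eqType) (s : seq T) e : uniq s -> (1 < size s)%N ->
  e \in sides s -> e.1 != e.2.
Proof.
case: s => [//|x s] us s1 es; move/(nthP (x, x)): es => [k].
rewrite size_zip size_rot minnn => is_ <- {e}; rename k into i.
rewrite nth_zip ?size_rot//= rot1_cons -cats1.
move: is_; rewrite /= ltnS leq_eqVlt => /predU1P[->|is_].
  rewrite nth_cat ltnn subnn /=; case: s us s1 => //= y s /andP[xs _] _.
  apply: contra xs => /eqP e0; rewrite -{1}e0.
  exact: (@mem_nth _ x (y :: s) (size s) (ltnSn _)).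
rewrite nth_cat is_ (_ : nth x s i = nth x (x :: s) i.+1)// nth_uniq//.
  by rewrite (ltn_eqF (ltnSn i)).
by rewrite ltnW.
Qed.

Section Polygon.
Variable R : realType.
Local Notation plane := (plane R).
Local Notation P := (int * int)%type.
Local Notation pt := (pt R).
Implicit Types (a b c o p q x y : plane) (e t : R) (s : seq P).

Lemma pt_inj : injective (pt : P -> plane).
Proof. by move=> [a1 a2] [b1 b2] [] /intr_inj -> /intr_inj ->. Qed.

Lemma det_pt (i j k : P) : det (pt i) (pt j) (pt k) = (orient i j k)%:~R :> R.
Proof. by rewrite /det /orient /= rmorphB !rmorphM !rmorphB. Qed.

Lemma segmentP (e : P * P) p : segment e p <->
  exists2 t : R, 0 <= t <= 1 & p = mix t (pt e.1) (pt e.2).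
Proof.
split=> [|[t t01 ->]].
  pose Y : set plane := [set p | exists2 t : R,
    0 <= t <= 1 & p = mix t (pt e.1) (pt e.2)].
  apply: (@hull_min _ _ Y); last first.
    move=> q [->|->]; [exists 0; last by rewrite mix0|exists 1; last by rewrite mix1];
      by rewrite ?lexx ?ler01.
  apply/convexP => _ _ u /andP[u0 u1] [v /andP[v0 v1] ->] [w /andP[w0 w1] ->].
  exists ((1 - u) * v + u * w); first by apply/andP; split; nra.
  by rewrite /mix /=; congr pair; ring.
apply: ((convexP _).1 (hull_convex (X := [set pt e.1; pt e.2]))) => //.
  by apply: hull_sub; left.
by apply: hull_sub; right.
Qed.

(* Unlike a single crossing number, the winding number of a triangle is locally
   constant off the triangle; [o] may be any point of the plane. *)
Lemma winding_fan o s p :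
  winding s p = \sum_(e <- sides s) winding3 o (pt e.1) (pt e.2) p.
Proof.
rewrite windingE /winding3 !big_split /= (sum_sides (fun x : P => crossing o (pt x) p)).
have -> : \sum_(e <- sides s) crossing (pt e.2) o p = - \sum_(e <- sides s) crossing
  o (pt e.2) p.
  by rewrite -sumrN; apply: eq_bigr => e _; rewrite crossing_swap.
by rewrite addrAC subrr add0r.
Qed.

Lemma winding3_swapr o a b p : winding3 o b a p = - winding3 o a b p.
Proof. by rewrite -winding3_rot winding3_swap winding3_rot. Qed.

Lemma winding3_near_out a b c p : 0 < det a b c -> det a b p < 0 ->
  \forall q \near p, winding3 a b c q = winding3 a b c p.
Proof.
move=> abc abp; have [_ /(_ abp) -> _] := winding3_ccw p abc.
apply: filterS (near_det_lt0 abp) => q.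
by have [_ ] := winding3_ccw q abc.
Qed.

(** On the line ab, the position of a point is read off from the areas it spans with an apex o off
    the line. *)
Lemma det_mixE (o a b p : plane) : 0 < det o a b -> det a b p = 0 ->
  p = mix (det o a p / det o a b) a b.
Proof.
move=> oab abp; have oab0 : det o a b != 0 by rewrite gt_eqF.
have d0 := det_sum o a b p; rewrite abp addr0 in d0.
have [b1 b2] := det_bary o a b p; rewrite abp !mul0r !add0r in b1 b2.
rewrite /mix [LHS]surjective_pairing; congr pair; apply: (mulfI oab0).
  by rewrite b1 -d0 in oab0 *; field.
by rewrite b2 -d0 in oab0 *; field.
Qed.

(** A negative determinant at some side puts p in an open outer half-plane, and three positive ones
    put it inside. The spokes from o are excluded by hypothesis, and a zero at ab with the other two
    positive would put p on the segment. *)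
Lemma winding3_near o a b p : det o a b != 0 -> det o a p != 0 -> det b o p != 0 ->
  ~ (exists2 t : R, 0 <= t <= 1 & p = mix t a b) ->
  \forall q \near p, winding3 o a b q = winding3 o a b p.
Proof.
(* Exchanging a and b negates [winding3] and reverses the orientation. *)
wlog oab : a b / 0 < det o a b => [wl|_].
  rewrite neq_lt => /orP[oab|oab] oap bop ab; last first.
    by apply: (wl a b oab) => //; rewrite gt_eqF.
  have oba : 0 < det o b a by rewrite -det_rot det_swap oppr_gt0 det_rot.
  have := wl b a oba; rewrite (gt_eqF oba) => /(_ isT).
  rewrite (det_swap b o) oppr_eq0 (det_swap o a) oppr_eq0 => /(_ bop oap) h.
  have {}h : \forall q \near p, winding3 o b a q = winding3 o b a p.
    apply: h => -[t /andP[t0 t1] pt']; apply: ab; exists (1 - t); first by lra.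
    by rewrite pt' /mix; congr pair; ring.
  by apply: filterS h => q; rewrite !(winding3_swapr o a b) => /oppr_inj.
move=> oap bop ab.
have T q := @winding3_ccw R o a b q oab.
have rot1 q : winding3 o a b q = winding3 a b o q by rewrite [RHS]winding3_rot.
have rot2 q : winding3 o a b q = winding3 b o a q by rewrite [LHS]winding3_rot.
have abo : 0 < det a b o by rewrite det_rot.
have boa : 0 < det b o a by rewrite -det_rot.
have [h|h|h] := ltrgt0P (det o a p); last by rewrite h eqxx in oap.
  have [h'|h'|h'] := ltrgt0P (det b o p); last by rewrite h' eqxx in bop.
    have [h2|h2|abp] := ltrgt0P (det a b p).
    - have [/(_ h h2 h') -> _ _] := T p.
      near=> q; have [+ _ _] := T q; apply; near: q; exact: near_det_gt0.
    - by apply: filterS (winding3_near_out abo h2) => q; rewrite !rot1.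
    exfalso; apply: ab; exists (det o a p / det o a b); last exact: det_mixE.
    rewrite divr_ge0 ?(ltW h) ?(ltW oab)//= ler_pdivrMr// mul1r.
    by rewrite -(det_sum o a b p) abp addr0 lerDl ltW.
  by apply: filterS (winding3_near_out boa h') => q; rewrite !rot2.
exact: winding3_near_out.
Unshelve. all: by end_near. Qed.

(** If o, a, b is counterclockwise, the left of ab is inside the triangle and w = 0; if clockwise,
    the right is inside and w = -1. The jump is the same, so the orientation of the fan triangle is
    irrelevant. *)
Lemma winding3_jump o a b t : det o a b != 0 -> 0 < t -> t < 1 ->
  exists w : int, \forall q \near mix t a b,
    (0 < det a b q -> winding3 o a b q = w + 1) /\ (det a b q < 0 -> winding3 o a b q
      = w).
Proof.
move=> + t0 t1; set p := mix t a b.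
have oap : det o a p = t * det o a b by rewrite det_mix det_right mulr0 add0r.
have bop : det b o p = (1 - t) * det o a b.
  by rewrite det_mix det_left mulr0 addr0 (det_rot a) (det_rot o).
rewrite neq_lt => /orP[oab|oab]; last first.
  have h1 : 0 < det o a p by rewrite oap mulr_gt0.
  have h2 : 0 < det b o p by rewrite bop mulr_gt0 // subr_gt0.
  exists 0; near=> q; have qo : 0 < det o a q by near: q; exact: near_det_gt0.
  have qb : 0 < det b o q by near: q; exact: near_det_gt0.
  have [tp _ _] := winding3_ccw q oab; rewrite add0r; split=> abq; first exact: tp.
  rewrite -[winding3 o a b q]winding3_rot.
  have abo : 0 < det a b o by rewrite det_rot.
  by have [_ tn _] := winding3_ccw q abo; exact: tn.
have oba : 0 < det o b a by rewrite -det_rot det_swap oppr_gt0 det_rot.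
have h1 : 0 < det a o p by rewrite det_swap oap oppr_gt0 pmulr_rlt0.
have h2 : 0 < det o b p by rewrite det_swap bop oppr_gt0 pmulr_rlt0 ?subr_gt0.
exists (-1); near=> q; have qo : 0 < det a o q by near: q; exact: near_det_gt0.
have qb : 0 < det o b q by near: q; exact: near_det_gt0.
rewrite -[winding3 o a b q]opprK -winding3_swapr; split=> abq.
  rewrite -winding3_rot addNr; have bao : 0 < det b a o by rewrite det_rot.
  have [_ tn _] := winding3_ccw q bao; apply/eqP; rewrite oppr_eq0; apply/eqP/tn.
  by rewrite det_swap oppr_lt0.
have [tp _ _] := winding3_ccw q oba; congr (- _); apply: tp => //.
- by rewrite det_swap oppr_gt0.
Unshelve. all: by end_near. Qed.

Lemma apex a b : a != b -> exists o, 0 < det a b o.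
Proof.
case: a b => [a1 a2] [b1 b2] ab; exists (a1 - (b2 - a2), a2 + (b1 - a1)).
have -> : det (a1, a2) (b1, b2) (a1 - (b2 - a2), a2 + (b1 - a1)) =
  (b1 - a1) ^+ 2 + (b2 - a2) ^+ 2 by rewrite detE; ring.
rewrite lt_neqAle addr_ge0 ?sqr_ge0// andbT eq_sym paddr_eq0 ?sqr_ge0// !sqrf_eq0
  !subr_eq0.
by apply: contra ab => /andP[/eqP -> /eqP ->].
Qed.

(** With an apex on its left, the segment is cut out by one equation and two weak inequalities;
    where one of them fails, it fails nearby. *)
Lemma near_not_segment (e : P * P) p : e.1 != e.2 -> ~ segment e p ->
  \forall q \near p, ~ segment e q.
Proof.
move=> e12 ep; have pe12 : pt e.1 != pt e.2 by rewrite (inj_eq pt_inj).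
have [ o eo] := apex pe12.
have seg0 q : segment e q -> [/\ det (pt e.1) (pt e.2) q = 0,
    0 <= det (pt e.2) o q & 0 <= det o (pt e.1) q].
  move=> /segmentP[t /andP[t0 t1] ->]; rewrite !det_mix !det_left !det_right.
  have -> : det (pt e.2) o (pt e.1) = det (pt e.1) (pt e.2) o by rewrite det_rot.
  have -> : det o (pt e.1) (pt e.2) = det (pt e.1) (pt e.2) o by rewrite -det_rot.
  rewrite !mulr0 !addr0 add0r; split=> //; apply: mulr_ge0 => //;
    first by rewrite subr_ge0.
  - exact: ltW.
  - exact: ltW.
have [h|h] := ltP (det (pt e.2) o p) 0.
  apply: filterS (near_det_lt0 h) => q qo /seg0[_ + _].
  by rewrite leNgt qo.
have [h'|h'] := ltP (det o (pt e.1) p) 0.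
  apply: filterS (near_det_lt0 h') => q qo /seg0[_ _].
  by rewrite leNgt qo.
have [h2|h2] := eqVneq (det (pt e.1) (pt e.2) p) 0; last first.
  by apply: filterS (near_det_neq0 h2) => q + /seg0[qe _ _]; rewrite qe eqxx.
exfalso; apply/ep/segmentP.
have oe : 0 < det o (pt e.1) (pt e.2) by rewrite -det_rot.
exists (det o (pt e.1) p / det o (pt e.1) (pt e.2)); last exact: det_mixE.
rewrite divr_ge0 ?(ltW oe)//= ler_pdivrMr// mul1r.
by rewrite -(det_sum o (pt e.1) (pt e.2) p) h2 addr0 lerDl.
Qed.

End Polygon.

Section Winding.
Variable R : realType.
Local Notation plane := (plane R).
Local Notation P := (int * int)%type.
Local Notation pt := (pt R).
Implicit Types (a b c o p q x y : plane) (e f : P * P) (t : R) (s : seq P).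

Lemma near_sum (T : eqType) (L : seq T) p (F : T -> plane -> int) :
  (forall l, l \in L -> \forall q \near p, F l q = F l p) ->
  \forall q \near p, \sum_(l <- L) F l q = \sum_(l <- L) F l p.
Proof.
move=> h; have := near_all (P := fun l q => F l q = F l p) h; apply: filterS => q hq.
exact: eq_big_seq.
Qed.

Lemma segment_left e : segment e (pt e.1).
Proof. by apply: hull_sub; left. Qed.

Lemma segment_right e : segment e (pt e.2).
Proof. by apply: hull_sub; right. Qed.

(** Generic with respect to the lines of [L], the apex gives nondegenerate fan triangles; generic
    with respect to the lines from p to the endpoints of [r], it keeps p off the spokes. The lists
    differ when p lies on one side of the polygon, which is then left out of [r]. *)
Lemma exists_apex (L : seq (P * P)) p (r : seq (P * P)) :
  (forall e, e \in L -> e.1 != e.2) ->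
  (forall e, e \in r -> ~ segment e p) ->
  exists o, (forall e, e \in L -> det o (pt e.1) (pt e.2) != 0) /\
    (forall e, e \in r -> det o (pt e.1) p != 0 /\ det (pt e.2) o p != 0).
Proof.
move=> L0 r0.
pose G : seq (plane * plane) := [seq (pt e.1, pt e.2) | e <- L] ++
  [seq (pt e.1, p) | e <- r] ++ [seq (pt e.2, p) | e <- r].
have [||o [_ oG]] := @generic_point R p setT G; first exact: filterT.
  move=> l; rewrite !mem_cat => /or3P[]/mapP[e eL ->] /=.
  - by rewrite (inj_eq (@pt_inj R)); exact: L0.
  - by apply/eqP => ep; apply: (r0 e eL); rewrite -ep; exact: segment_left.
  - by apply/eqP => ep; apply: (r0 e eL); rewrite -ep; exact: segment_right.
exists o; split=> e eL.
  have := oG (pt e.1, pt e.2);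
    rewrite !mem_cat (map_f (fun e => (pt e.1, pt e.2)) eL) => /(_ isT) /=.
  by rewrite (det_rot o).
split.
  have := oG (pt e.1, p);
    rewrite !mem_cat (map_f (fun e => (pt e.1, p)) eL) orbT => /(_ isT) /=.
  by rewrite (det_rot o).
have := oG (pt e.2, p);
  rewrite !mem_cat (map_f (fun e => (pt e.2, p)) eL) !orbT => /(_ isT) /=.
by rewrite (det_swap p) oppr_eq0 [det (pt e.2) o p]det_rot.
Qed.

Lemma winding_near s p : (forall e, e \in sides s -> e.1 != e.2) ->
  ~ boundary s p -> \forall q \near p, winding s q = winding s p.
Proof.
move=> s0 sp; have sp' e : e \in sides s -> ~ segment e p.
  by move=> es ep; apply: sp; exists e.
have [z [k1 k2]] := exists_apex s0 sp'.
rewrite (winding_fan z s p).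
have h : \forall q \near p, \sum_(e <- sides s) winding3 z (pt e.1) (pt e.2) q =
    \sum_(e <- sides s) winding3 z (pt e.1) (pt e.2) p.
  apply: near_sum => e es; have [h1 h2] := k2 e es.
  by apply: winding3_near => //; [exact: k1|move=> /segmentP; exact: sp'].
by apply: filterS h => q; rewrite (winding_fan z).
Qed.

Lemma winding_jump s e t : uniq (sides s) -> (forall e, e \in sides s -> e.1 != e.2) ->
  e \in sides s -> 0 < t -> t < 1 ->
  (forall f, f \in sides s -> f != e -> ~ segment f (mix t (pt e.1) (pt e.2))) ->
  exists w : int, \forall q \near mix t (pt e.1) (pt e.2),
    (0 < det (pt e.1) (pt e.2) q -> winding s q = w + 1) /\
    (det (pt e.1) (pt e.2) q < 0 -> winding s q = w).
Proof.
move=> us s0 es t0 t1 only; set p := mix _ _ _ in only *.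
pose r := rem e (sides s).
have rP f : f \in r -> f \in sides s /\ f != e.
  by rewrite mem_rem_uniq// !inE => /andP[].
have r0 f : f \in r -> ~ segment f p by move=> /rP[fs fe]; exact: only.
have [z [k1 k2]] := exists_apex s0 r0.
have [w hw] := winding3_jump (k1 e es) t0 t1.
have hr : \forall q \near p, \sum_(f <- r) winding3 z (pt f.1) (pt f.2) q =
    \sum_(f <- r) winding3 z (pt f.1) (pt f.2) p.
  apply: near_sum => f fr; have [h1 h2] := k2 f fr.
  apply: winding3_near => //; first by apply: k1; have [] := rP f fr.
  by move=> /segmentP; exact: r0.
exists (w + \sum_(f <- r) winding3 z (pt f.1) (pt f.2) p).
near=> q; have [w1 w2] :
  (0 < det (pt e.1) (pt e.2) q -> winding3 z (pt e.1) (pt e.2) q = w + 1) /\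
    (det (pt e.1) (pt e.2) q < 0 -> winding3 z (pt e.1) (pt e.2) q = w).
  by near: q; exact: hw.
have hq : \sum_(f <- r) winding3 z (pt f.1) (pt f.2) q = \sum_(f <- r) winding3 z (pt
  f.1) (pt f.2) p.
  by near: q; exact: hr.
by rewrite (winding_fan z) (perm_big _ (perm_to_rem es)) /= big_cons -/r hq; split=> h;
  rewrite ?(w1 h) ?(w2 h) // addrAC.
Unshelve. all: by end_near. Qed.

Section Clockwise.
Variable s : seq P.
Hypothesis s_polygon : clockwise_polygon R s.

Lemma polygon_uniq : uniq s. Proof. by case: s_polygon => -[]. Qed.

Lemma polygon_sides e : e \in sides s -> e.1 != e.2.
Proof. by case: s_polygon => -[s3 us _] _; apply: sides_neq => //; exact: ltnW. Qed.

Lemma polygon_winding q : ~ boundary s q -> winding s q = 0 \/ winding s q = -1.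
Proof.
case: s_polygon => _ cw bq; have [->|wq] := eqVneq (winding s q) 0; first by left.
by right; apply: cw => //; right.
Qed.

Lemma mix_inner (e : P * P) t : e.1 != e.2 -> 0 < t -> t < 1 ->
  mix t (pt e.1) (pt e.2) != pt e.1 /\ mix t (pt e.1) (pt e.2) != pt e.2.
Proof.
rewrite -(inj_eq (@pt_inj R)) => e12 t0 t1.
have [ o] := apex e12; rewrite (det_rot o) => oe.
split; apply/eqP => me.
  have := det_mix o (pt e.1) t (pt e.1) (pt e.2); rewrite me det_right mulr0 add0r.
  by move/esym/eqP; rewrite mulf_eq0 (gt_eqF oe) orbF (gt_eqF t0).
have := det_mix (pt e.2) o t (pt e.1) (pt e.2);
  rewrite me det_left mulr0 addr0 (det_rot (pt e.1)) (det_rot o).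
by move/esym/eqP; rewrite mulf_eq0 (gt_eqF oe) orbF subr_eq0 gt_eqF.
Qed.

Lemma polygon_inner e f t : e \in sides s -> f \in sides s -> f != e -> 0 < t -> t < 1 ->
  ~ segment f (mix t (pt e.1) (pt e.2)).
Proof.
move=> es fs fe t0 t1 fp; case: s_polygon => -[_ _ simp] _.
have [||a [pa ea _]] := simp e f es fs _ (mix t (pt e.1) (pt e.2)) _ fp.
- by apply/eqP; rewrite eq_sym.
- by apply/segmentP; exists t; rewrite ?(ltW t0) ?(ltW t1).
have [m1 m2] := mix_inner (polygon_sides es) t0 t1.
by case/orP: ea pa m1 m2 => /eqP -> ->; rewrite eqxx.
Qed.

(** The winding number jumps by 1 across the side, from w on the right to w + 1 on the left. Test
    points on both sides lie off the boundary, where only 0 and -1 are possible, so w = -1. *)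
Lemma polygon_side e t : e \in sides s -> 0 < t -> t < 1 ->
  \forall q \near mix t (pt e.1) (pt e.2),
    [/\ 0 < det (pt e.1) (pt e.2) q -> winding s q = 0,
        det (pt e.1) (pt e.2) q < 0 -> winding s q = -1 &
        det (pt e.1) (pt e.2) q != 0 -> ~ boundary s q].
Proof.
move=> es t0 t1; have us := sides_uniq polygon_uniq.
have only f : f \in sides s -> f != e -> ~ segment f (mix t (pt e.1) (pt e.2)).
  by move=> fs fe; exact: polygon_inner.
have [w hw] := winding_jump us polygon_sides es t0 t1 only.
set p := mix _ _ _ in only hw *.
have hb : \forall q \near p, det (pt e.1) (pt e.2) q != 0 -> ~ boundary s q.
  have : \forall q \near p, forall f, f \in sides s -> f != e -> ~ segment f q.
    apply: near_all => f fs; have [->|fe] := eqVneq f e; first by near=> q.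
    near=> q => _; near: q; apply: near_not_segment; first exact: polygon_sides.
    exact: only.
  apply: filterS => q h dq [f fs fq]; have [fe|/h] := eqVneq f e; last exact.
  move: fq dq; rewrite fe => /segmentP[u _ ->].
  by rewrite det_mix det_left det_right !mulr0 addr0 eqxx.
have dp : det (pt e.1) (pt e.2) p = 0 by rewrite det_mix det_left det_right !mulr0 addr0.
have e12 : pt e.1 != pt e.2 by rewrite (inj_eq (@pt_inj R)); exact: polygon_sides.
have [g eg] := apex e12.
have e21 : pt e.2 != pt e.1 by rewrite eq_sym.
have [h] := apex e21.
rewrite det_swap oppr_gt0 => eh.
have hwb : \forall q \near p, ((0 < det (pt e.1) (pt e.2) q -> winding s q = w + 1) /\
    (det (pt e.1) (pt e.2) q < 0 -> winding s q = w)) /\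
    (det (pt e.1) (pt e.2) q != 0 -> ~ boundary s q) by exact: filterI.
have [u [u0 u1 [[wl _] bl]]] := near_toward g hwb.
have [v [v0 v1 [[_ wr] br]]] := near_toward h hwb.
have w0 : w = -1.
  move: wl bl; rewrite (det_mix _ _ u) dp mulr0 add0r (gt_eqF (mulr_gt0 u0 eg))
    mulr_gt0//.
  move=> /(_ isT) wl /(_ isT) /polygon_winding; rewrite wl.
  move: wr br; rewrite (det_mix _ _ v) dp mulr0 add0r pmulr_rlt0// eh => /(_ isT) wr.
  rewrite lt_eqF ?pmulr_rlt0// => /(_ isT) /polygon_winding; rewrite wr.
  by case=> -> // [].
apply: filterS hwb => q [[w1 w2] b]; split=> // k; first by rewrite w1// w0 addNr.
by rewrite w2.
Unshelve. all: by end_near. Qed.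

End Clockwise.

End Winding.

(** * Triangles *)

Definition triangle_edges (T : Type) (t : T * T * T) : seq (T * T) :=
  [:: t.1; (t.1.2, t.2); (t.2, t.1.1)].

Definition rotate (T : Type) (t : T * T * T) : T * T * T := (t.1.2, t.2, t.1.1).

Section Triangle.
Variable R : realType.
Local Notation plane := (plane R).
Local Notation P := (int * int)%type.
Local Notation pt := (pt R).
Implicit Types (a b c o p q x y : plane) (e f : P * P) (s : seq P) (T : P * P * P).

Definition corners T : {fset P} := [fset T.1.1; T.1.2; T.2]%fset.

Definition ccw T := 0 < orient T.1.1 T.1.2 T.2.

Definition inside T p := [/\ 0 < det (pt T.1.1) (pt T.1.2) p,
  0 < det (pt T.1.2) (pt T.2) p & 0 < det (pt T.2) (pt T.1.1) p].

Definition triangle_winding T p := winding3 (pt T.1.1) (pt T.1.2) (pt T.2) p.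

Lemma det_ccw T : ccw T -> 0 < det (pt T.1.1) (pt T.1.2) (pt T.2).
Proof. by rewrite det_pt ltr0z. Qed.

Lemma ccw_neq T : ccw T -> [/\ T.1.1 != T.1.2, T.1.2 != T.2 & T.2 != T.1.1].
Proof.
move=> /det_ccw; case: T => [[a b] c] /= d0.
split; apply/eqP => h; move: d0; rewrite ?h.
- by rewrite -det_rot det_left ltxx.
- by rewrite det_right ltxx.
- by rewrite det_left ltxx.
Qed.

Lemma inside_trot T p : inside (rotate T) p <-> inside T p.
Proof. by split=> -[]. Qed.

Lemma triangle_winding_trot T p : triangle_winding (rotate T) p = triangle_winding T p.
Proof. exact: winding3_rot. Qed.

Lemma corners_trot T : corners (rotate T) = corners T.
Proof. by apply/fsetP => v; rewrite !inE /= orbC orbA. Qed.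

Lemma orient_rot (i j k : P) : orient j k i = orient i j k.
Proof. by case: i j k => [? ?] [? ?] [? ?]; rewrite /orient /=; ring. Qed.

Lemma ccw_trot T : ccw (rotate T) = ccw T.
Proof. by rewrite /ccw orient_rot. Qed.

Lemma triangle_edges_trot T e :
  (e \in triangle_edges (rotate T)) = (e \in triangle_edges T).
Proof. by rewrite !inE /= -surjective_pairing orbA orbC. Qed.

(** Bundles what rotation preserves, so that a claim about any edge can be proved for the first one,
    which is literally [T'.1]. *)
Variant rot_spec T e : P * P * P -> Prop :=
  RotSpec T' of T'.1 = e & ccw T' & corners T' = corners T &
    (forall p, inside T' p <-> inside T p) & (forall p,
      triangle_winding T' p = triangle_winding T p) &
    triangle_edges T' =i triangle_edges T : rot_spec T e T'.

Lemma edge_rot T e : ccw T -> e \in triangle_edges T -> exists T', rot_spec T e T'.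
Proof.
move=> cT; rewrite !inE => /or3P[]/eqP->.
- by exists T; split.
- exists (rotate T); split=> //; rewrite ?ccw_trot ?corners_trot// => ?.
  + exact: inside_trot.
  + exact: triangle_winding_trot.
  + exact: triangle_edges_trot.
exists (rotate (rotate T)); split=> //; rewrite ?ccw_trot ?corners_trot// => ?.
- by rewrite !inside_trot.
- by rewrite !triangle_winding_trot.
- by rewrite !triangle_edges_trot.
Qed.

Lemma triangle_winding_ge0 T p : ccw T -> 0 <= triangle_winding T p.
Proof.
move=> /det_ccw d0; rewrite /triangle_winding.
by have [_ _ [->|[-> _]]] := winding3_ccw p d0.
Qed.

Lemma inside_triw T p : ccw T -> inside T p -> triangle_winding T p = 1.
Proof.
move=> /det_ccw d0 [h1 h2 h3].
by have [+ _ _] := winding3_ccw p d0; apply.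
Qed.

Lemma inside_near T p : inside T p -> \forall q \near p, inside T q.
Proof. by move=> [h1 h2 h3]; near=> q; split; near: q; exact: near_det_gt0.
Unshelve. all: by end_near. Qed.

(* The barycentric coordinate of [p] at the vertex [v], times twice the area. *)
Definition bary T v p : R :=
  if v == T.1.1 then det (pt T.1.2) (pt T.2) p
  else if v == T.1.2 then det (pt T.2) (pt T.1.1) p
  else if v == T.2 then det (pt T.1.1) (pt T.1.2) p else 0.

Lemma bary_mix T v t p q : bary T v (mix t p q) = (1 - t) * bary T v p + t * bary T v q.
Proof.
rewrite /bary; do 3 ?[case: ifP => _; first exact: det_mix].
by rewrite !mulr0 addr0.
Qed.

Lemma bary_pt T v v' : ccw T -> v \in corners T -> v' \in corners T ->
  bary T v (pt v') = if v == v' then det (pt T.1.1) (pt T.1.2) (pt T.2) else 0.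
Proof.
case: T => [[a b] c] cT; have [/= ab bc ca] := ccw_neq cT.
rewrite /bary !inE /= -!orbA => /or3P[]/eqP-> /or3P[]/eqP->;
  rewrite ?eqxx ?(negPf ab) ?(negPf bc) ?(negPf ca) ?[b == a]eq_sym ?[c == b]eq_sym
  ?[a == c]eq_sym ?(negPf ab) ?(negPf bc) ?(negPf ca) ?det_left ?det_right//.
- by rewrite det_rot.
- by rewrite -det_rot.
Qed.

Lemma conv2 (Y : set plane) (u v : R) a b : @convex_set R plane Y ->
  0 <= u -> 0 <= v -> 0 < u + v -> (u != 0 -> Y a) -> (v != 0 -> Y b) ->
  Y ((u * a.1 + v * b.1) / (u + v), (u * a.2 + v * b.2) / (u + v)).
Proof.
move=> /convexP cY u0 v0 uv Ya Yb; have uvn : u + v != 0 by rewrite gt_eqF.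
have [uz|un] := eqVneq u 0.
  have vn : v != 0 by rewrite uz add0r in uvn.
  have := Yb vn; congr (Y _); case: b {Yb} => b1 b2 /=.
  by rewrite uz !mul0r !add0r; congr pair; field.
have [vz|vn] := eqVneq v 0.
  have := Ya un; congr (Y _); case: a {Ya} => a1 a2 /=.
  by rewrite vz !mul0r !addr0; congr pair; field.
have := cY a b (v / (u + v)) _ (Ya un) (Yb vn).
have -> : mix (v / (u + v)) a b =
    ((u * a.1 + v * b.1) / (u + v), (u * a.2 + v * b.2) / (u + v)).
  by rewrite /mix; congr pair; field.
by apply; rewrite divr_ge0 ?(ltW uv)//= ler_pdivrMr// mul1r lerDr.
Qed.

(** A point of weight zero need not belong to [Y]; this lets the same argument serve faces of every
    dimension. *)
Lemma conv3 (Y : set plane) (u v w : R) a b c p : @convex_set R plane Y ->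
  0 <= u -> 0 <= v -> 0 <= w -> 0 < u + v + w ->
  (u != 0 -> Y a) -> (v != 0 -> Y b) -> (w != 0 -> Y c) ->
  (u + v + w) * p.1 = u * a.1 + v * b.1 + w * c.1 ->
  (u + v + w) * p.2 = u * a.2 + v * b.2 + w * c.2 -> Y p.
Proof.
move=> cY u0 v0 w0 d0 Ya Yb Yc p1 p2; have dn : u + v + w != 0 by rewrite gt_eqF.
have pE : p = ((u * a.1 + v * b.1 + w * c.1) / (u + v + w),
    (u * a.2 + v * b.2 + w * c.2) / (u + v + w)).
  rewrite -p1 -p2 ![(u + v + w) * _]mulrC !mulfK//.
  by case: (p).
have [uv|uv] := eqVneq (u + v) 0.
  have : u == 0 /\ v == 0 by apply/andP; rewrite -paddr_eq0// uv.
  move=> [/eqP uz /eqP vz].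
  have wn : w != 0 by rewrite uz vz !add0r in dn.
  have := Yc wn; congr (Y _); rewrite pE uz vz !mul0r !add0r ![w * _]mulrC !mulfK//.
  by case: (c).
have uvp : 0 < u + v by rewrite lt_neqAle eq_sym uv addr_ge0.
have := conv2 cY (addr_ge0 u0 v0) w0 d0 (fun=> conv2 cY u0 v0 uvp Ya Yb) Yc.
by congr (Y _); rewrite pE /=; congr pair; field; rewrite ?uv ?dn.
Qed.

(** A face is where the barycentric coordinates of the omitted corners vanish. For empty [S] all
    coordinates would vanish, against their positive sum. *)
Lemma conv_face T (S : {fset P}) p : ccw T -> (S `<=` corners T)%fset ->
  conv_pts S p <->
  (forall v, v \in corners T -> 0 <= bary T v p /\ (v \notin S -> bary T v p = 0)).
Proof.
move=> cT ST; have d0 := det_ccw cT; split=> [|h].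
  pose Y := [set p : plane | forall v,
    v \in corners T -> 0 <= bary T v p /\ (v \notin S -> bary T v p = 0)].
  apply: (@hull_min _ _ Y) => [|_ [w wS <-] v vT].
    apply/convexP => x y t /andP[t0 t1] Yx Yy v vT.
    have [x0 xS] := Yx v vT; have [y0 yS] := Yy v vT; rewrite bary_mix; split.
      by rewrite addr_ge0 ?mulr_ge0 ?subr_ge0.
    by move=> vS; rewrite xS// yS// !mulr0 addr0.
  rewrite (bary_pt cT vT (fsubsetP ST w wS)); split; first by case: ifP => // _;
    exact: ltW.
  by case: eqP => // -> /negP[].
have [ab bc ca] := ccw_neq cT.
have la : bary T T.1.1 p = det (pt T.1.2) (pt T.2) p by rewrite /bary eqxx.
have lb : bary T T.1.2 p = det (pt T.2) (pt T.1.1) p.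
  by rewrite /bary eqxx eq_sym (negPf ab).
have lc : bary T T.2 p = det (pt T.1.1) (pt T.1.2) p.
  by rewrite /bary eqxx (negPf ca) eq_sym (negPf bc).
have [|ha aS] := h T.1.1; first by rewrite !inE eqxx.
have [|hb bS] := h T.1.2; first by rewrite !inE eqxx orbT.
have [|hc cS] := h T.2; first by rewrite !inE eqxx !orbT.
have YS v : bary T v p != 0 -> (v \notin S -> bary T v p = 0) -> conv_pts S (pt v).
  by move=> v0 vS; apply: hull_sub; exists v => //=; apply: contra_neqT v0.
have sumd : bary T T.1.1 p + bary T T.1.2 p + bary T T.2 p = det (pt T.1.1) (pt
  T.1.2) (pt T.2).
  by rewrite la lb lc -(det_sum (pt T.1.1) (pt T.1.2) (pt T.2) p); ring.
have [b1 b2] := det_bary (pt T.1.1) (pt T.1.2) (pt T.2) p.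
rewrite -la -lb -lc -sumd in b1 b2.
apply: (conv3 (hull_convex (X := pt @` [set` S])) ha hb hc _ _ _ _ b1 b2).
- by rewrite sumd.
- by move=> /YS; apply.
- by move=> /YS; apply.
- by move=> /YS; apply.
Qed.

Lemma conv_triangle T p : ccw T -> conv_pts (corners T) p <->
  [/\ 0 <= det (pt T.1.1) (pt T.1.2) p, 0 <= det (pt T.1.2) (pt T.2) p &
      0 <= det (pt T.2) (pt T.1.1) p].
Proof.
move=> cT; rewrite (conv_face p cT (fsubset_refl _)).
have [ab bc ca] := ccw_neq cT; split=> [h|[h1 h2 h3] v].
  have [|ha _] := h T.1.1; first by rewrite !inE eqxx.
  have [|hb _] := h T.1.2; first by rewrite !inE eqxx orbT.
  have [|hc _] := h T.2; first by rewrite !inE eqxx !orbT.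
  move: ha hb hc; rewrite /bary !eqxx (negPf ca) eq_sym (negPf ab).
  by rewrite eq_sym (negPf bc).
move=> vT; split; last by rewrite vT.
by rewrite /bary; do 3 ?case: ifP => // _.
Qed.

Lemma triangle_winding_conv T p :
  ccw T -> triangle_winding T p != 0 -> conv_pts (corners T) p.
Proof.
move=> cT; have [_ _ [h|[_ h]]] := winding3_ccw p (det_ccw cT).
  by rewrite /triangle_winding h.
by move=> _; apply/(conv_triangle p cT).
Qed.

Lemma inside_conv T p : ccw T -> inside T p -> conv_pts (corners T) p.
Proof. by move=> cT ip; apply: triangle_winding_conv => //; rewrite inside_triw. Qed.

Lemma conv_near_inn T p (U : set plane) : ccw T -> conv_pts (corners T) p -> nbhs p U ->
  exists q, U q /\ inside T q.
Proof.
move=> cT /(conv_triangle p cT)[h1 h2 h3] pU; have d0 := det_ccw cT.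
have d1 : 0 < det (pt T.1.2) (pt T.2) (pt T.1.1) by rewrite det_rot.
have d2 : 0 < det (pt T.2) (pt T.1.1) (pt T.1.2) by rewrite det_rot det_rot.
(* An interior point, with weights 1/2, 1/4, 1/4; moving from any point of the closed triangle
   towards it enters the interior at once. *)
pose g := mix 2^-1 (pt T.1.1) (mix 2^-1 (pt T.1.2) (pt T.2)).
have [t [t0 t1 Ut]] := near_toward g pU; exists (mix t p g); split=> //.
have u1 : 0 <= 1 - t by rewrite subr_ge0 ltW.
have hf : 0 < 2^-1 :> R by rewrite invr_gt0.
have hf' : 0 < 1 - 2^-1 :> R by rewrite subr_gt0 invf_lt1// ltr1n.
by split; rewrite /g !det_mix !det_left !det_right !(mulr0, addr0, add0r);
  apply: ltr_wpDl; do ?[exact: mulr_ge0|apply: mulr_gt0 => //].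
Qed.

(** At a relative interior point of an edge the other two determinants are positive, hence also
    nearby. *)
Lemma near_edge T e t : ccw T -> e \in triangle_edges T -> 0 < t -> t < 1 ->
  \forall q \near mix t (pt e.1) (pt e.2), 0 < det (pt e.1) (pt e.2) q -> inside T q.
Proof.
move=> cT eT t0 t1; have [_ [T' <- cT' _ T'T _ _]] := edge_rot cT eT.
have d0 := det_ccw cT'.
have h1 : 0 < det (pt T'.1.2) (pt T'.2) (mix t (pt T'.1.1) (pt T'.1.2)).
  have u1 : 0 < 1 - t by rewrite subr_gt0.
  by rewrite det_mix det_left mulr0 addr0 det_rot mulr_gt0.
have h2 : 0 < det (pt T'.2) (pt T'.1.1) (mix t (pt T'.1.1) (pt T'.1.2)).
  by rewrite det_mix det_right mulr0 add0r det_rot det_rot mulr_gt0.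
near=> q => dq; apply/T'T; split=> //; near: q; exact: near_det_gt0.
Unshelve. all: by end_near. Qed.

Lemma conv_pts_edge e : conv_pts [fset e.1; e.2]%fset = segment e :> set plane.
Proof.
rewrite /conv_pts /segment; congr hull; apply/seteqP; split=> [_ [v + <-]|].
  by rewrite /= !inE => /orP[]/eqP->; [left|right].
by move=> _ [->|->]; [exists e.1|exists e.2] => //=; rewrite !inE eqxx ?orbT.
Qed.

Lemma triangle_edges_tpts T e : e \in triangle_edges T -> ([fset e.1;
  e.2] `<=` corners T)%fset.
Proof.
rewrite !inE => /or3P[]/eqP->; apply/fsubsetP => v; rewrite !inE /= => /orP[]/eqP->;
  by rewrite eqxx ?orbT.
Qed.

Lemma triangle_position T p : ccw T -> conv_pts (corners T) p ->
  [\/ inside T p,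
      exists e t, [/\ e \in triangle_edges T, 0 < t,
        t < 1 & p = mix t (pt e.1) (pt e.2)] |
      exists2 v, v \in corners T & p = pt v].
Proof.
suff H T' : ccw T' -> conv_pts (corners T') p -> det (pt T'.1.1) (pt T'.1.2) p = 0 ->
    (exists t, [/\ 0 < t, t < 1 & p = mix t (pt T'.1.1) (pt T'.1.2)]) \/
    exists2 v, v \in corners T' & p = pt v.
  move=> cT pT; have [h1 h2 h3] := (conv_triangle p cT).1 pT.
  have E T' : ccw T' -> conv_pts (corners T') p -> T'.1 \in triangle_edges T ->
    corners T' = corners T ->
    det (pt T'.1.1) (pt T'.1.2) p = 0 ->
    [\/ inside T p,
      exists e t, [/\ e \in triangle_edges T, 0 < t,
        t < 1 & p = mix t (pt e.1) (pt e.2)] |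
      exists2 v, v \in corners T & p = pt v].
    move=> cT' pT' eT TT d0; have [[t [t0 t1 pE]]|[v vT pE]] := H T' cT' pT' d0.
      by apply: Or32; exists T'.1, t.
    by apply: Or33; exists v; rewrite -?TT.
  have [d1|d1] := eqVneq (det (pt T.1.1) (pt T.1.2) p) 0.
    by apply: (E T) => //; rewrite inE eqxx.
  have [d2|d2] := eqVneq (det (pt T.1.2) (pt T.2) p) 0.
    by apply: (E (rotate T)) => //; rewrite ?ccw_trot ?corners_trot// !inE eqxx orbT.
  have [d3|d3] := eqVneq (det (pt T.2) (pt T.1.1) p) 0.
    by apply: (E (rotate (rotate T))) => //;
      rewrite ?ccw_trot ?corners_trot// !inE eqxx !orbT.
  by apply: Or31; split; rewrite lt_neqAle eq_sym ?d1 ?d2 ?d3.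
move=> cT' /(conv_triangle p cT')[_ h2 h3] d0; have D := det_ccw cT'.
have D' : 0 < det (pt T'.2) (pt T'.1.1) (pt T'.1.2) by rewrite det_rot det_rot.
have sumd := det_sum (pt T'.1.1) (pt T'.1.2) (pt T'.2) p; rewrite d0 add0r in sumd.
have pE := det_mixE D' d0; set t := (X in mix X) in pE.
have tE : t * det (pt T'.2) (pt T'.1.1) (pt T'.1.2) = det (pt T'.2) (pt T'.1.1) p.
  by rewrite /t divfK// gt_eqF.
have [t0|t0] := eqVneq t 0.
  by right; exists T'.1.1; rewrite ?inE ?eqxx// pE t0 mix0.
have [t1|t1] := eqVneq t 1.
  by right; exists T'.1.2; rewrite ?inE ?eqxx ?orbT// pE t1 mix1.
left; exists t; split=> //.
  by rewrite lt_neqAle eq_sym t0 /t divr_ge0// ltW.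
have Dt : det (pt T'.2) (pt T'.1.1) (pt T'.1.2) = det (pt T'.1.1) (pt T'.1.2) (pt T'.2).
  by rewrite det_rot det_rot.
rewrite lt_neqAle t1 /t ler_pdivrMr// mul1r Dt -sumd.
by rewrite lerDr.
Qed.

End Triangle.

(** * Balanced families of triangles and triangulations *)

Section Balanced.
Variable R : realType.
Local Notation plane := (plane R).
Local Notation P := (int * int)%type.
Local Notation pt := (pt R).
Implicit Types (p q : plane) (e f : P * P) (T : P * P * P).
Variables (s : seq P) (ts : seq (P * P * P)).
Hypothesis s_polygon : clockwise_polygon R s.
Hypothesis ts_ccw : forall T, T \in ts -> ccw T.

Let edges := sides s ++ flatten (map (@triangle_edges P) ts).
Hypothesis balanced : perm_eq edges (map (@flip P) edges).

Lemma flipK : involutive (@flip P). Proof. by case. Qed.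

Lemma flip_edge e : e \in edges -> flip e \in edges.
Proof.
by move=> eE; rewrite (perm_mem balanced) (mem_map (inv_inj flipK)).
Qed.

Lemma triangle_winding_edges T p :
  triangle_winding T p = \sum_(e <- triangle_edges T) crossing (pt e.1) (pt e.2) p.
Proof. by rewrite /triangle_edges !big_cons big_nil addr0 addrA. Qed.

(** Crossings are antisymmetric and the edge list is stable under reversal, so the total over all
    edges equals its own negative. *)
Lemma sum_triangle_winding p : \sum_(T <- ts) triangle_winding T p = - winding s p.
Proof.
pose w e : int := crossing (pt e.1) (pt e.2) p.
have : \sum_(e <- edges) w e = - \sum_(e <- edges) w e.
  rewrite {1}(perm_big _ balanced) big_map -sumrN; apply: eq_bigr => e _.
  by rewrite /w crossing_swap.
rewrite /edges big_cat big_flatten big_map /= -windingE.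
have -> : \sum_(T <- ts) \sum_(e <- triangle_edges T) w e = \sum_(T <- ts)
  triangle_winding T p.
  by apply: eq_bigr => T _; rewrite triangle_winding_edges.
by move: (\sum_(T <- ts) _) => x; move: (winding s p) => y; lia.
Qed.

Lemma sum_triangle_winding_ge T p (r : seq (P * P * P)) :
  perm_eq ts (T :: r) -> inside T p ->
  1 + \sum_(T' <- r) triangle_winding T' p = - winding s p.
Proof.
move=> tsT iT; rewrite -sum_triangle_winding (perm_big _ tsT) /= big_cons inside_triw//.
by apply: ts_ccw; rewrite (perm_mem tsT) mem_head.
Qed.

Lemma sum_triangle_winding_ge0 (r : seq (P * P * P)) p : {subset r <= ts} ->
  0 <= \sum_(T <- r) triangle_winding T p.
Proof.
by move=> rts; rewrite big_seq; apply: sumr_ge0 => T /rts/ts_ccw;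
  exact: triangle_winding_ge0.
Qed.

Lemma inside_winding T p : T \in ts -> inside T p -> winding s p < 0.
Proof.
move=> Tts iT; have tsT := perm_to_rem Tts.
have := sum_triangle_winding_ge tsT iT;
  have := @sum_triangle_winding_ge0 (rem T ts) p (mem_subseq (rem_subseq _ _)).
lia.
Qed.

Lemma generic_inside p (U : set plane) : nbhs p U -> exists q, U q /\ ~ boundary s q.
Proof.
pose G : seq (plane * plane) := [seq (pt e.1, pt e.2) | e <- sides s].
move=> pU; have [|q [Uq qG]] := @generic_point R p U G pU.
  move=> _ /mapP[e es ->] /=; rewrite (inj_eq (@pt_inj R)).
  exact: polygon_sides s_polygon _ es.
exists q; split=> // -[e es /segmentP[t _ qE]].
have := qG _ (map_f (fun e : P * P => (pt e.1, pt e.2)) es).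
by rewrite qE /= det_mix det_left det_right !mulr0 addr0 eqxx.
Qed.

(** Perturbed off the boundary, the common point would give a sum of at least 2 against at most 1.
    The permutation form admits T = T', so a repeated triangle is excluded too. *)
Lemma no_overlap T T' r p : perm_eq ts [:: T,
  T' & r] -> inside T p -> inside T' p -> False.
Proof.
move=> tsT iT iT'.
have sub : {subset T' :: r <= ts} by move=> x xr; rewrite (perm_mem tsT) inE xr orbT.
have [q [[iTq iTq'] bq]] := generic_inside (filterI (inside_near iT) (inside_near iT')).
have := sum_triangle_winding_ge tsT iTq; rewrite big_cons inside_triw//; last first.
  by apply: ts_ccw; apply: sub; rewrite mem_head.
have sub' : {subset r <= ts} by move=> x xr; apply: sub; rewrite inE xr orbT.
have := sum_triangle_winding_ge0 q sub'; set S := (X in 0 <= X); rewrite -/S.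
by move: S => S; have [->|->] := polygon_winding s_polygon bq; lia.
Qed.

Lemma no_overlap_neq T T' p :
  T \in ts -> T' \in ts -> T != T' -> inside T p -> inside T' p -> False.
Proof.
move=> Tts T'ts TT'; have T'r : T' \in rem T ts.
  apply: contraR TT' => T'r; have := perm_mem (perm_to_rem Tts) T'.
  by rewrite T'ts inE (negPf T'r) orbF => /esym/eqP->.
apply: (@no_overlap T T' (rem T' (rem T ts))).
by rewrite (perm_trans (perm_to_rem Tts))// perm_cons perm_to_rem.
Qed.

Lemma left_point e t (U : set plane) : e.1 != e.2 -> nbhs (mix t (pt e.1) (pt e.2)) U ->
  exists q, U q /\ 0 < det (pt e.1) (pt e.2) q.
Proof.
move=> e12 pU.
have pe12 : pt e.1 != pt e.2 by rewrite (inj_eq (@pt_inj R)).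
have [ o eo] := apex pe12.
have [u [u0 u1 Uu]] := near_toward o pU; exists (mix u (mix t (pt e.1) (pt e.2)) o).
by split=> //; rewrite det_mix (det_mix _ _ t) det_left det_right !mulr0 addr0 mulr0
  add0r mulr_gt0.
Qed.

Lemma triangle_edges_neq T e : ccw T -> e \in triangle_edges T -> e.1 != e.2.
Proof. by move=> cT; have [? ? ?] := ccw_neq R cT; rewrite !inE => /or3P[]/eqP->. Qed.

(** Near the midpoint of a common directed edge, both triangles contain the points to its left. *)
Lemma edge_disjoint T T' r e : perm_eq ts [:: T, T' & r] ->
  e \in triangle_edges T -> e \in triangle_edges T' -> False.
Proof.
move=> tsT eT eT'; have Tts : T \in ts by rewrite (perm_mem tsT) mem_head.
have T'ts : T' \in ts by rewrite (perm_mem tsT) inE mem_head orbT.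
have h0 : 0 < 2^-1 :> R by rewrite invr_gt0.
have h1 : 2^-1 < 1 :> R by rewrite invf_lt1// ltr1n.
have n1 := near_edge (ts_ccw Tts) eT h0 h1; have n2 := near_edge (ts_ccw T'ts) eT' h0 h1.
have [q [[q1 q2] dq]] := left_point (triangle_edges_neq (ts_ccw Tts) eT) (filterI n1 n2).
exact: (no_overlap tsT (q1 dq) (q2 dq)).
Qed.

(** A clockwise polygon has its exterior on the left of each side, and the triangle would reach into
    it. *)
Lemma side_disjoint T e : T \in ts -> e \in triangle_edges T -> e \in sides s -> False.
Proof.
move=> Tts eT es.
have h0 : 0 < 2^-1 :> R by rewrite invr_gt0.
have h1 : 2^-1 < 1 :> R by rewrite invf_lt1// ltr1n.
have n1 := near_edge (ts_ccw Tts) eT h0 h1; have n2 := polygon_side s_polygon es h0 h1.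
have [q [[q1 [q2 _ _]] dq]] :=
  left_point (triangle_edges_neq (ts_ccw Tts) eT) (filterI n1 n2).
by have := inside_winding Tts (q1 dq); rewrite q2.
Qed.

Lemma uniq_flatten_tedges (l : seq (P * P * P)) : (forall T, T \in l -> ccw T) ->
  (forall T T' r e, perm_eq l [:: T,
    T' & r] -> e \in triangle_edges T -> e \in triangle_edges T' -> False) ->
  uniq (flatten (map (@triangle_edges P) l)).
Proof.
elim: l => // T l IHl cl dis.
have cT : ccw T by apply: cl; rewrite mem_head.
have [ab bc ca] := ccw_neq R cT.
change (is_true (uniq (triangle_edges T ++ flatten (map (@triangle_edges P) l)))).
rewrite cat_uniq IHl ?andbT; last 2 first.
- by move=> T' T'l; apply: cl; rewrite inE T'l orbT.
- move=> T1 T2 r e lT; apply: (dis T1 T2 (T :: r)).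
  rewrite -(perm_cons T) in lT; rewrite (perm_trans lT)//.
  by rewrite (perm_catCA [:: T] [:: T1; T2]).
apply/andP; split.
  case: T ab bc ca {cl dis cT} => [[a b] c] /= ab bc ca.
  by rewrite !inE !xpair_eqE (negPf ab) (negPf bc) [a == c]eq_sym (negPf ca).
apply/hasPn => e /flatten_mapP[T' T'l eT']; apply/negP => eT.
apply: (dis T T' (rem T' l) e) => //.
by rewrite perm_cons perm_to_rem.
Qed.

Lemma edges_uniq : uniq edges.
Proof.
rewrite cat_uniq sides_uniq ?(polygon_uniq s_polygon)//= uniq_flatten_tedges//;
  last first.
  exact: edge_disjoint.
rewrite andbT; apply/hasPn => e /flatten_mapP[T Tts eT].
by apply/negP => es; exact: side_disjoint Tts eT es.
Qed.

Lemma triangle_edges_edges T e : T \in ts -> e \in triangle_edges T -> e \in edges.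
Proof. by move=> Tts eT; rewrite mem_cat; apply/orP; right; apply/flatten_mapP;
  exists T. Qed.

Lemma det_flip e q : det (pt (flip e).1) (pt (flip e).2) q = - det (pt e.1) (pt e.2) q.
Proof. exact: det_swap. Qed.

Lemma mix_flip e t : mix (1 - t) (pt (flip e).1) (pt (flip e).2) = mix t (pt e.1) (pt
  e.2).
Proof. by rewrite /mix /=; congr pair; ring. Qed.

(* Near [p] the other side of [e] is covered by the triangle owning [flip e], or
   it lies outside the polygon if [flip e] is a side; but [T'] has interior points
   arbitrarily near [p], on one side of [e] or the other. *)
Lemma edge_point_shared T T' e t p : T \in ts -> T' \in ts -> T != T' ->
  e \in triangle_edges T -> 0 < t -> t < 1 -> p = mix t (pt e.1) (pt e.2) ->
  conv_pts (corners T') p -> e.1 \in corners T' /\ e.2 \in corners T'.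
Proof.
move=> Tts T'ts TT' eT t0 t1 -> pT'; set p' := mix _ _ _ in pT' *.
have e12 := triangle_edges_neq (ts_ccw Tts) eT.
have t0' : 0 < 1 - t by rewrite subr_gt0.
have t1' : 1 - t < 1 by rewrite ltrBlDr ltrDl.
have n1 := near_edge (ts_ccw Tts) eT t0 t1.
(* The test point avoids the line of e, so it lies strictly on one side and contradicts one of two
   coverings. *)
have off (U : set plane) : nbhs p' U -> exists q, [/\ U q,
  inside T' q & det (pt e.1) (pt e.2) q != 0].
  move=> /nbhs_interior p'U; have [q [Uq Tq]] := conv_near_inn (ts_ccw T'ts) pT' p'U.
  have [|q' [[Uq' Tq'] dq']] := @generic_point R q _ [:: (pt e.1,
    pt e.2)] (filterI Uq (inside_near Tq)).
    by move=> l; rewrite inE => /eqP->; rewrite (inj_eq (@pt_inj R)).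
  by exists q'; split=> //; apply: (dq' (pt e.1, pt e.2)); rewrite mem_head.
have := flip_edge (triangle_edges_edges Tts eT);
  rewrite mem_cat => /orP[es|/flatten_mapP[T'' T''ts eT'']].
  exfalso; have n2 := polygon_side s_polygon es t0' t1'; rewrite mix_flip in n2.
  have [q [[q1 [q2 _ _]] iT' dq]] := off _ (filterI n1 n2).
  move: dq; rewrite neq_lt => /orP[dq|/q1 iT];
    last exact: no_overlap_neq Tts T'ts TT' iT iT'.
  have := inside_winding T'ts iT'; rewrite q2 // det_flip oppr_gt0 //.
have [<-|TT''] := eqVneq T'' T'.
  have /fsubsetP sub := triangle_edges_tpts eT''.
  by split; apply: sub; rewrite !inE eqxx ?orbT.
exfalso; have n2 := near_edge (ts_ccw T''ts) eT'' t0' t1'; rewrite mix_flip in n2.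
have [q [[q1 q2] iT' dq]] := off _ (filterI n1 n2).
move: dq; rewrite neq_lt => /orP[dq|/q1 iT];
  last exact: no_overlap_neq Tts T'ts TT' iT iT'.
apply: (no_overlap_neq T''ts T'ts TT'' _ iT').
by apply: q2; rewrite det_flip oppr_gt0.
Qed.

(** A common point interior to one triangle gives an overlap, and one interior to an edge makes both
    ends of the edge common; otherwise it is a corner of both. *)
Lemma faces T T' : T \in ts -> T' \in ts ->
  conv_pts (corners T) `&` conv_pts (corners T') = conv_pts (corners T `&` corners
    T')%fset :> set plane.
Proof.
move=> Tts T'ts; have [<-|TT'] := eqVneq T T'; first by rewrite setIid fsetIid.
have sub (S S' : {fset P}) : (S `<=` S')%fset -> (conv_pts S :
  set plane) `<=` conv_pts S'.
  by move=> /fsubsetP SS'; apply: hullS => _ [v vS <-]; exists v => //; exact: SS'.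
apply/seteqP; split=> [p [pT pT']|p pS]; last first.
  by split; apply: sub pS; rewrite ?fsubsetIl ?fsubsetIr.
have E T1 T2 e t : T1 \in ts -> T2 \in ts -> T1 != T2 ->
  e \in triangle_edges T1 -> 0 < t -> t < 1 -> p = mix t (pt e.1) (pt e.2) ->
  conv_pts (corners T2) p -> conv_pts (corners T1 `&` corners T2)%fset p.
  move=> h1 h2 h12 eT t0 t1 pE pT2.
  have [e1 e2] := edge_point_shared h1 h2 h12 eT t0 t1 pE pT2.
  apply: (sub [fset e.1; e.2]%fset).
    rewrite fsubsetI triangle_edges_tpts//=; apply/fsubsetP => v.
    by rewrite in_fset2 => /orP[]/eqP->.
  by rewrite conv_pts_edge; apply/segmentP; exists t; rewrite ?(ltW t0) ?(ltW t1).
have [iT|[e [t [eT t0 t1 pE]]]|[v vT pE]] := triangle_position (ts_ccw Tts) pT.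
- have [q [iTq iT'q]] := conv_near_inn (ts_ccw T'ts) pT' (inside_near iT).
  by exfalso; exact: no_overlap_neq Tts T'ts TT' iTq iT'q.
- exact: (E T T' e t).
have [iT'|[e [t [eT t0 t1 pE']]]|[v' v'T pE']] := triangle_position (ts_ccw T'ts) pT'.
- have [q [iTq iT'q]] := conv_near_inn (ts_ccw Tts) pT (inside_near iT').
  by exfalso; exact: no_overlap_neq Tts T'ts TT' iT'q iTq.
- by rewrite fsetIC; apply: (E T' T e t) => //; rewrite eq_sym.
apply: hull_sub; exists v => //=; rewrite in_fsetI vT.
by have := pt_inj (etrans (esym pE) pE') => ->.
Qed.

Lemma side_triangle e : e \in sides s -> exists2 T,
  T \in ts & flip e \in triangle_edges T.
Proof.
move=> es; have : e \in edges by rewrite mem_cat es.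
move=> /flip_edge; rewrite mem_cat => /orP[fs|/flatten_mapP[T Tts eT]]; last by exists T.
exfalso; have e12 := polygon_sides s_polygon es.
have h0 : 0 < 2^-1 :> R by rewrite invr_gt0.
have h1 : 2^-1 < 1 :> R by rewrite invf_lt1// ltr1n.
apply: (polygon_inner s_polygon es fs _ h0 h1).
  by apply: contraNneq e12 => fe; move: (congr1 fst fe) => /= ->.
apply/segmentP; exists (1 - 2^-1); last by rewrite mix_flip.
by rewrite subr_ge0 (ltW h1) lerBlDr lerDl (ltW h0).
Qed.

(** Off the boundary the winding number is locally constant, so a point of a closed triangle
    inherits it from interior points nearby. Conversely a nonzero sum has a nonzero term. *)
Lemma region_covered : \bigcup_(T in [set` ts]) (conv_pts (corners T) :
  set plane) = region s.
Proof.
apply/seteqP; split=> p.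
  move=> [T /= Tts pT]; have [bp|bp] := pselect (boundary s p); [by left|right].
  have [q [wq iT]] := conv_near_inn (ts_ccw Tts) pT
    (winding_near (polygon_sides s_polygon) bp).
  by rewrite /= -wq lt_eqF//; exact: inside_winding iT.
move=> [[e es ep]|/= wp].
  have [T Tts eT] := side_triangle es; exists T => //.
  have : conv_pts [fset (flip e).1; (flip e).2]%fset p.
    by move: ep; rewrite -conv_pts_edge fsetUC.
  by apply: hullS => _ [v vS <-]; exists v => //;
    apply: (fsubsetP (triangle_edges_tpts eT)).
have : \sum_(T <- ts) triangle_winding T p != 0 by rewrite sum_triangle_winding oppr_eq0.
move=> h; have [T Tts Tp] : exists2 T, T \in ts & triangle_winding T p != 0.
  apply/hasP; apply: contraNT h => /hasPn h; rewrite big_seq big1// => T /h.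
  by rewrite negbK => /eqP.
by exists T => //; apply: triangle_winding_conv => //; exact: ts_ccw.
Qed.

Lemma corners_card T : ccw T -> #|` corners T| = 3%N.
Proof.
move=> /(ccw_neq R)[ab bc ca]; rewrite /corners -fsetUA cardfsU1 cardfs2 in_fset2.
by rewrite negb_or ab bc eq_sym ca.
Qed.

End Balanced.

Section Area.
Variable R : realType.
Local Notation P := (int * int)%type.

Lemma orient_swap (i j k : P) : orient j i k = - orient i j k.
Proof. by case: i j k => [? ?] [? ?] [? ?]; rewrite /orient /=; ring. Qed.

Lemma fset3P (t : {fset P}) : #|` t| = 3%N -> exists x y z,
  [/\ (t : seq P) = [:: x; y;
    z], t = corners (x, y, z) & area R t = `|orient x y z|%:~R / 2 :> R].
Proof.
move=> t3; have : size (t : seq P) = 3%N := t3.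
case E: (t : seq P) => [|x [|y [|z [|]]]] //= _; exists x, y, z; split=> //.
  apply/fsetP => v; have -> : (v \in t) = (v \in enum_fset t) by [].
  by rewrite E !inE orbA.
by rewrite /area E.
Qed.

Lemma corners_norm (T T' : P * P * P) : ccw T -> corners T' = corners T ->
  `|orient T'.1.1 T'.1.2 T'.2| = orient T.1.1 T.1.2 T.2.
Proof.
case: T T' => [[a b] c] [[x y] z] cT; have [/= ab bc ca] := ccw_neq R cT => TT.
move: (cT); rewrite /ccw /= => abc.
have mem v : (v \in [:: x; y; z]) = (v \in [:: a; b; c]).
  by move/fsetP/(_ v): TT; rewrite !inE /= -!orbA.
have := mem x; have := mem y; have := mem z; have := mem a; have := mem b; have := mem c.
rewrite !inE !eqxx ?orbT /= => hc hb ha.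
have E1 : orient b a c = - orient a b c by rewrite orient_swap.
have E2 : orient a c b = - orient a b c by rewrite -orient_swap orient_rot.
have E3 : orient c b a = - orient a b c by rewrite -orient_swap -orient_rot.
have E4 : orient b c a = orient a b c by rewrite orient_rot.
have E5 : orient c a b = orient a b c by rewrite orient_rot E4.
move=> /esym/or3P[]/eqP hz /esym/or3P[]/eqP hy /esym/or3P[]/eqP hx;
  move: ha hb hc; rewrite hx hy hz;
  rewrite ?eqxx ?(negPf ab) ?(negPf bc) ?(negPf ca) ?[b == a]eq_sym ?[c == b]eq_sym
  ?[a == c]eq_sym ?(negPf ab) ?(negPf bc) ?(negPf ca) //= => _ _ _;
  by rewrite ?E1 ?E2 ?E3 ?E4 ?E5 ?normrN gtr0_norm.
Qed.

Lemma area_tpts T : ccw T -> area R (corners T) = (orient T.1.1 T.1.2 T.2)%:~R / 2 :> R.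
Proof.
move=> cT; have [x [y [z [_ tE ->]]]] := fset3P (corners_card R cT).
by rewrite (@corners_norm T (x, y, z) cT (esym tE)).
Qed.

Lemma area_ccw (t : {fset P}) : #|` t| = 3%N -> area R t != 0 :> R ->
  exists2 T, ccw T & corners T = t.
Proof.
move=> t3; have [x [y [z [_ tE ->]]]] := fset3P t3.
have [h|h|h] := ltrgt0P (orient x y z); last by rewrite ?h ?normr0 mul0r eqxx.
  by exists (x, y, z).
exists (y, x, z); first by rewrite /ccw /= orient_swap oppr_gt0.
by rewrite tE; apply/fsetP => v; rewrite !inE /= orbAC [_ || (v == y)]orbC orbAC.
Qed.

End Area.

(** * From triangulations to balanced edges *)

Section Converse.
Variable R : realType.
Local Notation plane := (plane R).
Local Notation P := (int * int)%type.
Local Notation pt := (pt R).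
Implicit Types (p q : plane) (e f : P * P) (T : P * P * P).

Lemma balanced_triangulation (s : seq P) (ts : seq (P * P * P)) :
  clockwise_polygon R s -> (forall T, T \in ts -> ccw T) ->
  perm_eq (sides s ++ flatten (map (@triangle_edges P) ts))
    (map (@flip P) (sides s ++ flatten (map (@triangle_edges P) ts))) ->
  triangulations R s [fset corners T | T in ts]%fset.
Proof.
move=> s_poly ts_ccw bal; split.
- move=> _ /imfsetP[T /= Tts ->]; have cT := ts_ccw T Tts.
  split; first exact: corners_card R _ cT.
  rewrite area_tpts// mulf_neq0 ?invr_neq0 ?pnatr_eq0// intr_eq0 gt_eqF//.
- rewrite -(region_covered s_poly ts_ccw bal); apply/seteqP; split.
    by move=> p [_ /imfsetP[T /= Tts ->] pT]; exists T.
  by move=> p [T /= Tts pT]; exists (corners T) => //=; apply/imfsetP; exists T.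
- move=> _ _ /imfsetP[T /= Tts ->] /imfsetP[T' /= T'ts ->].
  exact: faces s_poly ts_ccw bal _ _ Tts T'ts.
- move=> e es; have [T Tts eT] := side_triangle s_poly bal es.
  exists (corners T); first by apply/imfsetP; exists T.
  have /fsubsetP sub := triangle_edges_tpts eT.
  by rewrite !sub// !inE eqxx ?orbT.
Qed.

Variables (s : seq P) (ts : seq (P * P * P)) (tau : {fset {fset P}}).
Hypothesis s_polygon : clockwise_polygon R s.
Hypothesis ts_ccw : forall T, T \in ts -> ccw T.
Hypothesis ts_uniq : uniq ts.
Hypothesis corners_inj : {in ts &, injective corners}.
Hypothesis tauE : tau = [fset corners T | T in ts]%fset.
Hypothesis tau_tri : triangulations R s tau.

Let edges := sides s ++ flatten (map (@triangle_edges P) ts).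

Lemma tau_ts T : T \in ts -> corners T \in tau.
Proof. by move=> Tts; rewrite tauE; apply/imfsetP; exists T. Qed.

Lemma tau_face T T' : T \in ts -> T' \in ts ->
  conv_pts (corners T) `&` conv_pts (corners T') = conv_pts (corners T `&` corners
    T')%fset :> set plane.
Proof. by case: tau_tri => _ _ h _ /tau_ts Tt /tau_ts T't; exact: h. Qed.

Lemma tau_region T p : T \in ts -> conv_pts (corners T) p -> region s p.
Proof. by case: tau_tri => _ <- _ _ /tau_ts Tt pT; exists (corners T). Qed.

Lemma region_tau p : region s p -> exists2 T, T \in ts & conv_pts (corners T) p.
Proof.
case: tau_tri => _ <- _ _ [t /=]; rewrite tauE => /imfsetP[T /= Tts ->] pT.
by exists T.
Qed.

Lemma inside_lam T v p : ccw T -> inside T p -> v \in corners T -> bary T v p != 0.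
Proof.
move=> cT [h1 h2 h3]; rewrite !inE /bary; case: (v == T.1.1) => /= [_|].
  by rewrite gt_eqF.
by case: (v == T.1.2) => /= [_|]; [|case: (v == T.2) => // _]; rewrite gt_eqF.
Qed.

(** A common point lies in the common face, where the coordinates of unshared corners vanish. *)
Lemma supp_shared T T' v p : T \in ts -> T' \in ts ->
  conv_pts (corners T) p -> conv_pts (corners T') p -> v \in corners T -> bary T v p
    != 0 ->
  v \in corners T'.
Proof.
move=> Tts T'ts pT pT' vT lv; have := tau_face Tts T'ts => /seteqP[sub _].
have /(conv_face p (ts_ccw Tts) (fsubsetIl _ _)) := sub p (conj pT pT').
move=> /(_ v vT)[_ h]; have : v \in (corners T `&` corners T')%fset.
  by apply: contraNT lv => /h ->.
by rewrite in_fsetI => /andP[].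
Qed.

Lemma tau_overlap T T' p : T \in ts -> T' \in ts -> inside T p -> inside T' p -> T = T'.
Proof.
move=> Tts T'ts iT iT'; apply: corners_inj => //.
have pT := inside_conv (ts_ccw Tts) iT; have pT' := inside_conv (ts_ccw T'ts) iT'.
apply/fsetP => v; apply/idP/idP => vT.
  by apply: (supp_shared Tts T'ts pT pT' vT); exact: inside_lam (ts_ccw Tts) iT vT.
by apply: (supp_shared T'ts Tts pT' pT vT); exact: inside_lam (ts_ccw T'ts) iT' vT.
Qed.

Let h0 : 0 < 2^-1 :> R. Proof. by rewrite invr_gt0. Qed.
Let h1 : 2^-1 < 1 :> R. Proof. by rewrite invf_lt1// ltr1n. Qed.

Lemma tau_edge T T' e :
  T \in ts -> T' \in ts -> e \in triangle_edges T -> e \in triangle_edges T' -> T = T'.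
Proof.
move=> Tts T'ts eT eT'.
have n1 := near_edge (ts_ccw Tts) eT h0 h1; have n2 := near_edge (ts_ccw T'ts) eT' h0 h1.
have [q [[q1 q2] dq]] :=
  left_point (triangle_edges_neq R (ts_ccw Tts) eT) (filterI n1 n2).
exact: tau_overlap Tts T'ts (q1 dq) (q2 dq).
Qed.

Lemma tau_side T e : T \in ts -> e \in triangle_edges T -> e \in sides s -> False.
Proof.
move=> Tts eT es.
have n1 := near_edge (ts_ccw Tts) eT h0 h1; have n2 := polygon_side s_polygon es h0 h1.
have [q [[q1 [q2 _ q3]] dq]] :=
  left_point (triangle_edges_neq R (ts_ccw Tts) eT) (filterI n1 n2).
have := tau_region Tts (inside_conv (ts_ccw Tts) (q1 dq)).
by case=> [|/=]; [apply: q3; rewrite gt_eqF|rewrite q2// eqxx].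
Qed.

Lemma corners_edge T a b : ccw T -> a \in corners T -> b \in corners T -> a != b ->
  (a, b) \in triangle_edges T \/ flip (a, b) \in triangle_edges T.
Proof.
case: T => [[x y] z] cT; rewrite !inE /= -!orbA => /or3P[]/eqP-> /or3P[]/eqP->;
  rewrite ?eqxx // => _; rewrite ?orbT; by [left|right].
Qed.

Lemma near_not_conv T p : ccw T -> ~ conv_pts (corners T) p ->
  \forall q \near p, ~ conv_pts (corners T) q.
Proof.
move=> cT pT.
have [h|k1] := ltP (det (pt T.1.1) (pt T.1.2) p) 0.
  apply: filterS (near_det_lt0 h) => q qd /(conv_triangle q cT)[+ _ _].
  by rewrite leNgt qd.
have [h|k2] := ltP (det (pt T.1.2) (pt T.2) p) 0.
  apply: filterS (near_det_lt0 h) => q qd /(conv_triangle q cT)[_ + _].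
  by rewrite leNgt qd.
have [h|k3] := ltP (det (pt T.2) (pt T.1.1) p) 0.
  apply: filterS (near_det_lt0 h) => q qd /(conv_triangle q cT)[_ _].
  by rewrite leNgt qd.
by exfalso; apply/pT/(conv_triangle p cT).
Qed.

Lemma edge_lam T e : ccw T -> e \in triangle_edges T ->
  bary T e.1 (mix 2^-1 (pt e.1) (pt e.2)) != 0 /\ bary T e.2 (mix 2^-1 (pt e.1) (pt
    e.2)) != 0.
Proof.
move=> cT eT; have e12 := triangle_edges_neq R cT eT;
  have /fsubsetP sub := triangle_edges_tpts eT.
have e1 : e.1 \in corners T by apply: sub; rewrite !inE eqxx.
have e2 : e.2 \in corners T by apply: sub; rewrite !inE eqxx orbT.
have d0 : det (pt T.1.1) (pt T.1.2) (pt T.2) != 0 by rewrite gt_eqF// det_ccw.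
have hh : 1 - 2^-1 != 0 :> R by rewrite subr_eq0 eq_sym lt_eqF.
rewrite !bary_mix !bary_pt// !eqxx (negPf e12) [e.2 == e.1]eq_sym (negPf e12) !mulr0
  addr0 add0r.
by rewrite !mulf_neq0// gt_eqF.
Qed.

Lemma conv_edge_side T e q : ccw T -> e \in triangle_edges T -> conv_pts (corners T) q ->
  0 <= det (pt e.1) (pt e.2) q.
Proof.
by move=> cT eT /(conv_triangle q cT)[k1 k2 k3]; move: eT; rewrite !inE => /or3P[]/eqP->.
Qed.

(* If no triangle owns [flip e], the points to the right of [e] near its midpoint
   are outside the region. So the midpoint is on the boundary, and the side
   through it is an edge of the only triangle containing it. *)
Lemma tau_flip T e : T \in ts -> e \in triangle_edges T -> flip e \in edges.
Proof.
move=> Tts eT; rewrite mem_cat; have cT := ts_ccw Tts;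
  have e12 := triangle_edges_neq R cT eT.
have [//|nT] /= := boolP (flip e \in flatten (map (@triangle_edges P) ts));
  first by rewrite orbT.
rewrite orbF.
set p := mix 2^-1 (pt e.1) (pt e.2).
have [l1 l2] := edge_lam cT eT; have /fsubsetP sub := triangle_edges_tpts eT.
have e1 : e.1 \in corners T by apply: sub; rewrite !inE eqxx.
have e2 : e.2 \in corners T by apply: sub; rewrite !inE eqxx orbT.
have seg_conv f (t : {fset P}) q : f.1 \in t -> f.2 \in t -> segment f q -> conv_pts t q.
  move=> f1 f2; rewrite -conv_pts_edge; apply: hullS => _ [v vf <-]; exists v => //=.
  by move: vf; rewrite /= in_fset2 => /orP[]/eqP->.
have pT : conv_pts (corners T) p.
  apply: (seg_conv e) => //; apply/segmentP; exists 2^-1 => //.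
  by rewrite (ltW h0) (ltW h1).
(* Both coordinates of the midpoint p are nonzero, so T' contains both ends of e and owns e or
   [flip e]; the latter is excluded. *)
have only T' : T' \in ts -> conv_pts (corners T') p -> T' = T.
  move=> T'ts pT'; have e1' := supp_shared Tts T'ts pT pT' e1 l1.
  have e2' := supp_shared Tts T'ts pT pT' e2 l2.
  have [] := corners_edge (ts_ccw T'ts) e1' e2' e12; rewrite -surjective_pairing => eT'.
    exact: tau_edge T'ts Tts eT' eT.
  by exfalso; move/negP: nT; apply; apply/flatten_mapP; exists T'.
have right_out : \forall q \near p, det (pt e.1) (pt e.2) q < 0 -> ~ region s q.
  have : \forall q \near p, forall T', T' \in ts -> T' != T -> ~ conv_pts (corners T') q.
    apply: near_all => T' T'ts; have [->|T'T] := eqVneq T' T; first by near=> q.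
    have : ~ conv_pts (corners T') p by move=> /(only T' T'ts) T'TE;
      rewrite T'TE eqxx in T'T.
    by move=> /(near_not_conv (ts_ccw T'ts)); apply: filterS => q h _.
  apply: filterS => q h dq /region_tau[T' T'ts qT'].
  have [TE|/(h T' T'ts)] := eqVneq T' T; last exact.
  by have := conv_edge_side cT eT; rewrite -TE => /(_ q qT'); rewrite leNgt dq.
have n1 := near_edge cT eT h0 h1.
have [bp|bp] := pselect (boundary s p); last first.
  (* Off the boundary the winding number would be constant near p, yet the left of e lies in the
     region and the right does not. *)
  exfalso; have nw := winding_near (polygon_sides s_polygon) bp.
  have nb : \forall q \near p, ~ boundary s q.
    have : \forall q \near p, forall f, f \in sides s -> ~ segment f q.
      apply: near_all => f fs; apply: near_not_segment;
        first exact: polygon_sides s_polygon _ fs.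
      by move=> fp; apply: bp; exists f.
    by apply: filterS => q h [f fs]; exact: h.
  have [q [[q1 [q2 q3]] dq]] := left_point e12 (filterI n1 (filterI nw nb)).
  have fe12 : (flip e).1 != (flip e).2 by rewrite eq_sym.
  have nr : nbhs (mix 2^-1 (pt (flip e).1) (pt (flip e).2)) [set q |
      (det (pt e.1) (pt e.2) q < 0 -> ~ region s q) /\ winding s q = winding s p].
    have -> : mix 2^-1 (pt (flip e).1) (pt (flip e).2) = p.
      by rewrite -[RHS](@mix_flip R); congr mix; lra.
    exact: filterI right_out nw.
  have [r [[r1 r2] dr]] := left_point fe12 nr.
  have rr : ~ region s r by apply: r1; move: dr; rewrite det_flip oppr_gt0.
  have [qb|/=] := tau_region Tts (inside_conv cT (q1 dq)); first exact: q3.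
  by rewrite q2 -r2 => wr; apply: rr; right.
case: bp => f fs fp; case: tau_tri => _ _ _ /(_ f fs)[t + /andP[f1 f2]].
rewrite tauE => /imfsetP[T' /= T'ts tE]; rewrite tE in f1 f2.
have TE := only T' T'ts (seg_conv f _ p f1 f2 fp); rewrite TE in f1 f2.
have Sf : ([fset f.1; f.2] `<=` corners T)%fset.
  by apply/fsubsetP => v; rewrite in_fset2 => /orP[]/eqP->.
have := (conv_face p cT Sf).1; rewrite conv_pts_edge => /(_ fp) h.
(* The side f through p spans a face of T containing p, where corners outside f have coordinate
   zero; so f has the ends of e, and being different from e it is [flip e]. *)
have m1 : e.1 \in [fset f.1; f.2]%fset by apply: contraNT l1 => /(h _ e1).2 ->.
have m2 : e.2 \in [fset f.1; f.2]%fset by apply: contraNT l2 => /(h _ e2).2 ->.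
have nef : f != e by apply/eqP => fe; apply: (tau_side Tts eT); rewrite -fe.
move: m1 m2 e12 nef fs; case: (f) => f1' f2'; case: (e) => a b;
  rewrite !in_fset2 /flip /=.
by move=> /orP[]/eqP-> /orP[]/eqP->; rewrite ?eqxx.
Unshelve. all: by end_near. Qed.

Lemma triangulation_flip e : e \in edges -> flip e \in edges.
Proof.
rewrite mem_cat => /orP[es|/flatten_mapP[T Tts eT]]; last exact: tau_flip Tts eT.
have e12 := polygon_sides s_polygon es.
case: tau_tri => _ _ _ /(_ e es)[t + /andP[]];
  rewrite tauE => /imfsetP[T /= Tts ->] e1 e2.
have [] := corners_edge (ts_ccw Tts) e1 e2 e12; rewrite -surjective_pairing => eT.
  by exfalso; exact: tau_side Tts eT es.
by rewrite mem_cat; apply/orP; right; apply/flatten_mapP; exists T.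
Qed.

Lemma triangulation_uniq : uniq edges.
Proof.
rewrite cat_uniq sides_uniq ?(polygon_uniq s_polygon)//= (uniq_flatten_tedges R) //.
  rewrite andbT; apply/hasPn => e /flatten_mapP[T Tts eT].
  by apply/negP => es; exact: tau_side Tts eT es.
move=> T T' r e tsT eT eT'.
have Tts : T \in ts by rewrite (perm_mem tsT) mem_head.
have T'ts : T' \in ts by rewrite (perm_mem tsT) inE mem_head orbT.
have := perm_uniq tsT; rewrite ts_uniq /= => /esym/andP[+ _].
by rewrite (tau_edge Tts T'ts eT eT') mem_head.
Qed.

End Converse.

(** * Bounding boxes and finiteness *)

Section Box.
Variable R : realType.
Local Notation plane := (plane R).
Local Notation P := (int * int)%type.
Local Notation pt := (pt R).
Implicit Types (p q x y : plane) (s : seq P).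

Definition in_box (M : nat) (a : P) := (`|a.1| <= M%:Z) && (`|a.2| <= M%:Z).

Definition plane_box (M : nat) : set plane :=
  [set p | `|p.1| <= M%:R /\ `|p.2| <= M%:R].

Lemma pt_box M a : plane_box M (pt a) <-> in_box M a.
Proof.
have E (m : int) : (`|m%:~R : R| <= M%:R) = (`|m| <= M%:Z).
  by rewrite -intr_norm -(ler_int R) -pmulrn.
by rewrite /in_box -!E; split=> /andP.
Qed.

Lemma plane_box_convex M : @convex_set R plane (plane_box M).
Proof.
apply/convexP => p q t /andP[t0 t1] [p1 p2] [q1 q2]; split.
  by move: p1 q1; rewrite /= !ler_norml => /andP[? ?] /andP[? ?]; apply/andP; split; nra.
by move: p2 q2; rewrite /= !ler_norml => /andP[? ?] /andP[? ?]; apply/andP; split; nra.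
Qed.

Lemma det_scanline x y p : det x y p =
  - ((y.2 - p.2) * (p.1 - x.1) + (p.2 - x.2) * (p.1 - y.1)).
Proof. by case: x y p => [? ?] [? ?] [? ?]; rewrite detE /=; ring. Qed.

Lemma crossing_right x y p : x.1 < p.1 -> y.1 < p.1 -> crossing x y p = 0.
Proof.
move=> xp yp; rewrite /crossing det_scanline.
case: ifP => [/and3P[xp2 py2]|_].
  rewrite ltNge oppr_le0 addr_ge0// mulr_ge0 ?subr_ge0 ?(ltW xp) ?(ltW yp) ?(ltW py2)//.
case: ifP => [/and3P[yp2 px2]|//].
rewrite ltNge oppr_ge0 -(oppr_ge0 (_ + _)) opprD -!mulNr !opprB addr_ge0//.
  by rewrite mulr_ge0 ?subr_ge0 ?(ltW xp).
by rewrite mulr_ge0 ?subr_ge0 ?(ltW yp) ?(ltW px2).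
Qed.

(** From far left the ray meets the segment whenever the heights separate, so the crossing is a
    difference of endpoint values and telescopes around the polygon. *)
Lemma crossing_left x y p : p.1 < x.1 -> p.1 < y.1 ->
  crossing x y p = Posz (p.2 < y.2)%R - Posz (p.2 < x.2)%R.
Proof.
move=> xp yp; rewrite /crossing.
case: (lerP x.2 p.2) => px; case: (lerP y.2 p.2) => py //=.
- rewrite det_scanline oppr_gt0 ifT//.
  rewrite -[X in X < _]/(_ + _) -oppr_gt0 opprD -!mulrN !opprB ltr_pwDl//.
    by rewrite mulr_gt0// subr_gt0.
  by rewrite mulr_ge0// subr_ge0// ltW.
- rewrite det_scanline oppr_lt0 ifT//.
  rewrite -[X in _ < X + _]mulrNN -[X in _ < _ + X]mulrNN !opprB ltr_wpDl//.
    by rewrite mulr_ge0// subr_ge0// ltW.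
  by rewrite mulr_gt0// subr_gt0.
Qed.

Lemma winding_box s M p : all (in_box M) s -> winding s p != 0 -> plane_box M p.
Proof.
move=> /allP sM; have box e : e \in sides s ->
    [/\ plane_box M (pt e.1) & plane_box M (pt e.2)].
  by move=> /sides_mem[/sM e1 /sM e2]; split; apply/pt_box.
apply: contra_neqP => np; rewrite windingE.
have [h1|h1] := ltP p.1 (- M%:R).
  pose F (a : P) : int := Posz (p.2 < (pt a).2)%R.
  rewrite (eq_big_seq (fun e : P * P => F e.2 - F e.1)); last first.
    move=> e /box[[x1 x2] [y1 y2]]; move: x1 y1;
      rewrite !ler_norml => /andP[l1 _] /andP[l2 _].
    by rewrite crossing_left// (lt_le_trans h1).
  by rewrite big_split sumrN /= (sum_sides F) subrr.
have [h2|h2] := ltP M%:R p.1.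
  rewrite big_seq big1// => e /box[[x1 x2] [y1 y2]].
  move: x1 y1; rewrite !ler_norml => /andP[_ l1] /andP[_ l2].
  by rewrite crossing_right// (le_lt_trans _ h2).
have [h3|h3] := ltP p.2 (- M%:R).
  rewrite big_seq big1// => e /box[[x1 x2] [y1 y2]].
  move: x2 y2; rewrite !ler_norml => /andP[l1 _] /andP[l2 _].
  by rewrite /crossing !leNgt !(lt_le_trans h3).
have [h4|h4] := ltP M%:R p.2.
  rewrite big_seq big1// => e /box[[x1 x2] [y1 y2]].
  move: x2 y2; rewrite !ler_norml => /andP[_ l1] /andP[_ l2].
  by rewrite /crossing !(le_gtF (ltW (le_lt_trans _ h4)))// !andbF.
by exfalso; apply: np; rewrite /plane_box /= !ler_norml h1 h2 h3 h4.
Qed.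

Lemma region_box s M p : all (in_box M) s -> region s p -> plane_box M p.
Proof.
move=> sM [[e /sides_mem[e1 e2] ep]|]; last exact: winding_box.
apply: (@hull_min _ _ _ (@plane_box_convex M) _ _ ep) => _ [->|->]; apply/pt_box;
  exact: (allP sM).
Qed.

Variables (s : seq P) (M : nat).
Hypothesis sM : all (in_box M) s.

Lemma pt_conv (t : {fset P}) a : a \in t -> conv_pts t (pt a).
Proof. by move=> at_; apply: hull_sub; exists a. Qed.

Lemma triangulation_box tau t a :
  triangulations R s tau -> t \in tau -> a \in t -> in_box M a.
Proof.
move=> [_ E _ _] tt at_; apply/pt_box; apply: region_box sM _.
by rewrite -E; exists t => //; exact: pt_conv.
Qed.

Definition box_points : {fset P} := [fset idx_val i | i : idx M]%fset.

Lemma box_pointsP a : in_box M a -> a \in box_points.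
Proof. by move=> aM; apply/imfsetP; exists (Idx aM). Qed.

Lemma triangulations_finite : finite_set (triangulations R s).
Proof.
apply: (sub_finite_set _ (finite_fset (fpowerset (fpowerset box_points)))) => tau tri /=.
rewrite fpowersetE; apply/fsubsetP => t tt; rewrite fpowersetE; apply/fsubsetP => a at_.
exact: box_pointsP (triangulation_box tri tt at_).
Qed.

End Box.

(** * Newton polyhedra of characteristic functions *)

Section Newton.
Variable R : realType.
Local Notation plane := (plane R).
Local Notation P := (int * int)%type.
Local Notation pt := (pt R).
Variables (s : seq P) (tau : {fset {fset P}}).
Hypothesis tri : triangulations R s tau.

Lemma verticesP a : reflect (exists2 t, t \in tau & a \in t) (a \in vertices tau).
Proof.
rewrite /vertices; apply: (iffP (bigfcupP _ _ _ _)) =>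
  [[t /andP[tt _] at_]|[t tt at_]]; exists t => //.
by rewrite tt.
Qed.

Lemma phi_gt0 a : a \in vertices tau -> 0 < phi R tau a.
Proof.
move=> /verticesP[t tt at_]; have [tri1 _ _ _] := tri.
have area_ge0 t' : 0 <= area R t' by rewrite divr_ge0// ler0z normr_ge0.
rewrite /phi big_mkcond (bigD1_seq t) ?fset_uniq//= at_ ltr_pwDl//; last first.
  by apply: sumr_ge0 => t' _; case: ifP.
by rewrite lt_neqAle eq_sym area_ge0 andbT; have [] := tri1 t tt.
Qed.

Lemma phi_polyE a : a \in vertices tau -> phi_poly R tau a = phi R tau a.
Proof. by move=> av; rewrite fsfunE av. Qed.

(** All coefficients at vertices are positive, so none drops out of the support. *)
Lemma newton_region : newton (phi_poly R tau) = hull (region s) :> set plane.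
Proof.
have [_ E _ _] := tri; apply/seteqP; split.
  apply: hull_min => [|_ [a /= + <-]]; first exact: hull_convex.
  rewrite fsfunE; case: ifP => [/verticesP[t tt at_] _|]; last by rewrite eqxx.
  by apply: hull_sub; rewrite -E; exists t => //; apply: hull_sub; exists a.
apply: hull_min => [|p]; first exact: hull_convex.
rewrite -E => -[t /= tt]; apply: hullS => _ [a at_ <-]; exists a => //=.
have av : a \in vertices tau by apply/verticesP; exists t.
by rewrite phi_polyE// gt_eqF// phi_gt0.
Qed.

End Newton.

(** * Formal power series *)

Section FpsTheory.
Variables (K : finType) (A : comNzRingType).
Implicit Types (f g : fps K A) (m u : {ffun K -> nat}) (c : A).

Definition degm m : nat := \sum_i m i.

Lemma fcoef_sum (T : Type) (r : seq T) (Q : pred T) (F : T -> fps K A) m :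
  fcoef (\sum_(t <- r | Q t) F t) m = \sum_(t <- r | Q t) fcoef (F t) m.
Proof. by rewrite (big_morph (fun f => fcoef f m) (id1 := 0) (op1 := +%R)). Qed.

Lemma fcoefM f g m :
  fcoef (f * g) m = \sum_(u <- below m) fcoef f u * fcoef g (expo_sub m u).
Proof. by []. Qed.

Lemma fcoef_const c f m : fcoef (fconst K c * f) m = c * fcoef f m.
Proof.
rewrite fcoefM (bigD1_seq 0) ?below_uniq//=; last first.
  by rewrite mem_below; apply/forallP => i; rewrite ffunE.
rewrite eqxx expo_sub0 big1 ?addr0// => u /negPf ->.
by rewrite mul0r.
Qed.

Lemma fconstM c c' : fconst K (c * c') = fconst K c * fconst K c'.
Proof. by apply/fpsP => m; rewrite fcoef_const /=; case: ifP; rewrite ?mulr0. Qed.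

Lemma fconst1 : fconst K 1 = 1 :> fps K A. Proof. by []. Qed.

Lemma fconst0 : fconst K 0 = 0 :> fps K A.
Proof. by apply/fpsP => m /=; case: ifP. Qed.

Lemma fconstD c c' : fconst K (c + c') = fconst K c + fconst K c'.
Proof. by apply/fpsP => m /=; case: ifP; rewrite ?addr0. Qed.

Lemma fconst_prod (T : Type) (r : seq T) (Q : pred T) (F : T -> A) :
  fconst K (\prod_(t <- r | Q t) F t) = \prod_(t <- r | Q t) fconst K (F t).
Proof. exact: (big_morph _ fconstM fconst1). Qed.

Lemma fconst_sum (T : Type) (r : seq T) (Q : pred T) (F : T -> A) :
  fconst K (\sum_(t <- r | Q t) F t) = \sum_(t <- r | Q t) fconst K (F t).
Proof. exact: (big_morph _ fconstD fconst0). Qed.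

Lemma fconst_nat n : fconst K n%:R = n%:R :> fps K A.
Proof.
by elim: n => [|n IHn]; rewrite ?fconst0// -!natr1 fconstD IHn fconst1.
Qed.

Definition has_order n f := forall m, (degm m < n)%N -> fcoef f m = 0.

Lemma degm_sub m u : expo_le u m -> (degm u + degm (expo_sub m u) = degm m)%N.
Proof.
move=> /forallP um; rewrite /degm -big_split; apply: eq_bigr => i _ /=.
by rewrite ffunE subnKC.
Qed.

Lemma has_orderM n n' f g : has_order n f -> has_order n' g -> has_order (n + n') (f * g).
Proof.
move=> hf hg m mn; rewrite fcoefM big_seq big1// => u; rewrite mem_below => um.
have [un|un] := ltnP (degm u) n; first by rewrite hf// mul0r.
rewrite hg ?mulr0//; have := degm_sub um; lia.
Qed.

Lemma has_orderX n f : has_order 1 f -> has_order n (f ^+ n).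
Proof.
move=> f1; elim: n => [|n IHn] //; rewrite exprS -add1n; exact: has_orderM.
Qed.

Lemma has_orderD n f g : has_order n f -> has_order n g -> has_order n (f + g).
Proof. by move=> hf hg m mn /=; rewrite hf// hg// addr0. Qed.

Lemma has_order_sum n (T : Type) (r : seq T) (F : T -> fps K A) :
  (forall t, has_order n (F t)) -> has_order n (\sum_(t <- r) F t).
Proof. by move=> hF m mn; rewrite fcoef_sum big1// => t _; exact: hF. Qed.

Lemma has_orderMl n f g : has_order n g -> has_order n (f * g).
Proof. by move=> hg; rewrite -[n]add0n; apply: has_orderM. Qed.

Lemma has_order_var i : has_order 1 (fvar A i).
Proof.
move=> m; rewrite ltnS leqn0 => /eqP m0 /=; case: eqP => // mE.
move: m0; rewrite mE /degm (bigD1 i)//= ffunE eqxx.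
by [].
Qed.

End FpsTheory.

(** * Exponential series *)

Section Exponential.
Variables (K : finType) (F : numFieldType).
Implicit Types (f g : fps K F) (m : {ffun K -> nat}).

(** Powers beyond the degree contribute nothing, so coefficients at different exponents can share
    one truncation bound. *)
Lemma fcoef_fexp B f m : has_order 1 f -> (degm m < B)%N ->
  fcoef (fexp f) m = \sum_(n < B) fcoef (f ^+ n) m / n`!%:R.
Proof.
move=> f1 mB; rewrite /= -/(degm m).
rewrite (big_ord_widen B (fun n => fcoef (f ^+ n) m / n`!%:R))//.
rewrite [RHS](bigID (fun n : 'I_B =>
  (n < (degm m).+1)%N)) /= [X in _ = _ + X]big1 ?addr0// => n.
by rewrite -leqNgt => mn; rewrite (has_orderX f1) ?mul0r.
Qed.

(** The index change of the Cauchy product; the corner that completes the triangle to a square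
    vanishes. *)
Lemma triangular_sum (V : nmodType) B (T : nat -> nat -> V) :
  (forall a b, (B <= a + b)%N -> T a b = 0) ->
  \sum_(n < B) \sum_(i < n.+1) T (n - i)%N i = \sum_(a < B) \sum_(b < B) T a b.
Proof.
move=> T0.
transitivity (\sum_(n < B) \sum_(i < B | (i < n.+1)%N) T (n - i)%N i).
  by apply: eq_bigr => n _; rewrite (big_ord_widen B (fun i => T (n - i)%N i)).
rewrite (exchange_big_dep xpredT)//= [RHS]exchange_big /=; apply: eq_bigr => i _.
rewrite -(big_mkord (fun n => i < n.+1)%N (fun n => T (n - i)%N i)).
rewrite (big_cat_nat (n := i)) //=; last exact: ltnW.
rewrite [X in X + _]big_nat_cond [X in X + _]big1 ?add0r; last first.
  by move=> n /andP[/andP[_ ni]]; rewrite ltnS leqNgt ni.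
rewrite -{1}[nat_of_ord i]add0n big_addn.
rewrite (eq_bigl xpredT) => [|n]; last by rewrite ltnS leq_addl.
rewrite (eq_bigr (fun n => T n i)) => [|n _]; last by rewrite addnK.
rewrite -(big_mkord xpredT (fun n =>
  T n i)) [RHS](big_cat_nat (n := (B - i)%N)) ?leq_subr//=.
rewrite [X in _ = _ + X]big_nat [X in _ = _ + X]big1 ?addr0// => a /andP[Ba _].
by apply: T0; move: Ba; rewrite leq_subLR addnC.
Qed.

Lemma fexpD f g : has_order 1 f -> has_order 1 g -> fexp (f + g) = fexp f * fexp g.
Proof.
move=> f1 g1; apply/fpsP => m; have fg1 := has_orderD f1 g1.
pose B := (degm m).+1.
pose T a b := fcoef (f ^+ a * g ^+ b) m / (a`!%:R * b`!%:R).
rewrite (fcoef_fexp (B := B) fg1)//.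
transitivity (\sum_(n < B) \sum_(i < n.+1) T (n - i)%N i).
  apply: eq_bigr => n _; rewrite exprDn fcoef_sum mulr_suml; apply: eq_bigr => i _.
  rewrite /T -mulr_natl -fconst_nat fcoef_const mulrAC mulrC; congr (_ * _).
  have ni : (i <= n)%N by rewrite -ltnS.
  rewrite -(bin_fact ni) !natrM;
    have h k : k`!%:R != 0 :> F by rewrite pnatr_eq0 -lt0n fact_gt0.
  have hb : 'C(n, i)%:R != 0 :> F by rewrite pnatr_eq0 -lt0n bin_gt0.
  by field; rewrite !h hb.
rewrite triangular_sum; last first.
  move=> a b ab; rewrite /T (has_orderM (has_orderX f1) (has_orderX g1)) ?mul0r//.
rewrite fcoefM [RHS]big_seq.
rewrite [RHS](eq_bigr (fun u => \sum_(a < B) \sum_(b < B)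
    fcoef (f ^+ a) u * fcoef (g ^+ b) (expo_sub m u) / (a`!%:R * b`!%:R))); last first.
  move=> u; rewrite mem_below => um; have du := degm_sub um.
  have uB : (degm u < B)%N by rewrite ltnS -du leq_addr.
  have vB : (degm (expo_sub m u) < B)%N by rewrite ltnS -du leq_addl.
  rewrite [X in X * _ = _](fcoef_fexp f1 uB) [X in _ * X = _](fcoef_fexp g1 vB).
  rewrite big_distrlr /=; apply: eq_bigr => a _; apply: eq_bigr => b _.
  by rewrite invfM mulrACA.
rewrite -big_seq [RHS]exchange_big; apply: eq_bigr => a _ /=;
  rewrite [RHS]exchange_big; apply: eq_bigr => b _ /=.
by rewrite /T fcoefM big_distrl.
Qed.

Lemma fexp0 : fexp 0 = 1 :> fps K F.
Proof.
apply/fpsP => m /=; rewrite big_ord_recl expr0 divr1 big1 ?addr0//= => n _.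
by rewrite /bump /= add1n exprS mul0r /= mul0r.
Qed.

Lemma fexp_sum (T : Type) (r : seq T) (f : T -> fps K F) :
  (forall t, has_order 1 (f t)) -> fexp (\sum_(t <- r) f t) = \prod_(t <- r) fexp (f t).
Proof.
move=> h; elim: r => [|t r IHr]; first by rewrite !big_nil fexp0.
by rewrite !big_cons fexpD ?IHr//; exact: has_order_sum.
Qed.

End Exponential.

Section OneVariable.
Variable A : comNzRingType.

Lemma fcoef_var_exp k (c : A) (m : {ffun unit -> nat}) :
  fcoef (fvar A tt ^+ k * fconst unit c) m = if m tt == k then c else 0.
Proof.
elim: k m => [|k IHk] m.
  rewrite expr0 mul1r /=; congr (if _ then _ else _).
  apply/eqP/eqP => [->|m0]; first by rewrite ffunE.
  by apply/ffunP => -[]; rewrite ffunE.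
rewrite exprS -mulrA fcoefM; pose e : {ffun unit -> nat} := [ffun j => (j == tt) : nat].
have eE j : e j = 1%N by rewrite ffunE; case: j.
have [em|em] := boolP (e \in below m); last first.
  rewrite big_seq big1 => [|u um]; last first.
    by rewrite /=; case: eqP => [uE|]; [move: em; rewrite -/e in uE;
      rewrite -uE um|rewrite mul0r].
  case: eqP => // mk; move: em; rewrite mem_below => /negP[]; apply/forallP => -[].
  by rewrite eE mk.
have var u : fcoef (fvar A tt) u = if u == e then 1 else 0 by [].
rewrite (bigD1_seq e) ?below_uniq// var eqxx mul1r IHk big1; last first.
  by move=> u /negPf ue; rewrite var ue mul0r.
have -> : expo_sub m e tt = (m tt - e tt)%N by rewrite ffunE.
move: em; rewrite mem_below => /forallP/(_ tt); rewrite eE.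
case: (m tt) => // n _. by rewrite subn1 eqSS /= addr0.
Qed.

End OneVariable.

(** * The correlator *)

Section Expansion.
Variables (R : realType) (N : nat).
Local Notation I := (idx N).
Local Notation T3 := (I * I * I)%type.
Local Notation C := R[i].
Implicit Types (t : T3) (H : I -> I -> C).

Definition points t : (int * int) * (int * int) * (int * int) :=
  (val t.1.1, val t.1.2, val t.2).

Definition least_first t := idx_lt t.1.1 t.1.2 && idx_lt t.1.1 t.2.

(* Representatives of oriented triangles up to rotation. *)
Definition rep t := least_first t && ccw (points t).

Definition tomega t : fps I C := omega R t.1.1 t.1.2 t.2.

Definition hprod H (es : seq (I * I)) : C := \prod_(e <- es) H e.1 e.2.

Lemma cyclic_potentialE H : cyclic_potential H =
  \sum_(t | rep t) tomega t * fconst I (hprod H (triangle_edges t)).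
Proof.
rewrite /cyclic_potential.
under eq_bigr do rewrite pair_big_dep /=.
rewrite pair_big_dep /=.
rewrite (reindex (fun t : T3 => (t.1.1, (t.1.2, t.2)))) /=; last first.
  by exists (fun p : I * (I * I) => (p.1, p.2.1, p.2.2)) => [[[? ?] ?]|[? [? ?]]].
rewrite [RHS]big_mkcond [LHS]big_mkcond; apply: eq_bigr => -[[i j] k] _ /=.
rewrite /rep /least_first /=; case: ifP => //= lij.
rewrite /tomega /hprod /triangle_edges !big_cons big_nil /= mulr1 mulrA /omega.
by rewrite /ccw /=; case: ifP => // _; rewrite mul0r.
Qed.

Lemma omega_rot (i j k : I) : omega R j k i = omega R i j k.
Proof.
have E : fvar C j + fvar C k + fvar C i = fvar C i + fvar C j + fvar C k.
  by move: (fvar C j) (fvar C k) (fvar C i) => a b c; rewrite [LHS]addrC; exact: addrA.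
rewrite /omega orient_rot; case: (0 < _); last by [].
exact: (congr1 (fun z => fexp (_ * z)) E).
Qed.

Lemma tomega_trot t : tomega (rotate t) = tomega t.
Proof. exact: omega_rot. Qed.

Lemma hprod_trot H t : hprod H (triangle_edges (rotate t)) = hprod H (triangle_edges t).
Proof.
case: t => [[i j] k]; rewrite /hprod /triangle_edges /rotate !big_cons big_nil /=.
by rewrite !mulr1; ring.
Qed.

Lemma idx_ltxx (i : I) : idx_lt i i = false. Proof. by rewrite /idx_lt ltnn. Qed.

(** The corners of a nondegenerate triangle are distinct, so exactly one rotation starts with the
    least rank. *)
Lemma least_first_sum t : ccw (points t) ->
  (least_first t + least_first (rotate t) + least_first (rotate (rotate t)) = 1)%N.
Proof.
case: t => [[i j] k] /(ccw_neq R)[];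
  rewrite /points /least_first /rotate /idx_lt /= => ij jk ki.
have rij : (enum_rank i != enum_rank j :> nat).
  by rewrite (inj_eq val_inj) (inj_eq enum_rank_inj); apply: contraNneq ij => ->.
have rjk : (enum_rank j != enum_rank k :> nat).
  by rewrite (inj_eq val_inj) (inj_eq enum_rank_inj); apply: contraNneq jk => ->.
have rki : (enum_rank k != enum_rank i :> nat).
  by rewrite (inj_eq val_inj) (inj_eq enum_rank_inj); apply: contraNneq ki => ->.
move: rij rjk rki; move: (nat_of_ord (enum_rank i)) (nat_of_ord (enum_rank j))
  (nat_of_ord (enum_rank k)).
move=> a b c ab bc ca.
by case: (ltngtP a b) ab => // ? _; case: (ltngtP b c) bc => // ? _;
  case: (ltngtP c a) ca => // ? _; lia.
Qed.

Lemma trot3 (T : Type) (t : T * T * T) : rotate (rotate (rotate t)) = t.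
Proof. by case: t => [[? ?] ?]. Qed.

(** Each nonzero term is multiplied by 1, written as the sum of the three indicators of
    [least_first]; reindexing by rotation makes the three sums equal. *)
Lemma potentialE H : potential H = 3%:R * cyclic_potential H.
Proof.
pose w t : fps I C := tomega t * fconst I (hprod H (triangle_edges t)).
have wt_trot t : w (rotate t) = w t by rewrite /w tomega_trot hprod_trot.
have -> : potential H = \sum_t w t.
  rewrite /potential pair_bigA pair_bigA /=; apply: eq_bigr => -[[i j] k] _ /=.
  by rewrite /w /tomega /hprod /triangle_edges !big_cons big_nil /= mulr1 mulrA.
have w0 t : ~~ ccw (points t) -> w t = 0.
  by rewrite /w /tomega /omega /ccw => /negPf /= ->; rewrite mul0r.
rewrite cyclic_potentialE -/(w _).
have -> : \sum_(t | rep t) w t = \sum_t w t * (least_first t)%:R.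
  rewrite big_mkcond; apply: eq_bigr => t _; rewrite /rep.
  case: (boolP (ccw (points t))) => [_|/w0 ->]; last by rewrite andbF mul0r.
  by rewrite andbT; case: ifP => _; rewrite ?mulr1 ?mulr0.
have rot_inj : bijective (@rotate I).
  by exists (fun t => rotate (rotate t)) => t; exact: trot3.
have E : \sum_t w t * (least_first (rotate t))%:R = \sum_t w t * (least_first t)%:R.
  rewrite [RHS](reindex (@rotate I)); last exact: onW_bij.
  by apply: eq_bigr => t _; rewrite wt_trot.
have E2 : \sum_t w t * (least_first (rotate (rotate t)))%:R = \sum_t w t *
  (least_first t)%:R.
  rewrite -[RHS]E [RHS](reindex (@rotate I)); last exact: onW_bij.
  by apply: eq_bigr => t _; rewrite wt_trot.
transitivity (\sum_t (w t * (least_first t)%:R + w t * (least_first (rotate t))%:R +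
    w t * (least_first (rotate (rotate t)))%:R)).
  apply: eq_bigr => t _; case: (boolP (ccw (points t))) => [ct|/w0 ->].
    by rewrite -!mulrDr -!natrD least_first_sum// mulr1.
  by rewrite !mul0r !addr0.
by rewrite !big_split /= E E2 mulr_natl 2!mulrSr mulr1n.
Qed.

Definition all_edges (v : seq I) (ts : seq T3) : seq (I * I) :=
  sides v ++ flatten (map (@triangle_edges I) ts).

Definition moment es : C := edge_moment (@nmom R N) (@entry_form R N) es.

Lemma hprod_all_edges H v ts :
  hprod H (all_edges v ts) = hprod H (sides v) * \prod_(t <- ts) hprod H
    (triangle_edges t).
Proof. by rewrite /hprod big_cat big_flatten big_map. Qed.

(** The factor [n] is 1 or 3, for the two potentials. At a fixed exponent in the x variables the
    integrand is a polynomial in H, expanded over choice functions of triangles. *)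
Lemma correlator_coef (n : nat) (W : (I -> I -> C) -> fps I C) v m :
  (forall H, W H = n%:R * cyclic_potential H) ->
  fcoef (correlator W v) m = fconst I ((m tt)`!%:R^-1) *
    \sum_(f : {ffun 'I_(m tt) -> T3} | f \in ffun_on rep)
      fconst I (moment (all_edges v (codom f))) * (n ^ m tt)%:R * \prod_l tomega (f l).
Proof.
move=> WE /=; set k := m tt; congr (_ * _); apply/fpsP => mm.
rewrite [LHS]/=.
pose c (f : {ffun 'I_k -> T3}) : C := (n ^ k)%:R * fcoef (\prod_l tomega (f l)) mm.
pose r := [seq f <- index_enum {ffun 'I_k -> T3} | f \in ffun_on rep].
have WkE H : fcoef (fconst I (hprod H (sides v)) * W H ^+ k) mm =
    \sum_(f <- r) c f * hprod H (all_edges v (codom f)).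
  rewrite fcoef_const WE exprMn -natrX -fconst_nat fcoef_const cyclic_potentialE.
  rewrite -[X in _ ^+ X]card_ord -prodr_const (bigA_distr_big rep).
  rewrite fcoef_sum !mulr_sumr big_filter; apply: eq_bigr => f _.
  rewrite big_split -fconst_prod [X in fcoef X _]mulrC fcoef_const.
  rewrite hprod_all_edges /c codomE big_map.
  have -> : \prod_(t <- enum 'I_k) hprod H (triangle_edges (f t)) = \prod_l hprod H
    (triangle_edges (f l)).
    by rewrite big_enum.
  ring.
transitivity (average0 (fun H => \sum_(f <- r) c f * hprod H (all_edges v (codom f)))).
  by congr average0; apply/funext => H; rewrite -WkE.
rewrite (gexpands_average (v := \sum_(f <- r) c f * moment (all_edges v (codom f))));
  last first.
  exact: (gexpands_sum r c (fun f => gexpands_edges R (all_edges v (codom f)))).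
rewrite fcoef_sum big_filter; apply: eq_bigr => f _.
by rewrite -mulrA fcoef_const -fconst_nat fcoef_const mulrC.
Qed.

End Expansion.

Section Counting.
Variables (T : finType) (V : comPzRingType) (Q : pred T) (w : T -> V) (k : nat).
Variables (good : {ffun 'I_k -> T} -> bool) (goodS : {set T} -> bool).
Hypothesis good_inj : forall f, f \in ffun_on Q -> good f -> injective f.
Hypothesis good_image : forall f, f \in ffun_on Q -> injective f ->
  good f = goodS (f @: 'I_k).

Lemma sum_over_images :
  \sum_(f in ffun_on Q | good f) \prod_l w (f l) =
  k`!%:R * \sum_(F : {set T} | [&& F \subset Q, goodS F & #|F| == k]) \prod_(t in F) w t.
Proof.
rewrite (partition_big (fun f : {ffun 'I_k -> T} => f @: 'I_k)
  (fun F => [&& F \subset Q, goodS F & #|F| == k])) /=; last first.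
  move=> f /andP[fQ gf]; have fi := good_inj fQ gf.
  rewrite -good_image// gf card_imset// card_ord eqxx andbT.
  by rewrite andbT; apply/fintype.subsetP => t /imsetP[l _ ->]; exact: (ffun_onP fQ).
rewrite mulr_sumr; apply: eq_bigr => F /and3P[FQ gF /eqP Fk].
transitivity (\sum_(f :
  {ffun 'I_k -> T} | (f \in ffun_on F) && injectiveb f) \prod_(t in F) w t).
  apply: eq_big => [f|f /andP[/andP[fQ gf] /eqP <-]]; last first.
    rewrite big_imset /=; last by move=> ? ? _ _; exact: good_inj fQ gf _ _.
    by [].
  apply/andP/andP => [[/andP[fQ gf] /eqP fF]|[fF /injectiveP fi]].
    split; last exact/injectiveP/good_inj.
    by apply/ffun_onP => l; rewrite -fF imset_f.
  have fQ : f \in ffun_on Q.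
    by apply/ffun_onP => l; apply: (fintype.subsetP FQ); exact: (ffun_onP fF).
  have imF : f @: 'I_k = F.
    apply/eqP; rewrite eqEcard card_imset// card_ord Fk leqnn andbT.
    by apply/fintype.subsetP => t /imsetP[l _ ->]; exact: (ffun_onP fF).
  by rewrite fQ good_image// imF gF eqxx.
rewrite sumr_const mulr_natl; congr (_ *+ _).
by rewrite -[LHS]cardsE (card_inj_ffuns_on) card_ord Fk ffactnn.
Qed.

End Counting.

(** * Triangulations as balanced families of representatives *)

Section Bijection.
Variables (R : realType) (N : nat).
Local Notation I := (idx N).
Local Notation T3 := (I * I * I)%type.
Local Notation P := (int * int)%type.
Variables (s : seq P) (v : seq I).
Hypothesis s_polygon : clockwise_polygon R s.
Hypothesis vs : map val v = s.
Implicit Types (t : T3) (F : {set T3}) (ts : seq T3).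

Local Notation rep := (@rep N).

Definition val2 (e : I * I) : P * P := (val e.1, val e.2).

Lemma val2_inj : injective val2.
Proof. by move=> [i j] [k l] [/val_inj -> /val_inj ->]. Qed.

Lemma points_inj : injective (@points N).
Proof. by move=> [[i j] k] [[i' j'] k'] [/val_inj -> /val_inj -> /val_inj ->]. Qed.

Lemma sides_map (A B : Type) (h : A -> B) (l : seq A) :
  sides (map h l) = [seq (h e.1, h e.2) | e <- sides l].
Proof.
rewrite /sides -map_rot; elim: l (rot 1 l) => [|x l IHl] [|y l'] //=.
by rewrite IHl.
Qed.

Lemma all_edges_val2 ts : map val2 (all_edges v ts) =
  sides s ++ flatten (map (@triangle_edges P) (map (@points N) ts)).
Proof.
rewrite /all_edges map_cat -vs sides_map map_flatten -!map_comp; congr (_ ++ flatten _).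
Qed.

Lemma all_edges_flip ts : map val2 (map (@flip I) (all_edges v ts)) =
  map (@flip P) (map val2 (all_edges v ts)).
Proof. by rewrite -!map_comp. Qed.

Definition balanced ts := perm_eq (all_edges v ts) (map (@flip I) (all_edges v ts)).

Lemma balanced_val2 ts : balanced ts =
  perm_eq (sides s ++ flatten (map (@triangle_edges P) (map (@points N) ts)))
    (map (@flip P) (sides s ++ flatten (map (@triangle_edges P) (map (@points N) ts)))).
Proof.
rewrite -all_edges_val2 -all_edges_flip /balanced; apply/idP/idP => [|h].
  exact: perm_map.
apply: perm_map_inj h; exact: val2_inj.
Qed.

Lemma rep_ccw ts : {subset ts <= rep} -> forall T, T \in map (@points N) ts -> ccw T.
Proof. by move=> tsr T /mapP[t /tsr /andP[_ ct] ->]. Qed.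

Lemma balanced_uniq ts : {subset ts <= rep} -> balanced ts -> uniq (all_edges v ts).
Proof.
move=> tsr; rewrite balanced_val2 => bal.
by rewrite -(map_inj_uniq val2_inj) all_edges_val2;
  exact: edges_uniq s_polygon (rep_ccw tsr) bal.
Qed.

Lemma balanced_uniq_ts ts : {subset ts <= rep} -> balanced ts -> uniq ts.
Proof.
move=> tsr bal; have := balanced_uniq tsr bal; rewrite cat_uniq => /and3P[_ _].
elim: ts {tsr bal} => // t ts IHts.
change (uniq (triangle_edges t ++ flatten (map (@triangle_edges I) ts)) -> uniq (t ::
  ts)).
rewrite cat_uniq => /and3P[_ /hasPn h /IHts uts]; rewrite /= uts andbT.
apply/negP => tts; have e1 : t.1 \in flatten (map (@triangle_edges I) ts).
  by apply/flatten_mapP; exists t => //; exact: mem_head.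
by have := h _ e1; rewrite mem_head.
Qed.

(** Balance is necessary for a nonzero moment; when it holds, the geometry excludes repeated edges
    and only one matching is left. *)
Lemma moment_balanced ts :
  {subset ts <= rep} -> moment R (all_edges v ts) = (balanced ts)%:R.
Proof.
move=> tsr; case: (boolP (balanced ts)) => bal; last first.
  apply/eqP; apply: contraNT bal.
  exact: (edge_moment_balanced (@nmomS R N) (@entry_form_pairing R N)).
apply: (edge_moment_uniq (@nmom0 R N) (@nmomS R N) (@entry_form_pairing R N)).
- exact: balanced_uniq.
- move=> e; rewrite mem_cat => /orP[es|/flatten_mapP[t tts et]].
    have := map_f val2 es;
      have -> : map val2 (sides v) = sides s by rewrite -vs sides_map.
    by move=> /(polygon_sides s_polygon) /=; apply: contraNneq => ->.
  have et' : val2 e \in triangle_edges (points t) by move: (map_f val2 et).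
  have := triangle_edges_neq R (rep_ccw tsr (map_f _ tts)) et'.
  by apply: contraNneq => /= ->.
move=> e; rewrite (perm_mem bal) => /mapP[e' e'v ->].
by rewrite /flip -surjective_pairing.
Qed.

Lemma perm_balanced ts ts' : perm_eq ts ts' -> balanced ts = balanced ts'.
Proof.
move=> tt; have E : perm_eq (all_edges v ts) (all_edges v ts').
  by rewrite perm_cat2l; apply/perm_flatten/perm_map.
by rewrite /balanced (permPl E) (permPr (perm_map _ E)).
Qed.

Definition tau_of F : {fset {fset P}} := [fset corners (points t) | t in enum F]%fset.

Definition balanced_family F := (F \subset rep) && balanced (enum F).

Lemma idx_lt_asym (i j : I) : idx_lt i j -> idx_lt j i = false.
Proof. by rewrite /idx_lt => /ltnW; rewrite leqNgt => /negPf. Qed.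

(** The corner set forgets the order: starting with the least index fixes the rotation, and
    orientation excludes the reflection. *)
Lemma points_rep_inj t t' :
  rep t -> rep t' -> corners (points t) = corners (points t') -> t = t'.
Proof.
case: t t' => [[i j] k] [[i' j'] k'] /andP[/andP[/= ij ik] c] /andP[/andP[/= ij' ik']
  c'] TT.
have mem (x : I) : (x \in [:: i; j; k]) = (x \in [:: i'; j'; k']).
  by move/fsetP/(_ (val x)): TT; rewrite !inE /= !val_eqE -!orbA.
have := mem i'; have := mem j'; have := mem k'; rewrite !inE !eqxx ?orbT.
have [/= n1 n2 n3] := ccw_neq R c'; rewrite !val_eqE in n1 n2 n3.
move=> /or3P[]/eqP hk /or3P[]/eqP hj /or3P[]/eqP hi; move: ij' ik' c' n1 n2 n3;
  rewrite hk hj hi ?eqxx //; rewrite ?(idx_lt_asym ij) ?(idx_lt_asym ik) ?idx_ltxx //.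
move=> _ _; move: c; rewrite /ccw /= -orient_rot orient_swap oppr_gt0 => c.
by rewrite -orient_rot ltNge (ltW c).
Qed.

Lemma tau_of_card F : F \subset rep -> #|` tau_of F| = #|F|.
Proof.
move=> /fintype.subsetP Fr; rewrite /tau_of card_in_imfset /=.
  by rewrite undup_id ?enum_uniq// cardE.
by move=> t t'; rewrite !mem_enum => /Fr rt /Fr rt'; exact: points_rep_inj.
Qed.

Lemma tau_of_tri F : balanced_family F -> triangulations R s (tau_of F).
Proof.
move=> /andP[/fintype.subsetP Fr bal].
have Er : {subset enum F <= rep} by move=> t; rewrite mem_enum => /Fr.
rewrite balanced_val2 in bal.
have := balanced_triangulation s_polygon (rep_ccw Er) bal.
congr (triangulations R s _); apply/fsetP => t; apply/imfsetP/imfsetP => -[x /= xin ->].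
  by move/mapP: xin => [u uF ->]; exists u.
by exists (points x) => //; exact: map_f.
Qed.

Hypothesis box : forall tau (t : {fset P}) a,
  triangulations R s tau -> t \in tau -> a \in t -> in_box N a.

Lemma rep_exists (t0 : {fset P}) : #|` t0| = 3%N -> area R t0 != 0 ->
  (forall a, a \in t0 -> in_box N a) -> exists2 t, rep t & corners (points t) = t0.
Proof.
move=> t3 a0 tbox; have [[[a b] c] cT TE] := area_ccw t3 a0.
have ab : in_box N a by apply: tbox; rewrite -TE !inE eqxx.
have bb : in_box N b by apply: tbox; rewrite -TE !inE eqxx ?orbT.
have cb : in_box N c by apply: tbox; rewrite -TE !inE eqxx ?orbT.
pose t : T3 := (Idx ab, Idx bb, Idx cb).
have ct : ccw (points t) by [].
have := least_first_sum R ct.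
have [l1 _|_] := boolP (least_first t); first by exists t; rewrite // /rep l1.
have [l2 _|_] := boolP (least_first (rotate t)).
  exists (rotate t); first by rewrite /rep l2 /= -(ccw_trot (points t)) in ct *.
  by rewrite -TE -(corners_trot (points t)).
have [l3 _|//] := boolP (least_first (rotate (rotate t))).
exists (rotate (rotate t)).
  by rewrite /rep l3 /= -(ccw_trot (points t)) -ccw_trot in ct *.
rewrite -TE; exact: etrans (corners_trot (rotate (points t))) (corners_trot (points t)).
Qed.

Lemma family_of_tri tau : triangulations R s tau -> exists2 F,
  balanced_family F & tau_of F = tau.
Proof.
(* All representatives with corners in tau; [box] ensures that no triangle of tau is missed. *)
move=> tri; pose F : {set T3} := [set t | rep t && (corners (points t) \in tau)]%SET.
have FE : tau_of F = tau.
  apply/fsetP => t0; apply/imfsetP/idP => [[t /=]|t0t].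
    by rewrite mem_enum inE => /andP[_ tt] ->.
  have [h _ _ _] := tri; have [t3 a0] := h _ t0t.
  have [t rt tE] := rep_exists t3 a0 (fun a => box tri t0t).
  by exists t => //=; rewrite mem_enum inE rt tE.
exists F => //; have Fr : F \subset rep by apply/fintype.subsetP => t;
  rewrite inE => /andP[].
rewrite /balanced_family Fr /=.
have Er : {subset enum F <= rep} by move=> t; rewrite mem_enum => /(fintype.subsetP Fr).
pose ts := map (@points N) (enum F).
have tsu : uniq ts by rewrite map_inj_uniq ?enum_uniq//; exact: points_inj.
have tsi : {in ts &, injective corners}.
  move=> _ _ /mapP[t tF ->] /mapP[t' t'F ->] /(points_rep_inj (Er _ tF) (Er _ t'F)).
  by move=> ->.
have tauE : tau = [fset corners T | T in ts]%fset.
  rewrite -FE; apply/fsetP => t; apply/imfsetP/imfsetP => -[x /= xin ->].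
    by exists (points x) => //; exact: map_f.
  by move/mapP: xin => [u uF ->]; exists u.
have uE := triangulation_uniq s_polygon (rep_ccw Er) tsu tsi tauE tri.
have fE := triangulation_flip s_polygon (rep_ccw Er) tsi tauE tri.
rewrite balanced_val2 -/ts; apply: uniq_perm => //.
  by rewrite map_inj_uniq//; exact: inv_inj flipK.
move=> e; apply/idP/mapP => [/fE ee|[e' /fE e'E ->//]].
by exists (flip e) => //; case: (e).
Qed.

Lemma tau_of_inj F F' :
  balanced_family F -> balanced_family F' -> tau_of F = tau_of F' -> F = F'.
Proof.
move=> /andP[/fintype.subsetP Fr _] /andP[/fintype.subsetP Fr' _] TT.
apply/setP => t; apply/idP/idP => tF.
  have : corners (points t) \in tau_of F' by rewrite -TT; apply/imfsetP; exists t;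
    rewrite //= mem_enum.
  move=> /imfsetP[t' /=]; rewrite mem_enum => t'F tE.
  by rewrite (points_rep_inj (Fr _ tF) (Fr' _ t'F) tE).
have : corners (points t) \in tau_of F by rewrite TT; apply/imfsetP; exists t;
  rewrite //= mem_enum.
move=> /imfsetP[t' /=]; rewrite mem_enum => t'F tE.
by rewrite (points_rep_inj (Fr' _ tF) (Fr _ t'F) tE).
Qed.

Lemma sum_triangulations (V : nmodType) (g : {fset {fset P}} -> V) :
  finite_set (triangulations R s) ->
  \sum_(tau \in triangulations R s) g tau = \sum_(F | balanced_family F) g (tau_of F).
Proof.
move=> fin; rewrite (fsbig_finite _ _ fin) /= -[RHS]big_filter -[RHS](big_map tau_of
  xpredT g).
apply: perm_big; apply: uniq_perm; first exact: fset_uniq.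
  rewrite map_inj_in_uniq ?filter_uniq ?index_enum_uniq// => F F'.
  by rewrite !mem_filter => /andP[fF _] /andP[fF' _]; exact: tau_of_inj.
move=> tau; rewrite in_fset_set//; apply/idP/mapP => [|[F]].
  rewrite inE => /family_of_tri[F fF <-]; exists F => //.
  by rewrite mem_filter fF mem_index_enum.
by rewrite mem_filter inE => /andP[fF _] ->; exact: tau_of_tri.
Qed.

End Bijection.

(** * Weights of triangulations *)

Lemma fconst_int (K : finType) (A : comNzRingType) (z : int) :
  fconst K z%:~R = z%:~R :> fps K A.
Proof.
case: z => n; first by rewrite -!pmulrn fconst_nat.
rewrite NegzE !mulrNz -!pmulrn -fconst_nat.
by apply/fpsP => m /=; case: ifP; rewrite ?oppr0.
Qed.

Lemma has_order_scaled_vars (K : finType) (A : comNzRingType) (c : fps K A) (i j k : K) :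
  has_order 1 (c * (fvar A i + fvar A j + fvar A k)).
Proof.
apply: has_orderMl; apply: has_orderD; last exact: has_order_var.
by apply: has_orderD; exact: has_order_var.
Qed.

Lemma fconst_half (K : finType) (F : numFieldType) (z : int) (X : fps K F) :
  2%:R * (fconst K (z%:~R / 2) * X) = z%:~R * X.
Proof.
by rewrite mulrA -fconst_nat -fconstM -fconst_int mulrCA mulfV ?mulr1//.
Qed.

Lemma fconst_factV (K : finType) (F : numFieldType) n :
  fconst K (n`!%:R^-1) * n`!%:R = 1 :> fps K F.
Proof. by rewrite -fconst_nat -fconstM mulVf// pnatr_eq0 -lt0n fact_gt0. Qed.

Section Weights.
Variables (R : realType) (N : nat).
Local Notation I := (idx N).
Local Notation T3 := (I * I * I)%type.
Local Notation P := (int * int)%type.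
Local Notation C := R[i].
Implicit Types (t : T3) (F : {set T3}).
Local Notation rep := (@rep N).

Definition exponent t : fps I C :=
  (orient (val t.1.1) (val t.1.2) (val t.2))%:~R * (fvar C t.1.1 + fvar C t.1.2 +
    fvar C t.2).

Lemma tomega_exp t : rep t -> tomega R t = fexp (exponent t).
Proof. by move=> /andP[_ ct]; rewrite /tomega /omega ifT. Qed.

Lemma xvar_val (i : I) : xvar R N (val i) = fvar C i.
Proof. by rewrite /xvar valK. Qed.

Lemma sum_tpts (V : nmodType) (T : P * P * P) (f : P -> V) : ccw T ->
  \sum_(a <- corners T) f a = f T.1.1 + f T.1.2 + f T.2.
Proof.
move=> /(ccw_neq R)[ab bc ca].
rewrite (perm_big [:: T.1.1; T.1.2; T.2]) /=.
  by rewrite !big_cons big_nil addr0 addrA.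
apply: uniq_perm; rewrite ?fset_uniq//= ?inE ?negb_or ?ab ?bc ?[_ == T.2]eq_sym ?ca//.
by move=> a; rewrite !inE orbA.
Qed.

Lemma finsupp_phi (s : seq P) tau : triangulations R s tau ->
  finsupp (phi_poly R tau) = vertices tau.
Proof.
move=> tri; apply/fsetP => a; rewrite mem_finsupp.
apply/idP/idP => [|av]; first by rewrite fsfunE; case: ifP => //; rewrite eqxx.
by rewrite (phi_polyE R av) gt_eqF// (phi_gt0 tri av).
Qed.

(** Double counting of pairs of a triangle and one of its vertices. *)
Lemma poly_series_phi (s : seq P) tau : triangulations R s tau ->
  poly_series N (phi_poly R tau) =
  \sum_(t0 <- tau) fconst I ((area R t0)%:C)%C * \sum_(a <- t0) xvar R N a.
Proof.
move=> tri; rewrite /poly_series (finsupp_phi tri).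
rewrite (eq_big_seq (fun a => \sum_(t0 <- tau | a \in t0)
    fconst I ((area R t0)%:C)%C * xvar R N a)); last first.
  move=> a av; rewrite (phi_polyE R av) /phi rmorph_sum fconst_sum mulr_suml.
  by [].
rewrite (exchange_big_dep xpredT)//= big_seq [RHS]big_seq; apply: eq_bigr => t0 t0t.
rewrite mulr_sumr -big_filter; apply: perm_big; apply: uniq_perm.
- by rewrite filter_uniq// fset_uniq.
- exact: fset_uniq.
move=> a; rewrite mem_filter; case: (boolP (a \in t0)) => //= at0.
by apply/(verticesP tau); exists t0.
Qed.

Lemma fexp_weight (s : seq P) (v : seq I) F :
  F \subset rep -> triangulations R s (tau_of F) ->
  fexp (2%:R * poly_series N (phi_poly R (tau_of F))) = \prod_(t in F) tomega R t.
Proof.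
move=> /fintype.subsetP Fr tri; rewrite (poly_series_phi tri).
have -> : 2%:R * (\sum_(t0 <- tau_of F) fconst I ((area R t0)%:C)%C * \sum_(a <- t0)
  xvar R N a) =
    \sum_(t <- enum F) exponent t.
  rewrite mulr_sumr (perm_big [seq corners (points t) | t <- enum F]) /=; last first.
    apply: uniq_perm; first exact: fset_uniq.
      rewrite map_inj_in_uniq ?enum_uniq// => t t'; rewrite !mem_enum => /Fr rt /Fr rt'.
      exact: points_rep_inj.
    by move=> a; apply/imfsetP/mapP => -[t tF ->]; exists t.
  rewrite big_map big_seq [RHS]big_seq; apply: eq_bigr => t; rewrite mem_enum => /Fr rt.
  have ct : ccw (points t) by case/andP: rt.
  rewrite (sum_tpts _ ct) /= !xvar_val area_tpts//.
  have -> : ((orient (val t.1.1) (val t.1.2) (val t.2))%:~R / 2)%:C%C =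
      (orient (val t.1.1) (val t.1.2) (val t.2))%:~R / 2 :> C.
    by rewrite rmorphM rmorph_int fmorphV rmorph_nat.
  exact: fconst_half.
rewrite fexp_sum => [|t]; last exact: has_order_scaled_vars.
rewrite -big_enum big_seq [RHS]big_seq; apply: eq_bigr => t; rewrite mem_enum => /Fr rt.
by rewrite tomega_exp.
Qed.

End Weights.

Section Correlator.
Variables (R : realType) (N : nat).
Local Notation I := (idx N).
Local Notation T3 := (I * I * I)%type.
Local Notation P := (int * int)%type.
Local Notation C := R[i].
Variables (s : seq P) (v : seq I).
Hypothesis s_polygon : clockwise_polygon R s.
Hypothesis vs : map val v = s.
Hypothesis sN : all (in_box N) s.

Lemma moment_sum (k n : nat) :
  \sum_(f : {ffun 'I_k -> T3} | f \in ffun_on (@rep N))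
      fconst I (moment R (all_edges v (codom f))) * (n ^ k)%:R * \prod_l tomega R (f l) =
  (k`! * n ^ k)%:R * \sum_(F | balanced_family v F && (#|F| == k)) \prod_(t in F)
    tomega R t.
Proof.
have sub (f : {ffun 'I_k -> T3}) : f \in ffun_on (@rep N) -> {subset codom f <= @rep N}.
  by move=> fr _ /codomP[l ->]; exact: (ffun_onP fr).
transitivity ((n ^ k)%:R * \sum_(f :
  {ffun 'I_k -> T3} | (f \in ffun_on (@rep N)) && balanced v (codom f))
    \prod_l tomega R (f l)).
  rewrite mulr_sumr big_mkcondr; apply: eq_bigr => f fr.
  rewrite (moment_balanced s_polygon vs (sub f fr)); case: ifP => _.
    by rewrite fconst1 mul1r.
  by rewrite fconst0 !mul0r.
rewrite (@sum_over_images _ _ _ _ _ (fun f => balanced v (codom f)) (fun F =>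
  balanced v (enum F))).
- rewrite mulrA natrM [X in X * _ = _]mulrC; congr (_ * _).
  by apply: eq_bigl => F; rewrite /balanced_family andbA.
- move=> f fr bal; apply/injectiveP.
  have := balanced_uniq_ts s_polygon vs (sub f fr) bal.
  by rewrite /injectiveb /dinjectiveb.
move=> f fr fi; apply: perm_balanced; apply: uniq_perm.
- by move: fi => /injectiveP.
- exact: enum_uniq.
by move=> t; rewrite mem_enum; apply/codomP/imsetP => [[l ->]|[l _ ->]]; exists l.
Qed.

Lemma correlator_triangulations n (W : (I -> I -> C) -> fps I C) :
  (forall H, W H = n%:R * cyclic_potential H) ->
  correlator W v = \sum_(tau \in triangulations R s)
    (n%:R * beta R N) ^+ #|` tau| *
    fconst unit (fexp (2%:R * poly_series N (phi_poly R tau))).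
Proof.
move=> WE; apply/fpsP => m; rewrite (correlator_coef v m WE) moment_sum.
have box tau (t : {fset P}) a := @triangulation_box R s N sN tau t a.
rewrite (sum_triangulations s_polygon vs box) ?fcoef_sum;
  last exact: triangulations_finite sN.
rewrite big_mkcondr mulr_sumr mulr_sumr; apply: eq_bigr => F fF.
have Fr : F \subset @rep N by case/andP: fF.
rewrite (tau_of_card R Fr) (fexp_weight v Fr (tau_of_tri s_polygon vs fF)).
rewrite exprMn -natrX -(@fconst_nat unit) -[X in _ = fcoef X _]mulrA fcoef_const
  fcoef_var_exp eq_sym.
case: ifP => [/eqP <-|_]; last by rewrite !mulr0.
by rewrite natrM -mulrA [LHS]mulrA fconst_factV mul1r.
Qed.

End Correlator.

Unset Implicit Arguments.
Set Strict Implicit.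
Set Printing Implicit Defensive.

Theorem theorem1 (R : realType) (s : seq (int * int))
    (s_polygon : clockwise_polygon R s) :
  [/\ finite_set (triangulations R s),
      exists N0 : nat, forall N : nat, (N0 <= N)%N ->
      exists2 v : seq (idx N), map val v = s &
        correlator (@cyclic_potential R N) v =
          \sum_(tau \in triangulations R s)
            beta R N ^+ #|` tau| *
            fconst unit (fexp (2%:R * poly_series N (phi_poly R tau)))
        /\
        correlator (@potential R N) v =
          \sum_(tau \in triangulations R s)
            (3%:R * beta R N) ^+ #|` tau| *
            fconst unit (fexp (2%:R * poly_series N (phi_poly R tau))) &
      forall tau, triangulations R s tau ->
        [/\ forall a, a \in vertices tau -> phi_poly R tau a = phi R tau a,
            newton (phi_poly R tau) = hull (region s) &
            @convex_set R (plane R) (region s) ->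
              newton (phi_poly R tau) = region s]].
Proof.
(* A bound on the polygon alone suffices, since every triangulation vertex lies in the same box. *)
pose N0 := \max_(a <- s) maxn (absz a.1) (absz a.2).
have sN N : (N0 <= N)%N -> all (in_box N) s.
  move=> N0N; apply/allP => a as_.
  have : (maxn (absz a.1) (absz a.2) <= N)%N.
    apply: leq_trans N0N; rewrite /N0 (big_rem a)//=; exact: leq_maxl.
  by rewrite geq_max /in_box -!abszE !lez_nat.
split.
- exact: triangulations_finite (sN N0 (leqnn _)).
- exists N0 => N /sN sNN.
  have [v vs] : exists v : seq (idx N), map val v = s.
    elim: s sNN {s_polygon N0 sN} => [|a s' IHs] /=; first by exists [::].
    by move=> /andP[aN /IHs[v <-]]; exists (Idx aN :: v).
  exists v => //; split.
    have := correlator_triangulations s_polygon vs sNN (n := 1) (W := @cyclic_potential R N).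
    by rewrite mul1r; apply => H; rewrite mul1r.
  exact: correlator_triangulations (potentialE (R := R) (N := N)).
move=> tau tri; have nE := newton_region tri; split=> //.
  by move=> a; exact: phi_polyE.
by move=> cr; rewrite nE; exact: hull_id.
Qed.
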